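(* Let $X$ be a real Banach space with separable dual $X^\star$. Then the following are equivalent: (i) for every open set $G\subset X$, every Lipschitz function $f:G\to\mathbb{R}$ is $\Gamma$-almost everywhere Fréchet differentiable (i.e. the set of points of $G$ at which $f$ is not Fréchet differentiable is $\Gamma$-null); (ii) every $\sigma$-porous set in $X$ is $\Gamma$-null.
   Context: $f$ is Fréchet differentiable at $x$ if there is $x^\star\in X^\star$ with $f(x+u)=f(x)+x^\star(u)+o(\|u\|)$ as $\|u\|\to0$. $B(z,r)$ is the closed ball with center $z$ and radius $r$. A set $A\subset X$ is porous if there is $0<c<1$ such that for every $x\in A$ there are $y_n\in X$ with $y_n\to x$ and $B(y_n,c\,\|y_n-x\|)\cap A=\emptyset$ for every $n$. A set is $\sigma$-porous if it is a union of countably many porous sets. $\Gamma$-null sets. $T=[0,1]^{\mathbb{N}}$ carries the product topology and the product Lebesgue (probability) measure $\mu$. $\Gamma(X)$ is the space of continuous maps $\gamma:T\to X$ having continuous partial derivatives $D_j\gamma:T\to X$ for all $j\in\mathbb{N}$ (one-sided where the $j$-th coordinate is $0$ or $1$), with the topology generated by the seminorms $\|\gamma\|_0=\sup_{t\in T}\|\gamma(t)\|$ and $\|\gamma\|_k=\sup_{t\in T}\|D_k\gamma(t)\|$, $k\ge1$. A Borel set $N\subset X$ is $\Gamma$-null if $\mu\{t\in T:\gamma(t)\in N\}=0$ for all $\gamma$ in a residual (comeager) subset of $\Gamma(X)$. An arbitrary set is $\Gamma$-null if it is contained in a Borel $\Gamma$-null set. *)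

(* Defs.v *)
From HB Require Import structures.
From mathcomp Require Import all_boot all_order all_algebra.
From mathcomp Require Import all_classical all_reals all_analysis.

Set Implicit Arguments.
Unset Strict Implicit.
Unset Printing Implicit Defensive.

Import Order.TTheory GRing.Theory Num.Theory.
Import numFieldNormedType.Exports.

Local Open Scope classical_set_scope.
Local Open Scope ring_scope.

Section dual.
Context {R : realType} (X : normedModType R).

Definition dual_norm (phi : X -> R) : R :=
  sup [set `|phi x| | x in [set x | `|x| <= 1]].

Definition separable_dual : Prop :=
  exists D : set {linear X -> R},
    [/\ countable D,
        forall phi, D phi -> continuous phi
      & forall psi : {linear X -> R}, continuous psi ->
          forall e : R, 0 < e ->
          exists2 phi, D phi & dual_norm (fun x => psi x - phi x) < e].

End dual.

Section porosity.
Context {R : realType} {X : normedModType R}.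

(* [closed_ball_ Num.norm z r] is [{y | `|z - y| <= r}]; the library's
   [closed_ball z r], a closure of an open ball, is empty for r = 0. *)
Definition porous (A : set X) : Prop :=
  exists2 c : R, 0 < c < 1 &
    forall x, A x -> exists2 y : nat -> X,
      y n @[n --> \oo] --> x &
      forall n, closed_ball_ Num.norm (y n) (c * `|y n - x|) `&` A = set0.

Definition sigma_porous (A : set X) : Prop :=
  exists2 P : nat -> set X, (forall n, porous (P n)) & A = \bigcup_n P n.

End porosity.

Section category.
Context {T : topologicalType}.

Definition nowhere_dense (A : set T) : Prop := (closure A)^° = set0.

Definition meager (A : set T) : Prop :=
  exists2 F : nat -> set T, (forall n, nowhere_dense (F n)) &
    A = \bigcup_n F n.

Definition residual (A : set T) : Prop := meager (~` A).

End category.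

Definition unit_interval (R : realType) : Type := `[0 : R, 1]%classic.

HB.instance Definition _ (R : realType) :=
  Topological.copy (unit_interval R) (set_type `[0 : R, 1]%classic).

Fact unit_interval0_subproof (R : realType) : (0 : R) \in `[0 : R, 1]%classic.
Proof. by rewrite inE /= in_itv /= lexx ler01. Qed.

HB.instance Definition _ (R : realType) :=
  isPointed.Build (unit_interval R) (exist _ 0 (unit_interval0_subproof R)).

Definition cube (R : realType) : Type := nat -> unit_interval R.

HB.instance Definition _ (R : realType) :=
  Topological.copy (cube R) (prod_topology (fun _ : nat => unit_interval R)).

HB.instance Definition _ (R : realType) :=
  isPointed.Build (cube R) (fun=> point).

Section product_measure.
Context (R : realType).

Definition cube_cylinders : set (set (cube R)) :=
  [set C | exists j, exists2 A : set R, measurable A &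
    C = [set t : cube R | A (val (t j))]].

(* By the pi-lambda theorem at most one [mu] satisfies this; it exists by
   Kolmogorov's theorem. *)
Definition is_product_lebesgue (mu : set (cube R) -> \bar R) : Prop :=
  forall (n : nat) (A : nat -> set R), (forall j, measurable (A j)) ->
    mu [set t : cube R | forall j, (j < n)%N -> A j (val (t j))] =
    (\prod_(j < n) lebesgue_measure (A j `&` `[0%R : R, 1%R]%classic))%E.

End product_measure.

Notation cube_measurable R := (g_sigma_algebraType (@cube_cylinders R)).

Section surfaces.
Context {R : realType} {X : normedModType R}.

Definition partial_quotient (j : nat) (g : cube R -> X) (t : cube R)
    (s : unit_interval R) : X :=
  (val s - val (t j))^-1 *: (g (dfwith t j s) - g t).

(* The filter is that of [0, 1], so the derivative is one-sided where
   [t j] is 0 or 1. *)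
Definition has_partial (j : nat) (g : cube R -> X) : Prop :=
  forall t : cube R, cvg (partial_quotient j g t s @[s --> (t j)^']).

Definition partial (j : nat) (g : cube R -> X) (t : cube R) : X :=
  lim (partial_quotient j g t s @[s --> (t j)^']).

Definition sup_norm (g : cube R -> X) : R := sup (range (fun t => `|g t|)).

(* Coordinates of [cube R] are numbered from 0. *)
Definition surface_seminorm (k : nat) (g : cube R -> X) : R :=
  if k is j.+1 then sup_norm (partial j g) else sup_norm g.

End surfaces.

Record surface (R : realType) (X : normedModType R) := Surface {
  surface_fun :> cube R -> X;
  surface_continuous : continuous surface_fun;
  surface_has_partial : forall j, has_partial j surface_fun;
  surface_partial_continuous : forall j, continuous (partial j surface_fun) }.

Section surface_topology.
Context (R : realType) (X : normedModType R).

HB.instance Definition _ := gen_eqMixin (surface X).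
HB.instance Definition _ := gen_choiceMixin (surface X).

Definition surface_ball (n : nat) (e : R) (g : surface X) : set (surface X) :=
  [set h : surface X | forall k, (k <= n)%N ->
     surface_seminorm k (fun t => h t - g t) < e].

Definition surface_open : set (set (surface X)) :=
  [set U | forall g, U g -> exists n, exists2 e : R, 0 < e &
     surface_ball n e g `<=` U].

Fact surface_openT : surface_open setT.
Proof. by move=> g _; exists 0%N, 1. Qed.

Fact surface_openI : setI_closed surface_open.
Proof.
move=> U V oU oV g [Ug Vg].
have [m [d d0 dU]] := oU _ Ug; have [n [e e0 eV]] := oV _ Vg.
exists (maxn m n), (Num.min d e); first by rewrite lt_min d0.
move=> h hg; split; [apply: dU|apply: eV] => k km.
  have /hg : (k <= maxn m n)%N by rewrite leq_max km.
  by rewrite lt_min => /andP[].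
have /hg : (k <= maxn m n)%N by rewrite leq_max km orbT.
by rewrite lt_min => /andP[].
Qed.

Fact surface_open_bigcup (I : Type) (U : I -> set (surface X)) :
  (forall i, surface_open (U i)) -> surface_open (\bigcup_i U i).
Proof.
move=> oU g [i _ Ug]; have [n [e e0 eU]] := oU i _ Ug.
by exists n, e => // h /eU Uh; exists i.
Qed.

HB.instance Definition _ := isOpenTopological.Build (surface X)
  surface_openT surface_openI surface_open_bigcup.

End surface_topology.

Section gamma_null.
Context {R : realType} {X : normedModType R} (mu : set (cube R) -> \bar R).

Definition borel_gamma_null (N : set X) : Prop :=
  <<s @open X >> N /\
  exists2 S : set (surface X), residual S &
    forall g : surface X, S g -> mu [set t | N (g t)] = 0%E.

Definition gamma_null (A : set X) : Prop :=
  exists2 N : set X, borel_gamma_null N & A `<=` N.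

Definition gamma_ae_frechet (G : set X) (f : X -> R) : Prop :=
  gamma_null [set x | G x /\ ~ differentiable f x].

End gamma_null.

(* Main.v *)
(** The distance to a porous set is Lipschitz and is not differentiable at any point of the set,
    which gives one direction.

    For the other one, let [f] be Lipschitz.  A Lipschitz function of one variable is differentiable
    almost everywhere, and a generic surface has, for any given vector, a partial derivative close
    to a multiple of it; hence for generic surfaces [f] has directional derivatives along a dense
    sequence at almost every point.  Where moreover the increments of [f] near [x] in these
    directions obey the same asymptotics as at [x], which fails only on a sigma-porous set, the
    directional derivatives form a bounded linear functional and the second differences of [f] at
    [x] are small.

    As the dual is separable, it remains to see, for [g = f - phi] with [phi] in a countable dense
    set of functionals, that the set [B] of points where the directional slopes of [g] are at most
    [eps / 64] but [g (x + u) - g x] exceeds [eps * `|u|] for arbitrarily small [u] is Gamma-null.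
    Suppose that a generic surface [gam] meets [B] in positive measure.  Dropping the [m]-th
    coordinate, [m] large, changes [gam] little and frees that coordinate.  On disjoint small cells
    covering most of the parameters of [B] one adds [t_m u], where [u] is much smaller than the
    cell and [g] has a large increment along [u] on the whole cell.  The new surface is close to
    [gam], but along its [m]-th lines [g] varies so much that a fixed proportion of each line lies
    outside the set [E] of points with small slopes.  This contradicts that, for a Borel set [E],
    a generic surface is a point of continuity of [gam |-> gam^-1 E] relative to a residual set. *)

From HB Require Import structures.
Require Import Defs.
From mathcomp Require Import all_boot all_order all_algebra.
From mathcomp Require Import all_classical all_reals all_analysis.
From mathcomp Require Import measurable_realfun.
From mathcomp Require Import zify ring lra.
Set Implicit Arguments.
Unset Strict Implicit.
Unset Printing Implicit Defensive.

Import Order.TTheory GRing.Theory Num.Theory.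
Import numFieldNormedType.Exports.

Local Open Scope classical_set_scope.
Local Open Scope ring_scope.

(** The central obstacle is one of scale. A bump of height [|u|] on a cell of side [2^-k] has
    derivatives of order [|u| * 2^k], and these must stay small for the new surface to remain near
    the old one. So [|u|] is only a small multiple of [2^-k], and across the cell the old surface
    may move by much more than [|u|]: Lipschitz continuity alone cannot carry a large increment from
    one point of the cell to the others. Up to an error small compared with [|u|], however, the
    surface moves on the cell along the span of finitely many partial derivatives, and small second
    differences along finitely many directions do carry the increment. This is what the sigma-porous
    exceptional set pays for. Second differences are used rather than the derivative because they
    are unchanged when a functional is subtracted, so one exceptional set serves every [f - phi].

    The perturbed surface is explicit and need not be generic itself. It is approximated by a member
    of the residual set, hence the restriction to surfaces near which that set is dense. *)

(** * Lipschitz functions of one variable *)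

(* Real induction: [h] grows with slope [p] except on a set measured by [Phi], where only the
   slope [- A] is guaranteed. *)
Lemma growth (R : realType) (h Phi : R -> R) (a b p A : R) :
  a <= b -> 0 <= A + p ->
  (forall s s', a <= s -> s <= s' -> s' <= b -> Phi s <= Phi s') ->
  (forall s s', a <= s -> s <= s' -> s' <= b -> - A * (s' - s) <= h s' - h s) ->
  (forall s, a <= s -> s < b -> exists s', [/\ s < s', s' <= b &
     p * (s' - s) <= h s' - h s \/ s' - s <= Phi s' - Phi s]) ->
  p * (b - a) - (A + p) * (Phi b - Phi a) <= h b - h a.
Proof.
move=> ab Ap Phimono hlow step.
pose S := [set s | [/\ a <= s, s <= b &
  p * (s - a) - (A + p) * (Phi s - Phi a) <= h s - h a]].
have Sa : S a by split=> //; rewrite !subrr !mulr0 subrr.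
have supS : has_sup S by split; [exists a|exists b => x []].
pose c := sup S.
have ac : a <= c by apply: ub_le_sup => //; case: supS.
have cb : c <= b by apply: ge_sup; [exists a|move=> x []].
have K0 : 0 < 1 + `|A| + `|p|.
  by have := normr_ge0 A; have := normr_ge0 p; lra.
have Sc : S c.
  split=> //; apply/ler_addgt0Pr => e e0.
  have [s [as_ sb hs]] : exists2 s, S s & c - e / (1 + `|A| + `|p|) < s.
    by apply: sup_adherent => //; apply: divr_gt0.
  move=> ces; have sc : s <= c by apply: ub_le_sup => //; case: supS.
  have := hlow _ _ as_ sc cb; have := Phimono _ _ as_ sc cb.
  move=> PP hh.
  have cse : (c - s) * (1 + `|A| + `|p|) <= e.
    by rewrite -ler_pdivlMr//; lra.
  have : (A + p) * (c - s) <= e.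
    apply: le_trans cse; rewrite mulrC ler_wpM2l ?subr_ge0//.
    by rewrite lerD ?ler_norm// (le_trans (ler_norm _))// lerDr.
  have := ler_wpM2l Ap PP.
  lra.
have [<-|cneb] := eqVneq c b; first by case: Sc.
have {cneb}cb' : c < b by rewrite lt_neqAle cneb.
case: Sc => _ _ hc.
have [s' [cs' s'b Hs]] := step _ ac cb'.
suff Ss' : S s'.
  have : s' <= c by apply: ub_le_sup => //; case: supS.
  by rewrite leNgt cs'.
split=> //; first exact: le_trans (ltW cs').
have P1 := ler_wpM2l Ap (Phimono _ _ ac (ltW cs') s'b).
have h1 := hlow _ _ ac (ltW cs') s'b.
case: Hs => [H|H]; first lra.
have := ler_wpM2l Ap H; lra.
Qed.

(** Reflection: [s |-> - h (- s)] and [s |-> - Phi (- s)] turn steps to the left into steps to the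
    right. *)
Lemma growth_left (R : realType) (h Phi : R -> R) (a b p A : R) :
  a <= b -> 0 <= A + p ->
  (forall s s', a <= s -> s <= s' -> s' <= b -> Phi s <= Phi s') ->
  (forall s s', a <= s -> s <= s' -> s' <= b -> - A * (s' - s) <= h s' - h s) ->
  (forall s, a < s -> s <= b -> exists s', [/\ a <= s', s' < s &
     p * (s - s') <= h s - h s' \/ s - s' <= Phi s - Phi s']) ->
  p * (b - a) - (A + p) * (Phi b - Phi a) <= h b - h a.
Proof.
move=> ab Ap Pm hl step.
have := @growth R (fun s => - h (- s)) (fun s => - Phi (- s)) (- b) (- a) p A.
rewrite !opprK (addrC (- a)) (addrC (- Phi a)) (addrC (- h a)); apply => //.
- by rewrite lerN2.
- by move=> s s' *; rewrite lerN2; apply: Pm; lra.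
- by move=> s s' *; have := hl (- s') (- s); lra.
move=> s bs sa; have [||s' [as' s's H]] := step (- s); [lra|lra|].
exists (- s'); rewrite !opprK; split; [lra|lra|].
by case: H => H; [left|right]; lra.
Qed.

Section lipschitz_derivative.
Context {R : realType}.
Notation lam := (@lebesgue_measure R).

Let fin_itv (O : set R) (a s : R) : open O ->
  lam (O `&` `[a, s]) \is a fin_num.
Proof.
move=> oO; rewrite ge0_fin_numE//.
have mO : measurable O by exact: open_measurable.
apply: (@le_lt_trans _ _ (lam `[a, s])).
  by apply: le_measure; rewrite ?inE//; exact: measurableI.
by rewrite lebesgue_measure_itv/= -EFinD -(fun_if EFin) ltry.
Qed.

(** The function [Phi] for an open exceptional set [O]: it has slope one inside [O], so every short
    step starting in [O] is charged to it. *)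
Definition occupied (O : set R) (a s : R) : R := fine (lam (O `&` `[a, s])).

Lemma occupied_mono (O : set R) (a s s' : R) : open O -> s <= s' ->
  occupied O a s <= occupied O a s'.
Proof.
move=> oO ss'; have mO : measurable O by exact: open_measurable.
apply: fine_le; rewrite ?fin_itv//; apply: le_measure; rewrite ?inE.
- exact: measurableI.
- exact: measurableI.
by apply: setIS; apply: subset_itvl; rewrite bnd_simp.
Qed.

Lemma occupied_incr (O : set R) (a s s' : R) : open O -> a <= s -> s <= s' ->
  `[s, s'] `<=` O -> s' - s <= occupied O a s' - occupied O a s.
Proof.
move=> oO as_ ss' sO; have mO : measurable O by exact: open_measurable.
rewrite /occupied; have -> : O `&` `[a, s'] = (O `&` `[a, s]) `|` `]s, s'].
  apply/seteqP; split=> x /=; rewrite !in_itv/=.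
    move=> [Ox /andP[-> xs']]; have [xs|sx] := leP x s; [by left|by right].
  move=> [[Ox /andP[-> xs]]|/andP[sx xs']].
    by split=> //; rewrite (le_trans xs).
  split; first by apply: sO; rewrite /= in_itv/= xs' ltW.
  by rewrite xs' (le_trans as_)// ltW.
have -> : lam ((O `&` `[a, s]) `|` `]s, s']) =
    (lam (O `&` `[a, s]) + lam `]s, s'])%E.
  apply: measureU; [exact: measurableI|by []|].
  apply/seteqP; split=> // x /= [[_]]; rewrite !in_itv/= => /andP[_ xs] /andP[sx _].
  by move: (lt_le_trans sx xs); rewrite ltxx.
rewrite lebesgue_measure_itv/= lte_fin; case: ifPn => [lt|].
  by rewrite fineD ?fin_itv//= addrAC subrr add0r.
by rewrite -leNgt adde0 => s's; lra.
Qed.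

Lemma occupied0 (O : set R) (a : R) : open O -> occupied O a a = 0.
Proof.
move=> oO; have mO : measurable O by exact: open_measurable.
rewrite /occupied (_ : lam _ = 0%E)//; apply/eqP.
rewrite eq_le measure_ge0 andbT -(lebesgue_measure_set1 a).
apply: le_measure; rewrite ?inE//; first exact: measurableI.
by rewrite set_itv1; exact: subIsetr.
Qed.

Let open_step (O : set R) (b s : R) : open O -> O s -> s < b ->
  exists s', [/\ s < s', s' <= b & `[s, s'] `<=` O].
Proof.
move=> oO Os sb; have /nbhs_ballP[e /= e0 eO] := open_nbhs_nbhs (conj oO Os).
exists (Num.min b (s + e / 2)); split.
- by rewrite lt_min sb ltrDl divr_gt0.
- by rewrite ge_min lexx.
move=> x; rewrite /= in_itv/= le_min => /andP[sx /andP[_ xs]]; apply: eO.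
rewrite /ball/= distrC ger0_norm ?subr_ge0//; lra.
Qed.

Let open_step_left (O : set R) (a s : R) : open O -> O s -> a < s ->
  exists s', [/\ a <= s', s' < s & `[s', s] `<=` O].
Proof.
move=> oO Os sb; have /nbhs_ballP[e /= e0 eO] := open_nbhs_nbhs (conj oO Os).
exists (Num.max a (s - e / 2)); split.
- by rewrite le_max lexx.
- by rewrite gt_max sb/=; lra.
move=> x; rewrite /= in_itv/= ge_max => /andP[/andP[_ xs] sx]; apply: eO.
rewrite /ball/= ger0_norm ?subr_ge0//; lra.
Qed.

Lemma growth_open (O : set R) (h : R -> R) (a b p A : R) : open O ->
  a <= b -> 0 <= A + p ->
  (forall s s', a <= s -> s <= s' -> s' <= b -> - A * (s' - s) <= h s' - h s) ->
  (forall s, a <= s -> s < b -> ~ O s -> exists s', [/\ s < s', s' <= b &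
     p * (s' - s) <= h s' - h s]) ->
  p * (b - a) - (A + p) * occupied O a b <= h b - h a.
Proof.
move=> oO ab Ap hl step.
have := @growth R h (occupied O a) a b p A; rewrite occupied0// subr0; apply => //.
- by move=> s s' as_ ss' s'b; exact: occupied_mono.
move=> s as_ sb; have [Os|nOs] := pselect (O s).
  have [s' [ss' s'b sO]] := open_step oO Os sb.
  exists s'; split=> //; right; apply: occupied_incr => //; exact: ltW.
by have [s' [? ? ?]] := step _ as_ sb nOs; exists s'; split=> //; left.
Qed.

Lemma growth_open_left (O : set R) (h : R -> R) (a b p A : R) : open O ->
  a <= b -> 0 <= A + p ->
  (forall s s', a <= s -> s <= s' -> s' <= b -> - A * (s' - s) <= h s' - h s) ->
  (forall s, a < s -> s <= b -> ~ O s -> exists s', [/\ a <= s', s' < s &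
     p * (s - s') <= h s - h s']) ->
  p * (b - a) - (A + p) * occupied O a b <= h b - h a.
Proof.
move=> oO ab Ap hl step.
have := @growth_left R h (occupied O a) a b p A.
rewrite occupied0// subr0; apply => //.
- by move=> s s' as_ ss' s'b; exact: occupied_mono.
move=> s as_ sb; have [Os|nOs] := pselect (O s).
  have [s' [ss' s'b sO]] := open_step_left oO Os as_.
  exists s'; split=> //; right; apply: occupied_incr => //; exact: ltW.
by have [s' [? ? ?]] := step _ as_ sb nOs; exists s'; split=> //; left.
Qed.

(** Strict inequalities at arbitrarily small scales, rather than a bound on the upper Dini
    derivative, make this a countable intersection of open sets when [h] is continuous. *)
Definition right_steep (h : R -> R) (p : R) : set R :=
  [set s | forall d, 0 < d -> exists y, [/\ 0 < y, y < d & p * y < h (s + y) - h s]].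

Definition left_steep (h : R -> R) (p : R) : set R :=
  [set s | forall d, 0 < d -> exists y, [/\ 0 < y, y < d & p * y < h s - h (s - y)]].

Definition steep h p := right_steep h p `|` left_steep h p.

Lemma growth_right_steep (O : set R) (h : R -> R) (a b p A : R) : open O ->
  a <= b -> 0 <= A + p ->
  (forall s s', s <= s' -> - A * (s' - s) <= h s' - h s) ->
  (forall s, a <= s -> s <= b -> ~ O s -> right_steep h p s) ->
  p * (b - a) - (A + p) * occupied O a b <= h b - h a.
Proof.
move=> oO ab Ap hl st; apply: growth_open => //; first by move=> *; exact: hl.
move=> s as_ sb nO; have [|y [y0 ybs hy]] := st s as_ (ltW sb) nO (b - s).
  by rewrite subr_gt0.
by exists (s + y); rewrite addrAC subrr add0r; split; [lra|lra|exact: ltW].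
Qed.

Lemma growth_left_steep (O : set R) (h : R -> R) (a b p A : R) : open O ->
  a <= b -> 0 <= A + p ->
  (forall s s', s <= s' -> - A * (s' - s) <= h s' - h s) ->
  (forall s, a <= s -> s <= b -> ~ O s -> left_steep h p s) ->
  p * (b - a) - (A + p) * occupied O a b <= h b - h a.
Proof.
move=> oO ab Ap hl st; apply: growth_open_left => //; first by move=> *; exact: hl.
move=> s as_ sb nO; have [|y [y0 ybs hy]] := st s (ltW as_) sb nO (s - a).
  by rewrite subr_gt0.
by exists (s - y); rewrite opprB addrCA subrr addr0; split; [lra|lra|exact: ltW].
Qed.

Let right_steepE h p : right_steep h p = \bigcap_k
  \bigcup_(y in [set y | 0 < y < k.+1%:R^-1]) [set s | p * y < h (s + y) - h s].
Proof.
apply/seteqP; split=> s /= H.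
  move=> k _; have [|y [y0 yk hy]] := H k.+1%:R^-1; first by [].
  by exists y => //=; rewrite y0.
move=> d d0; have /ltr_add_invr[k] := d0; rewrite add0r => kd.
have [//|y /= /andP[y0 yk] hy] := H k; exists y; split=> //.
exact: lt_trans kd.
Qed.

Let left_steepE h p : left_steep h p = \bigcap_k
  \bigcup_(y in [set y | 0 < y < k.+1%:R^-1]) [set s | p * y < h s - h (s - y)].
Proof.
apply/seteqP; split=> s /= H.
  move=> k _; have [|y [y0 yk hy]] := H k.+1%:R^-1; first by [].
  by exists y => //=; rewrite y0.
move=> d d0; have /ltr_add_invr[k] := d0; rewrite add0r => kd.
have [//|y /= /andP[y0 yk] hy] := H k; exists y; split=> //.
exact: lt_trans kd.
Qed.

Lemma measurable_right_steep h p : continuous h -> measurable (right_steep h p).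
Proof.
move=> ch; rewrite right_steepE; apply: bigcap_measurable; first by exists 0%N.
move=> k _; apply: open_measurable; apply: bigcup_open => y _.
rewrite (_ : [set s | _] = (fun s => h (s + y) - h s) @^-1` [set z | p * y < z])//.
apply: open_comp; last exact: open_gt.
move=> s _; apply: cvgB; last exact: ch.
apply: (@continuous_comp _ _ _ (fun s => s + y) h); last exact: ch.
by apply: cvgD; [exact: cvg_id|exact: cvg_cst].
Qed.

Lemma measurable_left_steep h p : continuous h -> measurable (left_steep h p).
Proof.
move=> ch; rewrite left_steepE; apply: bigcap_measurable; first by exists 0%N.
move=> k _; apply: open_measurable; apply: bigcup_open => y _.
rewrite (_ : [set s | _] = (fun s => h s - h (s - y)) @^-1` [set z | p * y < z])//.
apply: open_comp; last exact: open_gt.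
move=> s _; apply: cvgB; first exact: ch.
apply: (@continuous_comp _ _ _ (fun s => s - y) h); last exact: ch.
by apply: cvgB; [exact: cvg_id|exact: cvg_cst].
Qed.

End lipschitz_derivative.

(** * Differentiability almost everywhere on the line *)

Section lipschitz_derivable.
Context {R : realType}.
Notation lam := (@lebesgue_measure R).

(** The common conclusion of the left and right growth lemmas, isolated so that a single density
    argument covers the four combinations of sides. *)
Definition grows (h : R -> R) (A p : R) (U : set R) :=
  forall (O : set R) (a b : R), open O -> a <= b ->
  (forall s, a <= s -> s <= b -> ~ O s -> U s) ->
  p * (b - a) - (A + p) * occupied O a b <= h b - h a.

(** Near a density point the complement of [D] takes up less than [e / 4] of the ball, whose length
    is [2 * r]; outer regularity encloses it in an open set at the further cost [r * e / 2]. *)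
Let density_ball (D : set R) (x e : R) : measurable D -> D x -> 0 < e ->
  (lam (D `&` ball x r) * (lam (ball x r))^-1)%E @[r --> 0^'+] --> (\1_D x)%:E ->
  exists2 r : R, 0 < r & exists O : set R, [/\ open O,
    ball x r `\` D `<=` O & (lam O <= (r * e)%:E)%E].
Proof.
move=> mD Dx e0; rewrite indicE mem_set//= => cv.
have cv' : \forall r \near (0:R)^'+,
    ((1 - e / 4)%:E < lam (D `&` ball x r) * (lam (ball x r))^-1)%E.
  have /cv : nbhs (1%:E : \bar R) (fun y => ((1 - e / 4)%:E < y)%E) by
    apply: open_ereal_gt'; rewrite lte_fin; lra.
  exact.
near (0 : R)^'+ => r.
have r0 : 0 < r by near: r; exact: nbhs_right_gt.
exists r => //.
have lb : lam (ball x r) = (r *+ 2)%:E by rewrite lebesgue_measure_ball// ltW.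
have mB : measurable (ball x r) by exact: measurable_ball.
have mDB : measurable (D `&` ball x r) by exact: measurableI.
have fI : lam (D `&` ball x r) \is a fin_num.
  rewrite ge0_fin_numE//; apply: (@le_lt_trans _ _ (lam (ball x r))).
    by apply: le_measure; rewrite ?inE.
  by rewrite lb ltry.
have mBD : measurable (ball x r `\` D) by exact: measurableD.
have lBD : (lam (ball x r `\` D) < (r * (e / 2))%:E)%E.
  have lbf : (lam (ball x r) < +oo)%E by rewrite lb ltry.
  have -> : lam (ball x r `\` D) = (lam (ball x r) - lam (ball x r `&` D))%E.
    exact: measureD.
  have : ((1 - e / 4)%:E < lam (D `&` ball x r) * (lam (ball x r))^-1)%E by near: r.
  rewrite lb (setIC (ball x r) D) -(fineK fI) inver.
  rewrite ifF; last by rewrite gt_eqF// pmulrn_lgt0.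
  rewrite -EFinM lte_fin -EFinB lte_fin ltr_pdivlMr ?pmulrn_lgt0// mulr2n.
  lra.
have [V [oO BO HO]] : exists U : set R,
    [/\ open U, ball x r `\` D `<=` U & (lam (U `\` (ball x r `\` D)) < (r * (e/2))%:E)%E].
  apply: lebesgue_regularity_outer => //; first exact: lt_trans lBD (ltry _).
  by rewrite mulr_gt0// divr_gt0.
exists V; split=> //.
rewrite -(setDKU BO); apply: (le_trans (measureU2 _ _ _)) => //.
  by apply: measurableD => //; exact: open_measurable.
have -> : (r * e)%:E = ((r * (e/2))%:E + (r * (e/2))%:E)%E.
  by rewrite -EFinD; congr EFin; lra.
by rewrite leeD// ltW.
Unshelve. all: by end_near. Qed.

(** At a density point of the intersection, [h] would over a short interval rise with slope at least
    [be] and at most [al], up to an error governed by the small open set that covers the rest. *)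
Lemma grows_null (h : R -> R) (A al be : R) (U W : set R) : al < be ->
  `|al| <= A -> `|be| <= A ->
  measurable U -> measurable W ->
  grows h A be U -> grows (fun s => - h s) A (- al) W -> lam (U `&` W) = 0%E.
Proof.
move=> alb alA beA mU mW gU gW.
have mD : measurable (U `&` W) by exact: measurableI.
suff: lam.-negligible (U `&` W) by case: (negligibleP lam mD).
have := lebesgue_density mD; apply: negligibleS => x Dx /= dens.
(* The two growth estimates lose at most [(A + be) * r * e] and [(A - al) * r * e]; this [e] keeps
   their sum below the gap [r * (be - al)]. *)
pose e := (be - al) / (2 * (2 * A + be - al + 1)).
have K0 : 0 < 2 * A + be - al + 1 by have := normr_ge0 al; lra.
have e0 : 0 < e by apply: divr_gt0; lra.
have [r r0 [V [oO BO Ole]]] := density_ball mD Dx e0 dens.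
have mO : measurable V by exact: open_measurable.
have mOI : measurable (V `&` `[x - r / 2, x + r / 2]) by exact: measurableI.
have occ : occupied V (x - r / 2) (x + r / 2) <= r * e.
  rewrite -lee_fin fineK; last first.
    rewrite ge0_fin_numE//; apply: (@le_lt_trans _ _ (lam V)); last first.
      by rewrite (le_lt_trans Ole)// ltry.
    by apply: le_measure; rewrite ?inE.
  by apply: le_trans Ole; apply: le_measure; rewrite ?inE.
have inD s : x - r / 2 <= s -> s <= x + r / 2 -> ~ V s -> (U `&` W) s.
  move=> xs sx nO; apply: contrapT => nD; apply: nO; apply: BO; split=> //.
  by rewrite /ball/= ltr_distlC; apply/andP; split; lra.
have ab : x - r / 2 <= x + r / 2 by lra.
have := gU V _ _ oO ab (fun s h1 h2 h3 => (inD s h1 h2 h3).1).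
have := gW V _ _ oO ab (fun s h1 h2 h3 => (inD s h1 h2 h3).2).
have Ab : 0 <= A + be by have := ler_norm (- be); rewrite normrN; lra.
have Aa : 0 <= A + - al by have := ler_norm al; lra.
have := ler_wpM2l Ab occ; have := ler_wpM2l Aa occ.
have : (2 * A + be - al) * (r * e) < r * (be - al).
  have -> : be - al = e * (2 * (2 * A + be - al + 1)).
    by rewrite /e divfK// gt_eqF// mulr_gt0.
  rewrite (mulrC _ (r * e)) -mulrA ltr_pM2l// ltr_pM2l//; lra.
move=> /=; lra.
Qed.

Lemma grows_right_steep h (A p : R) : 0 <= A + p ->
  (forall s s', s <= s' -> - A * (s' - s) <= h s' - h s) ->
  grows h A p (right_steep h p).
Proof. by move=> Ap hl O a b oO ab H; exact: growth_right_steep. Qed.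

Lemma grows_left_steep h (A p : R) : 0 <= A + p ->
  (forall s s', s <= s' -> - A * (s' - s) <= h s' - h s) ->
  grows h A p (left_steep h p).
Proof. by move=> Ap hl O a b oO ab H; exact: growth_left_steep. Qed.

Definition has_derivative (h : R -> R) (s d : R) :=
  forall e, 0 < e -> exists2 de : R, 0 < de & forall y, `|y| < de ->
    `|h (s + y) - h s - d * y| <= e * `|y|.

Section fixed_function.
Variables (h : R -> R) (A : R).
Hypothesis A0 : 0 <= A.
Hypothesis hA : forall s s', `|h s' - h s| <= A * `|s' - s|.

Let ch : continuous h.
Proof.
move=> s; apply/cvgrPdist_lt => e e0.
have eA : 0 < e / (A + 1) by apply: divr_gt0 => //; rewrite ltr_wpDl.
near=> y; rewrite (le_lt_trans (hA _ _))//.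
have : `|s - y| < e / (A + 1).
  by near: y; exact: cvgr_dist_lt.
rewrite ltr_pdivlMr ?ltr_wpDl//.
by apply: le_lt_trans; rewrite mulrC ler_wpM2l//; lra.
Unshelve. all: by end_near. Qed.

Let hlow s s' : s <= s' -> - A * (s' - s) <= h s' - h s.
Proof.
move=> ss'; have := hA s s'; rewrite (ger0_norm (_ : 0 <= s' - s)) ?subr_ge0//.
by rewrite ler_norml => /andP[+ _]; rewrite mulNr.
Qed.

Let hlowN s s' : s <= s' -> - A * (s' - s) <= - h s' - - h s.
Proof.
move=> ss'; have := hA s s'; rewrite (ger0_norm (_ : 0 <= s' - s)) ?subr_ge0//.
by rewrite ler_norml mulNr => /andP[_ +]; lra.
Qed.

Let chN : continuous (fun s => - h s).
Proof. by move=> s; apply: cvgN; exact: ch. Qed.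

Lemma steep_both_null (al be : R) : al < be ->
  lam.-negligible (steep h be `&` steep (fun s => - h s) (- al)).
Proof.
(* [A] is enlarged so that both slopes become admissible for the growth lemmas. *)
move=> alb; have A0' := A0; pose A' := A + `|al| + `|be|.
have a0 := normr_ge0 al; have b0 := normr_ge0 be.
have low' s s' : s <= s' -> - A' * (s' - s) <= h s' - h s.
  move=> ss'; apply: le_trans (hlow ss').
  by rewrite ler_wpM2r ?subr_ge0// lerN2 /A'; lra.
have lowN' s s' : s <= s' -> - A' * (s' - s) <= - h s' - - h s.
  move=> ss'; apply: le_trans (hlowN ss').
  by rewrite ler_wpM2r ?subr_ge0// lerN2 /A'; lra.
have bA : 0 <= A' + be by have := ler_norm (- be); rewrite normrN /A'; lra.
have aA : 0 <= A' + - al by have := ler_norm al; rewrite /A'; lra.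
have main (U W : set R) : measurable U -> measurable W -> grows h A' be U ->
    grows (fun s => - h s) A' (- al) W -> lam.-negligible (U `&` W).
  move=> mU mW gU gW; apply/negligibleP; first exact: measurableI.
  by apply: (grows_null alb _ _ mU mW gU gW); rewrite /A'; lra.
rewrite /steep setIUl !setIUr.
by do 2?[apply: negligibleU]; apply: main;
  (exact: measurable_right_steep || exact: measurable_left_steep ||
   exact: grows_right_steep || exact: grows_left_steep).
Qed.

Definition quotient_near (be : R) : set R :=
  [set s | forall d, 0 < d -> exists y, [/\ y != 0, `|y| < d & be < (h (s + y) - h s) / y]].

Lemma steepP be s : quotient_near be s -> steep h be s.
Proof.
move=> H; apply: contrapT => /not_orP[/existsNP[d /not_implyP[d0 nd]]].
move=> /existsNP[d' /not_implyP[d'0 nd']].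
have [|y [y0 yd hy]] := H (Num.min d d'); first by rewrite lt_min d0.
move: yd; rewrite lt_min => /andP[yd yd'].
have [yneg|ypos|yz] := ltgtP y 0; last by rewrite yz eqxx in y0.
  apply: nd'; exists (- y); rewrite opprK; split; [lra|by rewrite -ltr0_norm|].
  by move: hy; rewrite ltr_ndivlMr// => hy; lra.
apply: nd; exists y; split=> //; first by rewrite -(gtr0_norm ypos).
by move: hy; rewrite ltr_pdivlMr.
Qed.

End fixed_function.

(** Where no derivative exists, the lower limit of the difference quotients is smaller than the
    upper one, and two rationals separate them; this leaves countably many null sets. *)
Lemma lipschitz_derivable_ae (h : R -> R) (A : R) : 0 <= A ->
  (forall s s', `|h s' - h s| <= A * `|s' - s|) ->
  lam.-negligible [set s | forall d, ~ has_derivative h s d].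
Proof.
move=> A0 hA.
have hAN s s' : `|- h s' - - h s| <= A * `|s' - s|.
  by rewrite -opprD normrN; exact: hA.
pose S (q : rat * rat) := steep h (ratr q.2) `&` steep (fun s => - h s) (- ratr q.1).
have [q qP] : exists q : nat -> rat * rat, forall p, exists n, q n = p.
  exists (fun n => odflt (0, 1) (unpickle n)) => p.
  by exists (pickle p); rewrite pickleK.
have : lam.-negligible (\bigcup_n if (q n).1 < (q n).2 then S (q n) else set0).
  apply: negligible_bigcup => n; case: ifPn => [lt|_]; last exact: negligible_set0.
  by apply: (steep_both_null A0 hA); rewrite ltr_rat.
move=> nB; apply: negligibleS nB.
  move=> s /= nd; pose Q y := (h (s + y) - h s) / y.
  have QA y : `|Q y| <= A.
    have [->|y0] := eqVneq y 0; first by rewrite /Q invr0 mulr0 normr0.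
    rewrite /Q normrM normfV ler_pdivrMr ?normr_gt0//.
    by have := hA s (s + y); rewrite addrAC subrr add0r.
  (* [inf U] and [sup W] are the upper and the lower limit of the quotients at 0. *)
  pose U := [set b : R | exists2 d : R, 0 < d &
    forall y, y != 0 -> `|y| < d -> Q y <= b].
  pose W := [set b : R | exists2 d : R, 0 < d &
    forall y, y != 0 -> `|y| < d -> b <= Q y].
  have UA : U A by exists 1 => // y _ _; have := QA y; rewrite ler_norml => /andP[].
  have WA : W (- A) by exists 1 => // y _ _; have := QA y; rewrite ler_norml => /andP[].
  have WU w u : W w -> U u -> w <= u.
    move=> [d d0 dw] [d' d'0 d'u].
    pose y := Num.min d d' / 2.
    have m0 : 0 < Num.min d d' by rewrite lt_min d0.
    have y0 : 0 < y by rewrite /y; lra.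
    have yd : `|y| < Num.min d d' by rewrite gtr0_norm// /y; lra.
    move: yd; rewrite lt_min => /andP[yd yd'].
    by rewrite (le_trans (dw y _ yd)) ?d'u// gt_eqF.
  have infU : has_inf U by split; [exists A|exists (- A) => u; exact: WU].
  have supW : has_sup W by split; [exists (- A)|exists A => u /WU; exact].
  have wu : sup W <= inf U.
    by apply: lb_le_inf; [exists A|move=> u Uu; apply: ge_sup; [exists (- A)|move=> w /WU; exact]].
  have [eqwu|neq] := eqVneq (sup W) (inf U).
    case: (nd (inf U)) => e e0.
    have [u [d d0 du] ue] : exists2 u, U u & u < inf U + e.
      exact: inf_adherent.
    have [w [d' d'0 d'w] we] : exists2 w, W w & inf U - e < w.
      by rewrite -eqwu; exact: sup_adherent.
    exists (Num.min d d'); first by rewrite lt_min d0.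
    move=> y; rewrite lt_min => /andP[yd yd'].
    have [->|y0] := eqVneq y 0; first by rewrite addr0 subrr mulr0 subrr !normr0 mulr0.
    have -> : h (s + y) - h s - inf U * y = (Q y - inf U) * y.
      by rewrite mulrBl /Q divfK.
    rewrite normrM ler_wpM2r// ler_norml.
    by have := du _ y0 yd; have := d'w _ y0 yd'; lra.
  have {}wu : sup W < inf U by rewrite lt_neqAle neq.
  have [a] := rat_in_itvoo wu; rewrite in_itv/= => /andP[wa au].
  have [b] := rat_in_itvoo au; rewrite in_itv/= => /andP[ab bu].
  have [n qn] := qP (a, b); exists n => //; rewrite qn/=.
  rewrite ltr_rat in ab; rewrite ab; split.
    apply: steepP => // d d0; apply: contrapT => nH.
    suff /(ge_inf infU.2) : U (ratr b) by lra.
    exists d => // y y0 yd; rewrite leNgt; apply/negP => bQ.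
    by apply: nH; exists y.
  apply: (@steepP (fun s => - h s)) => // d d0; apply: contrapT => nH.
  suff /(ub_le_sup supW.2) : W (ratr a) by lra.
  exists d => // y y0 yd; rewrite leNgt; apply/negP => bQ.
  by apply: nH; exists y; split=> //; rewrite -opprD mulNr ltrN2.
Qed.

End lipschitz_derivable.

(** * Linear functionals *)

Section hahn_banach.
Context {R : realType} {X : normedModType R}.

Record sublinear (p : X -> R) : Prop := Sublinear {
  sublinearD : forall x y, p (x + y) <= p x + p y;
  sublinearZ : forall (c : R) x, 0 <= c -> p (c *: x) = c * p x }.

Lemma sublinear0 p : sublinear p -> p 0 = 0.
Proof. by move=> sp; rewrite -(scale0r 0) sublinearZ// mul0r. Qed.

Lemma sublinearN p x : sublinear p -> - p (- x) <= p x.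
Proof.
move=> sp; have := sublinearD sp x (- x); rewrite subrr sublinear0//; lra.
Qed.

(** The auxiliary functional in the minimality proof of the Hahn-Banach theorem: it is sublinear,
    lies below [q], and is at most [- q y] at [- y]. A minimal [q] coincides with all its tilts,
    which makes it additive. *)
Definition tilt (q : X -> R) (y x : X) : R :=
  inf [set q (x + t *: y) - t * q y | t in [set t | 0 <= t]].

Let tilt_has_inf q y x : sublinear q ->
  has_inf [set q (x + t *: y) - t * q y | t in [set t | 0 <= t]].
Proof.
move=> sq; split; first by exists (q (x + 0 *: y) - 0 * q y), 0 => //=.
exists (- q (- x)) => _ [t /= t0 <-].
have := sublinearD sq (x + t *: y) (- x).
by rewrite addrAC subrr add0r sublinearZ//; lra.
Qed.

Lemma tilt_le q y x t : sublinear q -> 0 <= t ->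
  tilt q y x <= q (x + t *: y) - t * q y.
Proof. by move=> sq t0; apply: ge_inf; [exact: (tilt_has_inf _ _ sq).2|exists t]. Qed.

Lemma tilt_le_id q y x : sublinear q -> tilt q y x <= q x.
Proof.
move=> sq; have := @tilt_le q y x 0 sq (lexx 0).
by rewrite scale0r addr0 mul0r subr0.
Qed.

Lemma tilt_sublinear q y : sublinear q -> sublinear (tilt q y).
Proof.
move=> sq; split=> [x z|c x].
  apply/ler_addgt0Pr => e e0; have e20 : 0 < e / 2 by lra.
  have [_ [t /= t0 <-] tx] := inf_adherent e20 (tilt_has_inf y x sq).
  have [_ [s /= s0 <-] tz] := inf_adherent e20 (tilt_has_inf y z sq).
  have := @tilt_le q y (x + z) (t + s) sq (addr_ge0 t0 s0).
  have := sublinearD sq (x + t *: y) (z + s *: y).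
  rewrite addrACA -scalerDl -/(tilt q y x) -/(tilt q y z) in tx tz *; lra.
rewrite le_eqVlt => /orP[/eqP <-|c0].
  rewrite mul0r scale0r; apply/eqP; rewrite eq_le; apply/andP; split.
    by rewrite -(sublinear0 sq); exact: tilt_le_id.
  apply: lb_le_inf; first by case: (tilt_has_inf y 0 sq).
  by move=> _ [t /= t0 <-]; rewrite add0r sublinearZ// subrr.
apply/eqP; rewrite eq_le; apply/andP; split.
  rewrite -ler_pdivrMl//; apply: lb_le_inf; first by case: (tilt_has_inf y x sq).
  move=> _ [t /= t0 <-]; rewrite ler_pdivrMl//.
  have := @tilt_le q y (c *: x) (c * t) sq (mulr_ge0 (ltW c0) t0).
  have -> : c *: x + (c * t) *: y = c *: (x + t *: y) by rewrite scalerDr scalerA.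
  by move=> /le_trans; apply; rewrite (sublinearZ sq) ?(ltW c0)// -mulrA -mulrBr.
apply: lb_le_inf; first by case: (tilt_has_inf y (c *: x) sq).
move=> _ [t /= t0 <-].
have c10 : 0 <= c^-1 by rewrite invr_ge0 ltW.
have := @tilt_le q y x (c^-1 * t) sq (mulr_ge0 c10 t0).
move=> /(ler_wpM2l (ltW c0)) /le_trans; apply.
rewrite mulrBr -(sublinearZ sq) ?(ltW c0)// scalerDr scalerA.
have -> : c * (c^-1 * t) = t by rewrite mulrA divff ?gt_eqF// mul1r.
by have -> : c * (c^-1 * t * q y) = t * q y by rewrite !mulrA divff ?gt_eqF// mul1r.
Qed.

Lemma minimal_sublinear p : sublinear p -> exists q, [/\ sublinear q,
  (forall x, q x <= p x) &
  forall q', sublinear q' -> (forall x, q' x <= q x) -> q' = q].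
Proof.
move=> sp.
pose T := {q : X -> R | sublinear q /\ forall x, q x <= p x}.
pose Rl (a b : T) : bool := `[< forall x, sval b x <= sval a x >].
have [||||[q [sq qp]] qmin] := @Zorn T Rl.
- by move=> t; apply/asboolP.
- move=> r s t /asboolP rs /asboolP st; apply/asboolP => x.
  exact: le_trans (st x) (rs x).
- move=> [s Hs] [t Ht] /asboolP /= st /asboolP /= ts; apply: eq_exist.
  by apply/funext => x; apply/eqP; rewrite eq_le ts st.
- move=> A totA; have [[a0 Aa0]|A0] := pselect (A !=set0); last first.
    exists (exist _ p (conj sp (fun x => lexx (p x)))) => s As.
    by exfalso; apply: A0; exists s.
  pose V x := [set sval a x | a in A].
  have iV x : has_inf (V x).
    split; first by exists (sval a0 x), a0.
    exists (- p (- x)) => _ [a Aa <-]; have [sa ap] := svalP a.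
    by have := sublinearN x sa; have := ap (- x); lra.
  pose m x := inf (V x).
  have mle x a : A a -> m x <= sval a x.
    by move=> Aa; apply: ge_inf; [case: (iV x)|exists a].
  have sm : sublinear m.
    split=> [x y|c x].
      apply/ler_addgt0Pr => e e0; have e20 : 0 < e / 2 by lra.
      have [_ [a Aa <-] ax] := inf_adherent e20 (iV x).
      have [_ [b Ab <-] bx] := inf_adherent e20 (iV y).
      have [/asboolP ab|/asboolP ba] := totA _ _ Aa Ab.
        have := mle (x + y) b Ab; have := sublinearD (svalP b).1 x y.
        by have := ab x; rewrite -/(m x) -/(m y) in ax bx *; lra.
      have := mle (x + y) a Aa; have := sublinearD (svalP a).1 x y.
      by have := ba y; rewrite -/(m x) -/(m y) in ax bx *; lra.
    rewrite le_eqVlt => /orP[/eqP <-|c0].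
      rewrite mul0r scale0r; apply/eqP; rewrite eq_le; apply/andP; split.
        by rewrite -(sublinear0 (svalP a0).1); exact: mle.
      apply: lb_le_inf; first by case: (iV 0).
      by move=> _ [a Aa <-]; rewrite (sublinear0 (svalP a).1).
    apply/eqP; rewrite eq_le; apply/andP; split.
      rewrite -ler_pdivrMl//; apply: lb_le_inf; first by case: (iV x).
      move=> _ [a Aa <-]; rewrite ler_pdivrMl// -(sublinearZ (svalP a).1) ?(ltW c0)//.
      exact: mle.
    apply: lb_le_inf; first by case: (iV (c *: x)).
    move=> _ [a Aa <-]; rewrite (sublinearZ (svalP a).1) ?(ltW c0)//.
    by rewrite ler_pM2l//; exact: mle.
  have mp x : m x <= p x by rewrite (le_trans (mle x _ Aa0))//; case: (svalP a0).
  by exists (exist _ m (conj sm mp)) => s As; apply/asboolP => x /=; exact: mle.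
exists q; split=> // q' sq' q'q.
have q'p x : q' x <= p x by exact: le_trans (q'q x) (qp x).
suff /(congr1 sval) : (exist _ q' (conj sq' q'p) : T) = exist _ q (conj sq qp) by [].
by apply: qmin; apply/asboolP.
Qed.

(** A minimal sublinear functional is linear. Starting below [tilt p x0] instead of [p] bounds its
    value at [- x0] by [- p x0], which forces equality at [x0]. *)
Lemma hahn_banach p x0 : sublinear p -> exists psi : {linear X -> R},
  (forall x, psi x <= p x) /\ psi x0 = p x0.
Proof.
move=> sp; have [q [sq qp qmin]] := minimal_sublinear (tilt_sublinear x0 sp).
have qp' x : q x <= p x by apply: le_trans (qp x) (tilt_le_id _ _ sp).
have qD x y : q (x + y) = q x + q y.
  apply/eqP; rewrite eq_le sublinearD//=.
  have /(congr1 (@^~ x)) <- := qmin _ (tilt_sublinear y sq) (fun x => tilt_le_id y x sq).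
  have := @tilt_le q y x 1 sq ler01; rewrite scale1r mul1r; lra.
have qN x : q (- x) = - q x.
  by apply/eqP; rewrite -addr_eq0 addrC -qD subrr sublinear0.
have qlin : linear q.
  move=> c x y; rewrite qD; congr (_ + _).
  have [c0|c0] := leP 0 c; first by rewrite sublinearZ.
  have : q (- c *: x) = - c * q x by rewrite (sublinearZ sq)// oppr_ge0 ltW.
  by rewrite scaleNr qN mulNr => /oppr_inj.
pose L := GRing.isLinear.Build R X R _ q qlin.
pose psi : {linear X -> R} := HB.pack q L.
exists psi; split=> //=; apply/eqP; rewrite eq_le qp'/=.
have := qp (- x0); have := @tilt_le p x0 (- x0) 1 sp ler01.
rewrite scale1r mul1r addNr sublinear0// qN; lra.
Qed.

End hahn_banach.

(** * Separability of the space from that of its dual *)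

Section separability.
Context {R : realType} {X : normedModType R}.

Lemma linear_mul (phi : {linear X -> R}) c x : phi (c *: x) = c * phi x.
Proof. exact: linearZ. Qed.

Lemma linear_bound (phi : {linear X -> R}) : continuous phi ->
  exists2 M : R, 0 <= M & forall x, `|phi x| <= M * `|x|.
Proof.
move=> cphi; have /linear_boundedP bphi : bounded_near phi (nbhs 0).
  by apply: continuous_linear_bounded; exact: cphi.
near (+oo : set_system R) => M; exists M; first by near: M; exact: nbhs_pinfty_ge.
by move=> x; move: x; near: M.
Unshelve. all: by end_near. Qed.

(** [dual_norm] is a supremum of reals and is meaningful only for a bounded set; with a bound at
    hand it obeys the usual operator norm inequality. *)
Lemma dual_norm_bound (chi : X -> R) (M : R) :
  (forall c x, chi (c *: x) = c * chi x) -> 0 <= M ->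
  (forall x, `|chi x| <= M * `|x|) ->
  [/\ has_sup [set `|chi x| | x in [set x | `|x| <= 1]], 0 <= dual_norm chi &
      forall v, `|chi v| <= dual_norm chi * `|v|].
Proof.
move=> chiZ M0 chiM.
have hs : has_sup [set `|chi x| | x in [set x | `|x| <= 1]].
  split; first by exists `|chi 0|, 0 => //=; rewrite normr0.
  by exists M => _ [x /= x1 <-]; rewrite (le_trans (chiM x))// ler_piMr.
have chi0 : chi 0 = 0 by rewrite -(scale0r 0) chiZ mul0r.
split=> //.
  by apply: ub_le_sup; [exact: hs.2|exists 0 => /=; rewrite ?normr0// chi0 normr0].
move=> v; have [->|v0] := eqVneq v 0; first by rewrite chi0 !normr0 mulr0.
have nv : 0 < `|v| by rewrite normr_gt0.
rewrite -ler_pdivrMr//.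
have -> : `|chi v| / `|v| = `|chi (`|v|^-1 *: v)|.
  by rewrite chiZ normrM mulrC ger0_norm// invr_ge0.
apply: ub_le_sup; first exact: hs.2.
by exists (`|v|^-1 *: v) => //=; rewrite normrZ ger0_norm ?invr_ge0// mulVf// gt_eqF.
Qed.

Lemma dual_dense_seq : separable_dual X ->
  exists phi : nat -> {linear X -> R}, (forall n, continuous (phi n)) /\
  forall psi : {linear X -> R}, continuous psi -> forall e : R, 0 < e ->
    exists n, forall v, `|psi v - phi n v| <= e * `|v|.
Proof.
move=> [D [/countable_injP[f injf] Dc Dd]].
(* Approximating the zero functional yields a default value for the indices that code no element of
   [D]. *)
have [phi0 Dphi0 _] : exists2 phi, D phi &
    dual_norm (fun x => (\0 : {linear X -> R}) x - phi x) < 1.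
  by apply: Dd => //; exact: cst_continuous.
have /choice[phi phiP] (n : nat) : exists p : {linear X -> R},
    D p /\ forall psi, D psi -> f psi = n -> p = psi.
  have [[psi [Dpsi fpsi]]|nex] := pselect (exists psi, D psi /\ f psi = n).
    exists psi; split=> // psi' Dpsi' fpsi'.
    by apply: injf; rewrite ?inE// fpsi.
  by exists phi0; split=> // psi Dpsi fpsi; exfalso; apply: nex; exists psi.
exists phi; split=> [n|psi cpsi e e0]; first by apply: Dc; case: (phiP n).
have [p Dp pe] := Dd psi cpsi e e0.
exists (f p); rewrite (proj2 (phiP (f p)) p Dp erefl) => v.
have [M M0 psiM] := linear_bound cpsi; have [M' M'0 pM] := linear_bound (Dc p Dp).
have [|||_ _ bd] := @dual_norm_bound (fun x => psi x - p x) (M + M').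
- by move=> c x; rewrite !linear_mul -mulrBr.
- exact: addr_ge0.
- move=> x; rewrite (le_trans (ler_normB _ _))// mulrDl lerD//.
by rewrite (le_trans (bd v))// ler_wpM2r// ltW.
Qed.

Definition span (x : nat -> X) : set X :=
  [set y | exists n, exists a : nat -> R, y = \sum_(i < n) a i *: x i].

Lemma span_ge (x : nat -> X) (n m : nat) (a : nat -> R) : (n <= m)%N ->
  exists b : nat -> R, \sum_(i < n) a i *: x i = \sum_(i < m) b i *: x i.
Proof.
move=> nm; exists (fun i => if (i < n)%N then a i else 0).
rewrite (big_ord_widen m (fun i => a i *: x i) nm) big_mkcond/=.
by apply: eq_bigr => i _; case: ifP => // _; rewrite scale0r.
Qed.

Lemma spanD (x : nat -> X) y z : span x y -> span x z -> span x (y + z).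
Proof.
move=> [n [a ->]] [m [b ->]].
have [a' ->] := span_ge x a (leq_maxl n m).
have [b' ->] := span_ge x b (leq_maxr n m).
exists (maxn n m), (fun i => a' i + b' i); rewrite -big_split/=.
by apply: eq_bigr => i _; rewrite scalerDl.
Qed.

Lemma spanZ (x : nat -> X) c y : span x y -> span x (c *: y).
Proof.
move=> [n [a ->]]; exists n, (fun i => c * a i); rewrite scaler_sumr.
by apply: eq_bigr => i _; rewrite scalerA.
Qed.

(** Used as the dominating functional of [hahn_banach]: a linear functional below it has norm at
    most one and vanishes on the span. *)
Definition span_dist (x : nat -> X) (y : X) : R :=
  inf [set `|y - z| | z in span x].

Lemma span_dist_has_inf (x : nat -> X) y : has_inf [set `|y - z| | z in span x].
Proof.
split; last by exists 0 => _ [z _ <-].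
by exists `|y - 0|, 0 => //; exists 0%N, (fun=> 0); rewrite big_ord0.
Qed.

Lemma span_dist_le (x : nat -> X) y z : span x z -> span_dist x y <= `|y - z|.
Proof. by move=> sz; apply: ge_inf; [exact: (span_dist_has_inf _ _).2|exists z]. Qed.

Lemma span_dist_sublinear (x : nat -> X) : sublinear (span_dist x).
Proof.
have span0 : span x 0 by exists 0%N, (fun=> 0); rewrite big_ord0.
split=> [y z|c y].
  apply/ler_addgt0Pr => e e0; have e20 : 0 < e / 2 by lra.
  have [_ [u su <-] uy] := inf_adherent e20 (span_dist_has_inf x y).
  have [_ [v sv <-] vz] := inf_adherent e20 (span_dist_has_inf x z).
  have := span_dist_le (y + z) (spanD su sv).
  have := ler_normD (y - u) (z - v); rewrite addrACA -opprD.
  rewrite -/(span_dist x y) -/(span_dist x z) in uy vz *; lra.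
rewrite le_eqVlt => /orP[/eqP <-|c0].
  rewrite scale0r mul0r; apply/eqP; rewrite eq_le; apply/andP; split.
    by have := span_dist_le 0 span0; rewrite subr0 normr0.
  apply: lb_le_inf; first by case: (span_dist_has_inf x 0).
  by move=> _ [z _ <-].
apply/eqP; rewrite eq_le; apply/andP; split.
  rewrite -ler_pdivrMl//; apply: lb_le_inf; first by case: (span_dist_has_inf x y).
  move=> _ [z sz <-]; rewrite ler_pdivrMl//.
  have := span_dist_le (c *: y) (spanZ c sz).
  by rewrite -scalerBr normrZ gtr0_norm.
apply: lb_le_inf; first by case: (span_dist_has_inf x (c *: y)).
move=> _ [z sz <-]; rewrite -ler_pdivlMl//.
apply: (le_trans (span_dist_le y (spanZ c^-1 sz))).
have -> : y - c^-1 *: z = c^-1 *: (c *: y - z).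
  by rewrite scalerBr scalerA mulVf ?gt_eqF// scale1r.
by rewrite normrZ gtr0_norm// invr_gt0.
Qed.

(** If the span of nearly norming vectors [x n] of the [phi n] were not dense, a functional [psi] of
    norm at most one would vanish on every [x n] without being zero. A [phi n] close to [psi] is
    small at [x n], hence small everywhere, and so is [psi]. *)
Lemma separable_of_dual : separable_dual X ->
  exists V : nat -> X, forall x (e : R), 0 < e -> exists n, `|x - V n| < e.
Proof.
move=> /dual_dense_seq[phi [cphi phid]].
have /choice[x xP] n : exists x, `|x| <= 1 /\ forall v, `|phi n v| <= 2 * `|phi n x| * `|v|.
  have [M M0 phiM] := linear_bound (cphi n).
  have [|hs N0 bd] := dual_norm_bound _ M0 phiM; first by move=> *; rewrite linear_mul.
  have [Nz|Npos] := eqVneq (dual_norm (phi n)) 0.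
    exists 0; rewrite normr0; split=> // v.
    by rewrite (le_trans (bd v))// Nz mul0r mulr_ge0// mulr_ge0.
  have {}Npos : 0 < dual_norm (phi n) by rewrite lt_neqAle eq_sym Npos.
  have N20 : 0 < dual_norm (phi n) / 2 by lra.
  have [_ [z /= z1 <-]] := sup_adherent N20 hs; rewrite -/(dual_norm (phi n)) => zN.
  exists z; split=> // v; rewrite (le_trans (bd v))// ler_wpM2r//; lra.
have dense0 y : span_dist x y <= 0.
  rewrite leNgt; apply/negP => y0.
  have [psi [psip psiy]] := hahn_banach y (span_dist_sublinear x).
  have dist_le z : span_dist x z <= `|z|.
    have : span x 0 by exists 0%N, (fun=> 0); rewrite big_ord0.
    by move/(span_dist_le z); rewrite subr0.
  have psi1 z : `|psi z| <= `|z|.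
    rewrite ler_norml; have := psip z; have := psip (- z); rewrite linearN/=.
    by have := dist_le z; have := dist_le (- z); rewrite normrN; lra.
  have cpsi : continuous psi.
    apply/linear_bounded_continuous/linear_boundedP.
    near=> M => u; rewrite (le_trans (psi1 u))// ler_peMl//.
  have psix n : psi (x n) = 0.
    have sx c : span x (c *: x n).
      exists n.+1, (fun i => if i == n then c else 0).
      rewrite big_ord_recr/= eqxx big1 ?add0r// => i _.
      by rewrite ltn_eqF// scale0r.
    have pz c : psi (c *: x n) <= 0.
      by rewrite (le_trans (psip _))// (le_trans (span_dist_le _ (sx c)))// subrr normr0.
    have := pz 1; have := pz (- 1); rewrite scale1r scaleN1r linearN/=; lra.
  (* With this [e], the bound [|psi y| <= 3 * e * |y|] contradicts [psi y = span_dist x y = 4 * e *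
     (1 + |y|)]. *)
  have e0 : 0 < span_dist x y / (4 * (1 + `|y|)).
    by apply: divr_gt0 => //; apply: mulr_gt0 => //; have := normr_ge0 y; lra.
  have [n nP] := phid psi cpsi _ e0; have [x1 xn] := xP n.
  have := nP (x n); rewrite psix sub0r normrN => h1.
  have := ler_normD (psi y - phi n y) (phi n y); rewrite subrK psiy.
  rewrite [`|span_dist x y|]gtr0_norm// => h2.
  have h3 := nP y; rewrite psiy in h3; have h4 := xn y.
  set e := span_dist x y / _ in e0 h1 h3.
  have h5 : `|phi n (x n)| <= e.
    by rewrite (le_trans h1)// ler_piMr// ltW.
  have h6 : 2 * `|phi n (x n)| * `|y| <= 2 * e * `|y|.
    by rewrite ler_wpM2r// ler_pM2l.
  have h7 : span_dist x y = e * (4 * (1 + `|y|)).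
    by rewrite /e divfK// gt_eqF// mulr_gt0//; have := normr_ge0 y; lra.
  have h8 : 0 <= e * `|y| by rewrite mulr_ge0// ltW.
  lra.
pose V s := \sum_(i < size s) ratr (nth 0 s i) *: x i : X.
exists (fun n => V (odflt [::] (unpickle n))) => y e e0.
suff [s sP] : exists s : seq rat, `|y - V s| < e.
  by exists (pickle s); rewrite pickleK.
have e20 : 0 < e / 2 by lra.
have [_ [z [n [a ->]] <-] yz] := inf_adherent e20 (span_dist_has_inf x y).
rewrite -/(span_dist x y) in yz.
set d := e / 2 / n.+1%:R; have d0 : 0 < d by apply: divr_gt0.
have /choice[q qP] i : exists q : rat, `|a i - ratr q| < d.
  have [|q] := @rat_in_itvoo R (a i - d) (a i + d).
    by lra.
  by rewrite in_itv/= => /andP[q1 q2]; exists q; rewrite ltr_distlC; apply/andP; split; lra.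
exists (mkseq q n).
have -> : V (mkseq q n) = \sum_(i < n) ratr (q i) *: x i.
  rewrite /V size_mkseq; apply: eq_bigr => i _.
  by rewrite nth_mkseq.
rewrite -(subrKA (\sum_(i < n) a i *: x i)) (le_lt_trans (ler_normD _ _))//.
rewrite -sumrB.
have : `|\sum_(i < n) (a i *: x i - ratr (q i) *: x i)| <= e / 2.
  apply: (le_trans (ler_norm_sum _ _ _)).
  apply: (@le_trans _ _ (\sum_(i < n) (d))).
    apply: ler_sum => i _; rewrite -scalerBl normrZ.
    by rewrite -[leRHS]mulr1 ler_pM// ?(ltW (qP _))//; case: (xP i).
  rewrite sumr_const card_ord -[d *+ n]mulr_natr /d mulrAC.
  by rewrite ler_pdivrMr// ler_pM2l// ler_nat.
have := dense0 y; lra.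
Unshelve. all: by end_near. Qed.

End separability.

(** * The cube and its measure *)

Section cube_topology.
Context {R : realType}.
Implicit Types (s : unit_interval R) (t : cube R).

Definition coord (t : cube R) (j : nat) : R := val (t j).

Lemma unit_interval_bounds s : 0 <= val s <= 1.
Proof. by case: s => x /=; rewrite inE/= in_itv. Qed.

Lemma coord_bounds t j : 0 <= coord t j <= 1.
Proof. exact: unit_interval_bounds. Qed.

Lemma unit_interval_inj s s' : val s = val s' -> s = s'.
Proof. by move/val_inj. Qed.

Definition clamp_val (x : R) : R := Num.max 0 (Num.min x 1).

Lemma clamp_subproof (x : R) : clamp_val x \in `[0 : R, 1]%classic.
Proof.
by rewrite inE/= in_itv/= /clamp_val le_max lexx/= ge_max ler01 ge_min lexx orbT.
Qed.

(** A total retraction onto the unit interval, so that coordinates can be prescribed by arbitrary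
    reals. *)
Definition clamp (x : R) : unit_interval R :=
  exist (fun y : R => y \in `[0 : R, 1]%classic) (clamp_val x) (clamp_subproof x).

Lemma clampE x : 0 <= x <= 1 -> val (clamp x) = x.
Proof.
move=> /andP[x0 x1]; rewrite /= /clamp_val.
by rewrite (min_idPl x1) (max_idPr x0).
Qed.

Lemma clamp_valK s : clamp (val s) = s.
Proof. by apply: unit_interval_inj; rewrite clampE// unit_interval_bounds. Qed.

Lemma clamp_lipschitz x y : `|clamp_val x - clamp_val y| <= `|x - y|.
Proof.
rewrite /clamp_val; wlog xy : x y / x <= y.
  by move=> H; have [/H//|/ltW /H] := leP x y; rewrite distrC (distrC y).
rewrite (distrC x) (ger0_norm (_ : 0 <= y - x)) ?subr_ge0//.
rewrite !maxEge !minEle.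
by do !case: ifPn => //=; rewrite -?ltNge => *; rewrite ler_norml; apply/andP; split; lra.
Qed.

Lemma unit_nbhsP s (U : set (unit_interval R)) : nbhs s U <->
  exists2 d : R, 0 < d & forall s', `|val s' - val s| < d -> U s'.
Proof.
split=> [|[d d0 dU]].
  rewrite nbhsE => -[_ [[B oB <-] Bs] BU].
  have /nbhs_ballP[d /= d0 dB] := open_nbhs_nbhs (conj oB Bs).
  by exists d => // s' s's; apply: BU; apply: dB; rewrite /ball/= distrC.
have : @nbhs _ (unit_interval R) s [set s' | ball (val s : R) d (val s')].
  apply: (@initial_continuous _ _ (set_val : `[0 : R, 1]%classic -> R) s).
  exact: nbhsx_ballx.
move=> H; apply: (@filterS _ _ (nbhs_filter (s : unit_interval R)) _ _ _ H) => s' /=.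
by rewrite /ball/= distrC; exact: dU.
Qed.

Lemma val_unit_continuous : continuous (fun s : unit_interval R => val s : R).
Proof.
move=> s U /nbhs_ballP[e /= e0 eU]; apply/unit_nbhsP; exists e => // s' s's.
by apply: eU; rewrite /ball/= distrC.
Qed.

Lemma continuous_to_unit (Y : topologicalType) (f : Y -> unit_interval R) :
  continuous (fun y => val (f y) : R) -> continuous f.
Proof.
move=> cf y U /unit_nbhsP[d d0 dU]; have /cvgrPdist_lt/(_ d d0) := cf y.
by apply: filterS => z; rewrite distrC; exact: dU.
Qed.

Lemma clamp_continuous : continuous clamp.
Proof.
apply: continuous_to_unit => x; apply/cvgrPdist_lt => e e0.
near=> y; apply: (le_lt_trans (clamp_lipschitz _ _)); near: y.
exact: cvgr_dist_lt.
Unshelve. all: by end_near. Qed.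

Lemma cube_cvgP (F : set_system (cube R)) t : Filter F ->
  (forall j, (fun t : cube R => t j) @ F --> t j) -> F --> t.
Proof.
move=> FF cv; apply/(@cvg_sup (cube R) nat _ F t) => j A.
rewrite nbhsE => -[_ [[B oB <-] Bt] BA].
have /(cv j) FB : nbhs (t j) B by apply: open_nbhs_nbhs.
by apply: (@filterS _ F FF _ _ _ FB) => t' Bt'; exact: BA.
Qed.

Lemma continuous_to_cube (Y : topologicalType) (f : Y -> cube R) :
  (forall j, continuous (fun y => f y j)) -> continuous f.
Proof. by move=> cf y; apply: cube_cvgP => j; exact: cf. Qed.

Lemma proj_cube_continuous j : continuous (fun t : cube R => t j).
Proof. exact: (@proj_continuous nat (fun=> unit_interval R) j). Qed.

Lemma coord_continuous j : continuous (coord ^~ j : cube R -> R).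
Proof.
move=> t; apply: (@continuous_comp _ _ _ (fun t : cube R => t j) (fun s => val s)).
  exact: proj_cube_continuous.
exact: val_unit_continuous.
Qed.

(** The one index [l] is both the number of controlled coordinates and the precision [2^-l], so that
    neighbourhoods of a point are described by a natural number. *)
Definition close (l : nat) (t t' : cube R) : Prop :=
  forall j, (j < l)%N -> `|coord t' j - coord t j| <= 2^-1 ^+ l.

Lemma half_gt0 l : 0 < 2^-1 ^+ l :> R. Proof. by rewrite exprn_gt0. Qed.

Lemma half_mono k l : (k <= l)%N -> 2^-1 ^+ l <= 2^-1 ^+ k :> R.
Proof.
move=> kl; rewrite ler_wiXn2l//; lra.
Qed.

Lemma half_lt (e : R) : 0 < e -> exists l, 2^-1 ^+ l < e.
Proof.
move=> e0; have h : `|2^-1 : R| < 1 by rewrite ger0_norm// invf_lt1// ltr1n.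
have /cvgrPdist_lt/(_ e e0) := cvg_geometric 1 h.
move=> [n _ /(_ n (leqnn n))] /=; rewrite sub0r normrN /geometric/= mul1r.
by rewrite ger0_norm ?exprn_ge0//; exists n.
Qed.

Lemma close_mono k l t t' : (k <= l)%N -> close l t t' -> close k t t'.
Proof.
move=> kl h j jk; rewrite (le_trans (h j (leq_trans jk kl)))//; exact: half_mono.
Qed.

Lemma close_nbhs (l : nat) (d : R) t : 0 < d ->
  nbhs t [set t' | forall j, (j < l)%N -> `|coord t' j - coord t j| < d].
Proof.
move=> d0; elim: l => [|l IH]; first by apply: filterS filterT.
have : nbhs t [set t' | `|coord t' l - coord t l| < d].
  have /cvgrPdist_lt/(_ d d0) := @coord_continuous l t.
  by apply: filterS => t'; rewrite distrC.
move: IH; apply: filterS2 => t' h1 h2 j; rewrite ltnS leq_eqVlt.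
by move=> /orP[/eqP->//|/h1].
Qed.

Lemma nbhs_close t (U : set (cube R)) : nbhs t U -> exists l, close l t `<=` U.
Proof.
pose F : set_system (cube R) := filter_from setT (fun l => close l t).
have FF : Filter F.
  apply: filter_from_filter; first by exists 0%N.
  move=> i j _ _; exists (maxn i j) => // t' h.
  by split; apply: close_mono h; rewrite ?leq_maxl ?leq_maxr.
suff /(_ U) H : F --> t by move=> /H[l _ lU]; exists l.
apply: cube_cvgP => j B /unit_nbhsP[d d0 dB].
have [l ld] := half_lt d0.
exists (maxn l j.+1) => // t' h; apply: dB => /=.
have := h j; rewrite leq_max ltnSn orbT => /(_ isT) /le_lt_trans; apply.
by rewrite (le_lt_trans _ ld)// half_mono// leq_maxl.
Qed.

Lemma compact_unit_interval : compact [set: unit_interval R].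
Proof.
apply/compact_near_coveringP => J F P FF H.
have /compact_near_coveringP/(_ J F (fun i x => P i (clamp x)) FF) :=
  @segment_compact R 0 1.
move=> K; near=> i => s _; rewrite -(clamp_valK s).
have : forall x, `[0 : R, 1]%classic x -> P i (clamp x).
  near: i; apply: K => x _; have [[A B] /= [nA FB] AB] := H (clamp x) I.
  exists (clamp @^-1` A, B) => /=; first by split=> //; apply: clamp_continuous.
  by move=> [y i] /= [Ay Bi]; exact: (AB (clamp y, i)).
by apply; rewrite /= in_itv/=; exact: unit_interval_bounds.
Unshelve. all: by end_near. Qed.

Lemma compact_cube : compact [set: cube R].
Proof.
have := @tychonoff nat (fun=> unit_interval R) (fun=> setT) (fun=> compact_unit_interval).
by rewrite (_ : [set f | _] = setT)//; apply/seteqP; split.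
Qed.

Lemma uniform_modulus (X : normedModType R) (h : cube R -> X) (e : R) :
  continuous h -> 0 < e ->
  exists l, forall t t', close l t t' -> `|h t' - h t| <= e.
Proof.
move=> ch e0.
have /compact_near_coveringP/(_ nat \oo
  (fun l t => forall t', close l t t' -> `|h t' - h t| <= e) _) := compact_cube.
case.
  move=> t _; have e20 : 0 < e / 2 by lra.
  have /cvgrPdist_lt/(_ _ e20)/nbhs_close[l lh] := ch t.
  (* With radius [2^-(l+1)] here and [k >= l + 1], a point close to [t'] at level [k] is still close
     to [t] at level [l]. *)
  exists ([set t' | forall j, (j < l)%N -> `|coord t' j - coord t j| < 2^-1 ^+ l.+1],
          [set k | (l.+1 <= k)%N]) => /=.
    by split; [apply: close_nbhs; exact: half_gt0|exists l.+1].
  move=> [t' k] /= [t't lk] t'' t't''.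
  have h1 : `|h t - h t'| < e / 2.
    apply: lh => j jl; rewrite (le_trans (ltW (t't j jl)))// half_mono//.
  have h2 : `|h t - h t''| < e / 2.
    apply: lh => j jl; rewrite -(subrKA (coord t' j)) (le_trans (ler_normD _ _))//.
    have := t't j jl; have := t't'' j (leq_trans jl (ltnW lk)).
    have := @half_mono _ _ lk; rewrite !exprS; lra.
  rewrite -(subrKA (h t)) (le_trans (ler_normD _ _))// distrC; lra.
move=> l _ /(_ l (leqnn l)) /= H; exists l => t t'; exact: H.
Qed.

Lemma bounded_on_cube (X : normedModType R) (h : cube R -> X) : continuous h ->
  exists2 M : R, 0 <= M & forall t, `|h t| <= M.
Proof.
move=> ch; have cn : continuous (fun t => `|h t| : R).
  move=> t; apply: (@continuous_comp _ _ _ h (fun x : X => `|x|)); first exact: ch.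
  exact: norm_continuous.
have [|M [_ hM]] := compact_bounded (@continuous_compact _ _ (fun t => `|h t| : R) setT _ compact_cube).
  by apply: continuous_subspaceT.
exists (`|M| + 1) => [|t]; first by rewrite addr_ge0.
apply: (le_trans (ler_norm _)); apply: (hM (`|M| + 1)); last by exists t.
by rewrite (le_lt_trans (ler_norm M))// ltrDl.
Qed.

End cube_topology.

(** * The product sigma-algebra and dyadic cells *)

Section cube_measure.
Context {R : realType}.
Notation T := (cube_measurable R).

Lemma measurable_coord j : measurable_fun setT ((@coord R) ^~ j : T -> R).
Proof.
move=> _ A mA; rewrite setTI; apply: sub_sigma_algebra; exists j, A => //.
Qed.

Lemma measurable_to_cube d (Y : measurableType d) (f : Y -> T) :
  (forall j, measurable_fun setT (fun y => coord (f y) j)) ->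
  measurable_fun setT f.
Proof.
move=> mf; apply: (@measurability _ _ _ _ setT f (@cube_cylinders R)) => //.
move=> _ [_ [j [A mA ->]] <-]; exact: (mf j measurableT A mA).
Qed.

Definition box (n : nat) (A : nat -> set R) : set T :=
  [set t | forall j, (j < n)%N -> A j (coord t j)].

Lemma boxS n A : box n.+1 A = box n A `&` [set t | A n (coord t n)].
Proof.
apply/seteqP; split=> t.
  by move=> h; split=> [j jn|]; apply: h => //; exact: leqW.
by move=> [h hn] j; rewrite ltnS leq_eqVlt => /orP[/eqP->//|]; exact: h.
Qed.

Lemma measurable_box n A : (forall j, measurable (A j)) -> measurable (box n A).
Proof.
move=> mA; elim: n => [|n IH].
  by rewrite (_ : box 0 A = setT)//; apply/seteqP; split.
rewrite boxS; apply: measurableI => //.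
by have := measurable_coord n measurableT (mA n); rewrite setTI.
Qed.

(* The cell of [t] only depends on the coordinates [j < n] with [c j != 0]. *)
Definition code (n : nat) (c : nat -> nat) (t : cube R) : seq nat :=
  mkseq (fun j => Num.truncn ((c j)%:R * coord t j)) n.

Lemma scaled_ge0 (c : nat -> nat) (t : cube R) j : 0 <= (c j)%:R * coord t j.
Proof. by rewrite mulr_ge0//; case/andP: (coord_bounds t j). Qed.

Lemma codeP n c t q : code n c t = q <-> size q = n /\ forall j, (j < n)%N ->
  (nth 0 q j)%:R <= (c j)%:R * coord t j < (nth 0 q j).+1%:R.
Proof.
split=> [<-|[sq h]].
  split=> [|j jn]; first by rewrite size_mkseq.
  by rewrite nth_mkseq// truncn_itv// scaled_ge0.
apply: (@eq_from_nth _ 0); rewrite size_mkseq// => j jn.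
by rewrite nth_mkseq//; apply/truncn_def; exact: h.
Qed.

Lemma cell_boxE n c q : size q = n -> [set t | code n c t = q] =
  box n (fun j => [set x | (nth 0 q j)%:R <= (c j)%:R * x < (nth 0 q j).+1%:R]).
Proof.
move=> sq; apply/seteqP; split=> t /=; first by move/codeP => [].
by move=> h; apply/codeP.
Qed.

Lemma measurable_slab (a b c : R) : measurable [set x : R | a <= c * x < b].
Proof.
have -> : [set x : R | a <= c * x < b] = (fun x => c * x) @^-1` `[a, b[.
  by apply/seteqP; split=> x /=; rewrite in_itv.
by rewrite -[X in measurable X]setTI; apply: (mulrl_measurable _).
Qed.

Lemma measurable_cell n c q : measurable ([set t | code n c t = q] : set T).
Proof.
have [sq|sq] := eqVneq (size q) n.
  by rewrite cell_boxE//; apply: measurable_box => j; exact: measurable_slab.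
rewrite (_ : [set _ | _] = set0)//; apply/seteqP; split=> // t /= tq.
by rewrite -tq size_mkseq eqxx in sq.
Qed.

Lemma code_close n c t t' j : (j < n)%N -> code n c t = code n c t' ->
  `|coord t' j - coord t j| * (c j)%:R <= 1.
Proof.
move=> jn tt'; have [_ /(_ j jn)] := (codeP n c t _).1 erefl.
have [_ /(_ j jn)] := (codeP n c t' _).1 erefl; rewrite tt'.
set q := nth 0 _ j; move=> /andP[h1 h2] /andP[h3 h4].
rewrite -[(c j)%:R]ger0_norm// -normrM ler_norml mulrC mulrBr.
rewrite -natr1 in h2 h4; lra.
Qed.

(** The integer part of [c * x] is the quotient by [d] of the integer part of [c * d * x], so a mesh
    that is a multiple determines the coarser one. *)
Lemma code_refine n n' (c c' : nat -> nat) t t' : (n <= n')%N ->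
  (forall j, (j < n)%N -> c j = 0%N \/ exists2 d, (0 < d)%N & c' j = (c j * d)%N) ->
  code n' c' t = code n' c' t' -> code n c t = code n c t'.
Proof.
move=> nn' cc' h; apply: (@eq_from_nth _ 0); rewrite ?size_mkseq// => j jn.
have jn' := leq_trans jn nn'.
have := congr1 (nth 0 ^~ j) h; rewrite !nth_mkseq//.
have [->|[d d0 ->]] := cc' j jn; first by rewrite !mul0r.
suff H (u : cube R) : Num.truncn ((c j)%:R * coord u j) =
    (Num.truncn ((c j * d)%:R * coord u j) %/ d)%N by rewrite !H => ->.
apply/truncn_def; have := truncn_itv (scaled_ge0 (fun j => c j * d)%N u j).
set q := Num.truncn _; move=> /andP[h1 h2].
have dR : 0 < d%:R :> R by rewrite ltr0n.
have E : (c j)%:R * coord u j * d%:R = (c j * d)%:R * coord u j :> R.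
  by rewrite natrM; ring.
apply/andP; split; rewrite -(ler_pM2r dR) || rewrite -(ltr_pM2r dR).
  by rewrite E (le_trans _ h1)// -natrM ler_nat leq_divM.
by rewrite E (lt_le_trans h2)// -natrM ler_nat -ltn_divLR.
Qed.

(** The sigma-algebra is generated by cylinders; an open set is a union of dyadic cells, of which
    there are only countably many. *)
Lemma open_cube_measurable (U : set (cube R)) : open U -> measurable (U : set T).
Proof.
move=> oU.
pose C (p : nat * seq nat) : set T := [set t | code p.1 (fun=> 2 ^ p.1)%N t = p.2].
have -> : U = \bigcup_(p in [set p | C p `<=` U]) C p.
  apply/seteqP; split=> [t Ut|t [p /= pU]]; last exact: pU.
  have [l lU] := nbhs_close (open_nbhs_nbhs (conj oU Ut)).
  exists (l, code l (fun=> 2 ^ l)%N t) => //= t' /= tt'; apply: lU => j jl.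
  have := code_close jl (esym tt'); rewrite -ler_pdivlMr ?ltr0n ?expn_gt0//.
  by rewrite div1r natrX exprVn.
rewrite bigcup_mkcond; apply: countable_bigcupT_measurable => //.
move=> p; case: ifP => // _; exact: measurable_cell.
Qed.

Lemma borel_preimage_measurable (X : normedModType R) (g : cube R -> X) (B : set X) :
  continuous g -> <<s @open X >> B -> measurable (g @^-1` B : set T).
Proof.
move=> cg; move: B; apply: smallest_sub.
  split.
  - by rewrite /= preimage_set0; exact: measurable0.
  - by move=> A mA; rewrite /= setTD preimage_setC; exact: measurableC.
  - by move=> F mF; rewrite /= preimage_bigcup; exact: bigcup_measurable.
by move=> U oU /=; apply: open_cube_measurable; apply: open_comp => // t _; exact: cg.
Qed.

End cube_measure.

Lemma pushforward_measure d1 d2 (T1 : measurableType d1) (T2 : measurableType d2)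
    (R : realType) (m : {measure set T1 -> \bar R}) (f : T1 -> T2) :
  measurable_fun setT f ->
  exists nu : {measure set T2 -> \bar R}, forall A, nu A = m (f @^-1` A).
Proof. by move=> mf; unshelve eexists (pushforward m f : {measure set T2 -> \bar R}). Qed.

(** * Uniqueness and shift invariance of the product measure *)

Section product_measure_theory.
Context {R : realType} (mu : probability (cube_measurable R) R).
Notation T := (cube_measurable R).
Notation lam := (@lebesgue_measure R).
Hypothesis mu_product : is_product_lebesgue mu.

Definition pad (n : nat) (A : nat -> set R) (j : nat) : set R :=
  if (j < n)%N then A j else setT.

Lemma box_pad n n' (A : nat -> set R) : (n <= n')%N -> box n A = box n' (pad n A).
Proof.
move=> nn'; apply/seteqP; split=> t h j jn; last first.
  by have := h j (leq_trans jn nn'); rewrite /pad jn.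
by rewrite /pad; case: ifPn => // jn'; exact: h.
Qed.

Lemma measurable_pad n (A : nat -> set R) : (forall j, measurable (A j)) ->
  forall j, measurable (pad n A j).
Proof. by move=> mA j; rewrite /pad; case: ifPn. Qed.

Lemma mu_box n (A : nat -> set R) : (forall j, measurable (A j)) ->
  mu (box n A) = (\prod_(j < n) lam (A j `&` `[0%R : R, 1%R]))%E.
Proof. by move=> mA; rewrite -mu_product. Qed.

(** Boxes form a pi-system generating the sigma-algebra. Testing only those with at least [n0]
    factors lets a given coordinate be assumed among the factors. *)
Lemma mu_unique (n0 : nat) (nu : {measure set T -> \bar R}) :
  (forall n (A : nat -> set R), (n0 <= n)%N -> (forall j, measurable (A j)) ->
     nu (box n A) = mu (box n A)) ->
  forall A, measurable A -> nu A = mu A.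
Proof.
move=> numu A mA.
pose G : set (set T) := [set C | exists n, exists2 A : nat -> set R,
  (n0 <= n)%N /\ (forall j, measurable (A j)) & C = box n A].
have GT : G setT.
  exists n0, (fun=> setT); first by split=> // j; exact: measurableT.
  by apply/seteqP; split.
symmetry; apply: (@measure_unique _ _ T G (fun=> setT)) => //.
- apply/seteqP; split.
    apply: smallest_sub; first exact: smallest_sigma_algebra.
    move=> _ [j [B mB ->]]; apply: sub_sigma_algebra.
    exists (maxn n0 j.+1), (fun i => if i == j then B else setT).
      by split=> [|i]; [exact: leq_maxl|case: ifP].
    apply/seteqP; split=> t /=; first by move=> Bt i _; case: ifPn => // /eqP ->.
    by move/(_ j); rewrite eqxx; apply; rewrite leq_max ltnSn orbT.
  apply: smallest_sub; first exact: sigma_algebra_measurable.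
  by move=> _ [n [B [_ mB] ->]]; exact: measurable_box.
- move=> _ _ [n [B [n0n mB] ->]] [n' [B' [n0n' mB'] ->]].
  exists (maxn n n'), (fun j => pad n B j `&` pad n' B' j).
    split; first by rewrite (leq_trans n0n)// leq_maxl.
    by move=> j; apply: measurableI; exact: measurable_pad.
  rewrite (box_pad B (leq_maxl n n')) (box_pad B' (leq_maxr n n')).
  apply/seteqP; split=> t /=; first by move=> [h h'] j jn; split; [exact: h|exact: h'].
  by move=> h; split=> j /h [].
- by apply/seteqP; split=> // t _; exists 0%N.
- by move=> _ [n [B [n0n mB] ->]]; rewrite numu.
- by move=> _; exact: (le_lt_trans (probability_le1 mu measurableT) (ltry 1)).
Qed.

Definition shift (m : nat) (t : cube R) : cube R :=
  fun j => if (j < m)%N then t j else t j.+1.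

Lemma measurable_shift m : measurable_fun setT (shift m : T -> T).
Proof.
apply: measurable_to_cube => j.
have -> : (fun t : T => coord (shift m t) j) =
    (@coord R) ^~ (if (j < m)%N then j else j.+1).
  by apply/funext => t; rewrite /coord /shift; case: ifP.
exact: measurable_coord.
Qed.

(** The preimage of a box is the box with one more factor, the whole interval, inserted at place
    [m]; that factor has mass one. *)
Lemma mu_shift m (A : set T) : measurable A -> mu (shift m @^-1` A) = mu A.
Proof.
move=> mA; have [nu nuE] := pushforward_measure mu (measurable_shift m).
rewrite -(nuE A); apply: (@mu_unique m.+1 nu) => // n B mn mB; rewrite nuE.
pose B' j := if (j < m)%N then B j else if (j == m)%N then setT else B j.-1.
have -> : shift m @^-1` box n B = box n.+1 B'.
  apply/seteqP; split=> t h j jn.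
    rewrite /B'; case: ltnP => jm; last case: eqVneq => // jnm.
      have := h j; rewrite /coord /shift jm; apply; exact: leq_trans jm (ltnW mn).
    have {jnm}jm : (m < j)%N by rewrite ltn_neqAle eq_sym jnm.
    case: j jn jm => // j jn jm /=.
    have := h j jn; rewrite /coord /shift ifF//; apply/negbTE.
    by rewrite -leqNgt.
  rewrite /coord /shift; case: ltnP => jm.
    by have := h j (leqW jn); rewrite /B' jm.
  have := h j.+1; rewrite ltnS jn => /(_ isT).
  by rewrite /B' ltnNge (leqW jm)/= gtn_eqF.
have mB' j : measurable (B' j) by rewrite /B'; case: ifP => // _; case: ifP.
apply: etrans (mu_box n.+1 mB') _; apply: esym; apply: etrans (mu_box n mB) _.
apply: esym.
have mn1 : (m < n.+1)%N by rewrite ltnW.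
rewrite (bigD1_ord (Ordinal mn1))//= /B' ltnn eqxx setTI.
rewrite lebesgue_measure_itv/= lte_fin ltr01 oppr0 adde0 mul1e.
apply: eq_bigr => j _; rewrite /lift/= /bump.
case: (leqP m j) => jm /=.
  by rewrite ltnNge leqW//= add1n gtn_eqF.
by rewrite add0n jm.
Qed.

End product_measure_theory.

(** * Integration along one coordinate *)

Section slices.
Context {R : realType} (mu : probability (cube_measurable R) R).
Notation T := (cube_measurable R).
Notation RR := (measurableTypeR R).
Notation lam := (@lebesgue_measure R).
Hypothesis mu_product : is_product_lebesgue mu.

Definition move (m : nat) (t : cube R) (x : R) : cube R := dfwith t m (clamp x).

Lemma coord_move m t x j :
  coord (move m t x) j = if j == m then clamp_val x else coord t j.
Proof.
rewrite /coord /move; case: eqVneq => [->|jm]; first by rewrite dfwithin.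
by rewrite dfwithout// eq_sym.
Qed.

Lemma cube_ext (t t' : cube R) : (forall j, coord t j = coord t' j) -> t = t'.
Proof. by move=> h; apply/funext => j; apply: unit_interval_inj; exact: h. Qed.

Lemma clamp_val_id (x : R) : 0 <= x <= 1 -> clamp_val x = x.
Proof. exact: clampE. Qed.

Lemma move_move m t x y : move m (move m t x) y = move m t y.
Proof. by apply: cube_ext => j; rewrite !coord_move; case: (j == m). Qed.

Lemma move_id m t : move m t (coord t m) = t.
Proof.
apply: cube_ext => j; rewrite coord_move; case: eqVneq => // ->.
by rewrite clamp_val_id// coord_bounds.
Qed.

Lemma clamp_val_continuous : continuous (@clamp_val R).
Proof.
move=> x; apply/cvgrPdist_lt => e e0.
near=> y; apply: (le_lt_trans (clamp_lipschitz _ _)); near: y.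
exact: cvgr_dist_lt.
Unshelve. all: by end_near. Qed.

Lemma measurable_move m :
  measurable_fun setT (fun p : T * RR => move m p.1 p.2 : T).
Proof.
apply: measurable_to_cube => j.
have [->|jm] := eqVneq j m.
  rewrite (_ : (fun _ => _) = (@clamp_val R) \o snd); last first.
    by apply/funext => p; rewrite coord_move eqxx.
  apply: measurableT_comp => //; apply: continuous_measurable_fun.
  exact: clamp_val_continuous.
rewrite (_ : (fun _ => _) = ((@coord R ^~ j) : T -> R) \o (fst : T * RR -> T)).
  by apply: measurableT_comp => //; exact: measurable_coord.
by apply/funext => p; rewrite coord_move (negbTE jm).
Qed.

Definition slice (m : nat) (t : cube R) (A : set (cube R)) : set R :=
  [set x | 0 <= x <= 1 /\ A (move m t x)].

Let graph_mble m (A : set T) : measurable A -> measurable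
  ((fun p : T * RR => move m p.1 p.2) @^-1` A `&` setT `*` `[0, 1]%classic).
Proof.
move=> mA; apply: measurableI; last exact: measurableX.
by have := measurable_move m measurableT mA; rewrite setTI.
Qed.

Let slice_xsection m t (A : set T) : slice m t A =
  xsection ((fun p : T * RR => move m p.1 p.2) @^-1` A `&` setT `*` `[0, 1]%classic) t.
Proof.
apply/seteqP; split=> x /=; rewrite /xsection/= inE/= in_itv/=.
  by move=> [x01 h].
by move=> [h [_ x01]].
Qed.

(** Fubini's theorem without splitting the cube: resampling coordinate [m] uniformly, that is
    mapping [mu] times Lebesgue measure on [[0, 1]] by [move m], gives back [mu], as is checked on
    boxes. *)
Lemma mu_slice m (A : set T) : measurable A ->
  mu A = (\int[mu]_t lam (slice m t A))%E.
Proof.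
move=> mA.
have mD : measurable (setT `*` `[0 : R, 1]%classic : set (T * RR)).
  exact: measurableX.
pose prod_mu : {measure set (T * RR) -> \bar R} :=
  (mu \x (lam : {sigma_finite_measure set RR -> \bar R}))%E.
pose restr : {measure set (T * RR) -> \bar R} := mrestr prod_mu mD.
have [nu nuE] := pushforward_measure restr (measurable_move m).
rewrite -[LHS](@mu_unique _ mu m.+1 nu)//; last first.
  move=> n B mn mB; rewrite nuE /restr/= /mrestr/=.
  pose B0 j := if j == m then setT else B j.
  have mB0 j : measurable (B0 j) by rewrite /B0; case: ifP.
  have -> : (fun p : T * RR => move m p.1 p.2) @^-1` box n B `&` setT `*` `[0, 1] =
      box n B0 `*` (B m `&` `[0, 1]).
    apply/seteqP; split=> -[t x] /=; rewrite in_itv/=.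
      move=> [h [_ x01]]; split; last split=> //.
        move=> j jn; rewrite /B0; case: eqVneq => // jm.
        by have := h j jn; rewrite coord_move (negbTE jm).
      by have := h m mn; rewrite coord_move eqxx clamp_val_id.
    move=> [h [Bx x01]]; split=> // j jn; rewrite coord_move.
    case: eqVneq => [->|jm].
      by rewrite clamp_val_id.
    by have := h j jn; rewrite /B0 (negbTE jm).
  have -> : prod_mu (box n B0 `*` (B m `&` `[0, 1])) =
      (mu (box n B0) * lam (B m `&` `[0%R, 1%R]))%E.
    apply: product_measure1E; first exact: measurable_box.
    exact: (measurableI _ _ (mB m) (measurable_itv _)).
  have -> := mu_box mu_product n mB0; have -> := mu_box mu_product n mB.
  rewrite (bigD1 (Ordinal mn))//= [in RHS](bigD1 (Ordinal mn))//= /B0 eqxx setTI.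
  rewrite lebesgue_measure_itv/= lte_fin ltr01 oppr0 adde0 mul1e muleC.
  congr (_ * _)%E; apply: eq_bigr => j; rewrite -val_eqE/= => jm.
  by rewrite (negbTE jm).
rewrite nuE /restr/= /mrestr/= /prod_mu /product_measure1.
by apply: eq_integral => t _ /=; rewrite slice_xsection.
Qed.

Lemma measurable_slice m t (A : set T) : measurable A -> measurable (slice m t A).
Proof.
move=> mA; have -> : slice m t A = `[0, 1] `&` (move m t @^-1` A).
  by apply/seteqP; split=> x /=; rewrite in_itv.
apply: measurableI => //; rewrite -[X in measurable X]setTI.
have : measurable_fun setT (move m t : R -> T).
  rewrite (_ : move m t = (fun p : T * RR => move m p.1 p.2 : T) \o (pair t)).
    by apply: measurableT_comp; [exact: measurable_move|exact: measurable_pair1].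
  by [].
by apply.
Qed.

Lemma slice_null m (A : set T) : measurable A ->
  (forall t, lam (slice m t A) = 0%E) -> mu A = 0%E.
Proof.
by move=> mA h; rewrite (mu_slice m mA); apply: integral0_eq => t _; exact: h.
Qed.

Lemma slice_ge m (A Z : set T) (c : R) : measurable A -> measurable Z -> 0 <= c ->
  (forall t, Z t -> (c%:E <= lam (slice m t A))%E) -> (c%:E * mu Z <= mu A)%E.
Proof.
move=> mA mZ c0 h; rewrite (mu_slice m mA).
have -> : (c%:E * mu Z = \int[mu]_(t in Z) cst c%:E t)%E by rewrite integral_cst.
rewrite integral_mkcond; apply: ge0_le_integral => //.
- by move=> t _; rewrite patchE; case: ifP; rewrite ?lee_fin.
- by apply: (measurable_restrictT _ mZ).1; exact: measurable_cst.
- rewrite (_ : (fun t => _) = lam \o xsection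
    ((fun p : T * RR => move m p.1 p.2) @^-1` A `&` setT `*` `[0, 1]%classic)).
    by apply: measurable_fun_xsection; exact: graph_mble.
  by apply/funext => t /=; rewrite slice_xsection.
by move=> t _; rewrite patchE; case: ifPn => [/set_mem/h//|_]; rewrite measure_ge0.
Qed.

End slices.

(** * Differentiable surfaces *)

Lemma subrACA (V : zmodType) (a b c d : V) : a - b - (c - d) = a - c - (b - d).
Proof. by rewrite !opprB !addrA (addrAC a) (addrAC a (- c)) addrAC. Qed.

Section surface_calculus.
Context {R : realType} {X : normedModType R}.

Lemma dist_dist (a b c : X) : `| `|a - c| - `|b - c| | <= `|a - b|.
Proof.
by apply: le_trans (ler_dist_dist _ _) _; rewrite subrACA subrr subr0.
Qed.

Lemma scale_quotient (y : R) (v p : X) : y != 0 ->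
  y^-1 *: v - p = y^-1 *: (v - y *: p).
Proof. by move=> y0; rewrite scalerBr scalerA mulVf// scale1r. Qed.

(** Continuity replaces the lower bound on slopes of [growth]: such a bound along lines is what the
    mean value inequality is to provide. *)
Lemma growth_continuous (h : R -> R) (a b p : R) : a <= b ->
  (forall s e, a <= s -> s <= b -> 0 < e -> exists2 d : R, 0 < d &
     forall s', `|s' - s| < d -> `|h s' - h s| <= e) ->
  (forall s, a <= s -> s < b -> exists s',
     [/\ s < s', s' <= b & p * (s' - s) <= h s' - h s]) ->
  p * (b - a) <= h b - h a.
Proof.
move=> ab hc step.
pose S := [set s | [/\ a <= s, s <= b & p * (s - a) <= h s - h a]].
have Sa : S a by split=> //; rewrite !subrr !mulr0.
have supS : has_sup S by split; [exists a|exists b => x []].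
pose c := sup S.
have ac : a <= c by apply: ub_le_sup => //; case: supS.
have cb : c <= b by apply: ge_sup; [exists a|move=> x []].
have Sc : S c.
  split=> //; apply/ler_addgt0Pr => e e0; have e20 : 0 < e / 2 by lra.
  have p0 : 0 < 1 + `|p| by have := normr_ge0 p; lra.
  have [d d0 hd] := hc c _ ac cb e20.
  pose d' := Num.min d (e / 2 / (1 + `|p|)).
  have d'0 : 0 < d' by rewrite lt_min d0 divr_gt0.
  have [s [as_ sb hs] ces] := sup_adherent d'0 supS.
  have sc : s <= c by apply: ub_le_sup => //; case: supS.
  have : `|s - c| < d' by rewrite distrC ger0_norm; rewrite -/c in ces; lra.
  rewrite lt_min => /andP[/hd h1]; rewrite ltr_pdivlMr// => h2.
  have : p * (c - s) <= `|s - c| * (1 + `|p|).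
    rewrite distrC mulrC mulrDr mulr1 -normrM (le_trans (ler_norm _))// lerDr//.
  have := ler_norm (h s - h c); lra.
have [<-|cneb] := eqVneq c b; first by case: Sc.
have {cneb}cb' : c < b by rewrite lt_neqAle cneb.
case: Sc => _ _ hc'; have [s' [cs' s'b Hs]] := step _ ac cb'.
suff Ss' : S s'.
  have : s' <= c by apply: ub_le_sup => //; case: supS.
  by rewrite leNgt cs'.
by split=> //; [exact: le_trans (ltW cs')|lra].
Qed.

Definition is_partial (j : nat) (g : cube R -> X) (t : cube R) (p : X) :=
  forall e : R, 0 < e -> exists2 d : R, 0 < d &
    forall y, 0 <= y <= 1 -> `|y - coord t j| < d ->
      `|g (move j t y) - g t - (y - coord t j) *: p| <= e * `|y - coord t j|.

Lemma dfwith_move j (t : cube R) (s : unit_interval R) : dfwith t j s = move j t (val s).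
Proof. by rewrite /move clamp_valK. Qed.

Lemma partial_quotientE j (g : cube R -> X) t s :
  partial_quotient j g t s = (val s - coord t j)^-1 *: (g (move j t (val s)) - g t).
Proof. by rewrite /partial_quotient dfwith_move. Qed.

Lemma is_partialP j (g : cube R -> X) t (p : X) :
  is_partial j g t p <-> partial_quotient j g t s @[s --> (t j)^'] --> p.
Proof.
split=> [H U /nbhs_ballP[e /= e0 eU]|H e e0].
  have e20 : 0 < e / 2 by lra.
  have [d d0 hd] := H _ e20.
  apply/unit_nbhsP; exists d => // s sd /= st; apply: eU.
  have y0 : val s - coord t j != 0.
    rewrite subr_eq0; apply: contra st => /eqP h; apply/eqP.
    exact: unit_interval_inj.
  have := hd _ (unit_interval_bounds s) sd.
  rewrite -ball_normE/= partial_quotientE (distrC p).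
  move: (val s - _) y0 (g _ - g _) => y y0 v hv.
  rewrite (scale_quotient _ _ y0) normrZ normfV mulrC ltr_pdivrMr ?normr_gt0//.
  by rewrite (le_lt_trans hv)// ltr_pM2r ?normr_gt0//; lra.
have /unit_nbhsP[d d0 hd] := H _ (nbhsx_ballx p e e0).
exists d => // y y01 yd.
have [y0|y0] := eqVneq (y - coord t j) 0.
  have -> : y = coord t j by apply/eqP; rewrite -subr_eq0 y0.
  by rewrite move_id !subrr scale0r subrr !normr0 mulr0.
have := hd (clamp y); rewrite clampE// => /(_ yd) /=.
have yj : clamp y != t j.
  apply: contra y0 => /eqP h; rewrite subr_eq0; apply/eqP.
  by rewrite /coord -h clampE.
move=> /(_ yj); rewrite -ball_normE/= partial_quotientE clampE// (distrC p).
move: (y - _) y0 (g _ - g _) => z z0 v hv.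
have -> : v - z *: p = z *: (z^-1 *: v - p).
  by rewrite (scale_quotient _ _ z0) scalerA mulfV// scale1r.
by rewrite normrZ mulrC ler_wpM2r// ltW.
Qed.

Lemma unit_dnbhs_proper (s : unit_interval R) : ProperFilter (s^' : set_system (unit_interval R)).
Proof.
apply: Build_ProperFilter_ex => U /unit_nbhsP[d d0 dU].
have /andP[s0 s1] := unit_interval_bounds s.
pose m := Num.min (d / 2) (1 / 2).
have m0 : 0 < m by rewrite lt_min; apply/andP; split; lra.
have md : m <= d / 2 by rewrite ge_min lexx.
have m1 : m <= 1 / 2 by rewrite ge_min lexx orbT.
pose x := if val s <= 1 / 2 then val s + m else val s - m.
have x01 : 0 <= x <= 1 by rewrite /x; case: ifPn; rewrite -?ltNge => h; apply/andP; split; lra.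
have xs : `|x - val s| = m.
  rewrite /x; case: ifPn => _; rewrite addrAC subrr add0r ?normrN gtr0_norm//.
exists (clamp x); apply: dU; first by rewrite clampE// xs; lra.
apply/eqP => /(congr1 val); rewrite clampE// => h.
by move: xs; rewrite h subrr normr0; lra.
Qed.

Lemma partialE j (g : cube R -> X) t (p : X) : is_partial j g t p -> partial j g t = p.
Proof.
move=> /is_partialP H; apply: cvg_lim => //.
exact: (@fmap_proper_filter _ _ _ _ (unit_dnbhs_proper (t j))).
Qed.

(** The partial derivatives are carried as data, so that operations yield explicit formulas;
    [C1_surface] turns the result into a surface. *)
Record C1 (g : cube R -> X) (Dg : nat -> cube R -> X) : Prop := MkC1 {
  C1_continuous : continuous g;
  C1_partial : forall j t, is_partial j g t (Dg j t);
  C1_partial_continuous : forall j, continuous (Dg j) }.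

Lemma surface_C1 (g : surface X) : C1 g (fun j => partial j g).
Proof.
split; first exact: surface_continuous.
  by move=> j t; apply/is_partialP; exact: surface_has_partial.
exact: surface_partial_continuous.
Qed.

Lemma C1_surface g Dg : C1 g Dg ->
  exists s : surface X, (s : cube R -> X) = g /\ forall j, partial j s = Dg j.
Proof.
move=> [cg pg cDg].
have hp j : has_partial j g.
  by move=> t; apply/cvg_ex; exists (Dg j t); apply/is_partialP; exact: pg.
have pE j : partial j g = Dg j by apply/funext => t; exact: partialE.
have cp j : continuous (partial j g) by rewrite pE; exact: cDg.
by exists (Surface cg hp cp); split.
Qed.

Lemma move_continuous j (t : cube R) : continuous (move j t).
Proof.
move=> x; apply: (@continuous_comp _ _ _ (@clamp R) (fun s => dfwith t j s : cube R)).
  exact: clamp_continuous.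
exact: (@dfwith_continuous nat (fun=> unit_interval R) t j).
Qed.

Lemma is_partial_move j (g : cube R -> X) t (p : X) x : is_partial j g (move j t x) p ->
  0 <= x <= 1 -> forall e : R, 0 < e -> exists2 d : R, 0 < d &
    forall y, 0 <= y <= 1 -> `|y - x| < d ->
      `|g (move j t y) - g (move j t x) - (y - x) *: p| <= e * `|y - x|.
Proof.
move=> H x01 e e0; have [d d0 hd] := H e e0; exists d => // y y01.
by have := hd y y01; rewrite coord_move eqxx move_move clamp_val_id.
Qed.

(** The values being vectors, the real induction is applied to [s |-> - |G s - G x|], where [G s] is
    [g (move j t s)] minus [s] times [p]. *)
Lemma mean_value j g Dg t (p : X) (M x y : R) : C1 g Dg -> 0 <= x -> x <= y -> y <= 1 ->
  (forall z, x <= z -> z <= y -> `|Dg j (move j t z) - p| <= M) ->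
  `|g (move j t y) - g (move j t x) - (y - x) *: p| <= M * (y - x).
Proof.
move=> [cg pg _] x0 xy y1 hM; apply/ler_addgt0Pr => e e0.
have K0 : 0 < y - x + 1 by lra.
pose d := e / (y - x + 1); have d0 : 0 < d by exact: divr_gt0.
pose G s := g (move j t s) - s *: p.
have cG : continuous G.
  move=> s; apply: cvgB; last by apply: cvgZl; exact: cvg_id.
  by apply: (@continuous_comp _ _ _ (move j t) g); [exact: move_continuous|exact: cg].
have := @growth_continuous (fun s => - `|G s - G x|) x y (- (M + d)) xy.
rewrite subrr normr0 oppr0 subr0 => H.
have {H} : - (M + d) * (y - x) <= - `|G y - G x|.
  apply: H => [s r xs sy r0|s xs sy].
    have /cvgrPdist_lt/(_ r r0)/nbhs_ballP[/= a a0 ha] := cG s.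
    exists a => // s' s's.
    have : `|G s - G s'| < r by apply: ha; rewrite /ball/= distrC.
    rewrite distrC => h; have h2 := dist_dist (G s') (G s) (G x).
    by rewrite -opprD normrN; exact: le_trans h2 (ltW h).
  have s01 : 0 <= s <= 1 by apply/andP; split; lra.
  have [a a0 ha] := is_partial_move (pg j (move j t s)) s01 d0.
  pose s' := Num.min y (s + a / 2).
  have ss' : s < s' by rewrite lt_min sy/=; lra.
  have s'a : s' <= s + a / 2 by rewrite ge_min lexx orbT.
  have s'y : s' <= y by rewrite ge_min lexx.
  exists s'; split=> //.
  have s'01 : 0 <= s' <= 1 by apply/andP; split; lra.
  have s's : `|s' - s| < a by rewrite gtr0_norm; lra.
  have := ha _ s'01 s's; rewrite gtr0_norm ?subr_gt0// => h1.
  have h2 := hM s xs (ltW sy).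
  have h3 : `|G s' - G s| <= (M + d) * (s' - s).
    have -> : G s' - G s = (g (move j t s') - g (move j t s) - (s' - s) *: Dg j (move j t s))
        + (s' - s) *: (Dg j (move j t s) - p).
      by rewrite scalerBr addrA subrK scalerBl /G subrACA.
    have h4 : (s' - s) * `|Dg j (move j t s) - p| <= M * (s' - s).
      by rewrite mulrC ler_wpM2r// subr_ge0 ltW.
    apply: (le_trans (ler_normD _ _)); rewrite normrZ gtr0_norm ?subr_gt0//; lra.
  have : `|G s' - G x| <= `|G s' - G s| + `|G s - G x|.
    by rewrite -{1}(subrKA (G s)) ler_normD.
  lra.
have -> : G y - G x = g (move j t y) - g (move j t x) - (y - x) *: p.
  by rewrite /G scalerBl subrACA.
move=> h; have : d * (y - x) <= e.
  by rewrite /d mulrAC ler_pdivrMr//; nra.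
lra.
Qed.

End surface_calculus.

(** * Operations on C1 maps *)

Section C1_operations.
Context {R : realType}.

Lemma sum_increment (V : zmodType) (a b c d x y : V) :
  a + b - (c + d) - (x + y) = (a - c - x) + (b - d - y).
Proof. by rewrite !opprD (addrACA a b) (addrACA (a - c)). Qed.

Lemma product_increment (V : lmodType R) (a' f z a : R) (u' u p : V) :
  a' *: u' - f *: u - z *: (a *: u + f *: p) =
  a' *: (u' - u - z *: p) + ((a' - f - z * a) *: u + (a' - f) *: (z *: p)).
Proof.
have -> : u' - u - z *: p = u' - (u + z *: p) by rewrite opprD addrA.
have -> : (a' - f - z * a) *: u + (a' - f) *: (z *: p) =
    (a' - f) *: (u + z *: p) - (z * a) *: u.
  by rewrite scalerBl scalerDr addrAC.
rewrite scalerBr [(a' - f) *: _]scalerBl -[a' *: (u + _) - _ - _]addrA subrKA.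
rewrite -addrA; congr (_ + _); rewrite !scalerDr !opprD !scalerA (mulrC f z).
by rewrite -[RHS]addrA; congr (_ + _); rewrite addrC.
Qed.

Lemma C1_const (X : normedModType R) (p : X) : C1 (fun=> p) (fun _ _ => 0).
Proof.
split=> [|j t e e0|j]; [exact: cst_continuous| |exact: cst_continuous].
by exists 1 => // y _ _; rewrite subrr scaler0 subr0 normr0 mulr_ge0// ltW.
Qed.

Lemma C1_add (X : normedModType R) (g h : cube R -> X) Dg Dh :
  C1 g Dg -> C1 h Dh -> C1 (fun t => g t + h t) (fun j t => Dg j t + Dh j t).
Proof.
move=> [cg pg cDg] [ch ph cDh]; split=> [t|j t e e0|j t].
- by apply: continuousD; [exact: cg|exact: ch].
- have e20 : 0 < e / 2 by lra.
  have [d d0 hd] := pg j t _ e20; have [d' d'0 hd'] := ph j t _ e20.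
  exists (Num.min d d'); first by rewrite lt_min d0.
  move=> y y01; rewrite lt_min => /andP[yd yd'].
  have := hd y y01 yd; have := hd' y y01 yd'.
  have -> : g (move j t y) + h (move j t y) - (g t + h t)
      - (y - coord t j) *: (Dg j t + Dh j t) =
    (g (move j t y) - g t - (y - coord t j) *: Dg j t) +
    (h (move j t y) - h t - (y - coord t j) *: Dh j t).
    by rewrite scalerDr; exact: sum_increment.
  move=> h1 h2; apply: (le_trans (ler_normD _ _)); lra.
- by apply: continuousD; [exact: cDg|exact: cDh].
Qed.

Lemma C1_scale (X : normedModType R) (phi : cube R -> R) (u : cube R -> X) Dphi Du :
  C1 phi Dphi -> C1 u Du ->
  C1 (fun t => phi t *: u t) (fun j t => Dphi j t *: u t + phi t *: Du j t).
Proof.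
move=> [cphi pphi cDphi] [cu pu cDu]; split=> [t|j t e e0|j t].
- by apply: continuousZ; [exact: cphi|exact: cu].
- pose a := Dphi j t; pose p := Du j t.
  have [B B0 hB] := bounded_on_cube cphi.
  have K1 : 0 < B + 1 by lra.
  have K2 : 0 < `|u t| + 1 by have := normr_ge0 (u t); lra.
  have K3 : 0 < (`|a| + 1) * (`|p| + 1).
    by apply: mulr_gt0; [have := normr_ge0 a|have := normr_ge0 p]; lra.
  have e1 : 0 < e / 3 / (B + 1) by apply: divr_gt0 => //; lra.
  have e2 : 0 < Num.min 1 (e / 3 / (`|u t| + 1)).
    by rewrite lt_min ltr01/=; apply: divr_gt0 => //; lra.
  have e3 : 0 < e / 3 / ((`|a| + 1) * (`|p| + 1)) by apply: divr_gt0 => //; lra.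
  have [d1 d10 hd1] := pu j t _ e1; have [d2 d20 hd2] := pphi j t _ e2.
  exists (Num.min (Num.min d1 d2) (e / 3 / ((`|a| + 1) * (`|p| + 1)))).
    by rewrite !lt_min d10 d20.
  move=> y y01; rewrite !lt_min -andbA => /and3P[yd1 yd2 yd3].
  have H1 := hd1 y y01 yd1; have H2 := hd2 y y01 yd2; rewrite -/a -/p in H1 H2 *.
  move: (y - coord t j) yd1 yd2 yd3 H1 H2 => z zd1 zd2 zd3.
  set t' := move j t y => H1 H2.
  have H2' : `|phi t' - phi t - z *: a| <= e / 3 / (`|u t| + 1) * `|z|.
    by apply: (le_trans H2); rewrite ler_wpM2r// ge_min lexx orbT.
  have H4 : `|phi t' - phi t| <= (`|a| + 1) * `|z|.
    have h : `|phi t' - phi t - z *: a| <= 1 * `|z|.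
      by apply: (le_trans H2); rewrite ler_wpM2r// ge_min lexx.
    have := ler_normD (phi t' - phi t - z *: a) (z *: a).
    by rewrite subrK normrZ; lra.
  have -> : phi t' *: u t' - phi t *: u t - z *: (a *: u t + phi t *: p) =
      phi t' *: (u t' - u t - z *: p) +
      ((phi t' - phi t - z *: a) *: u t + (phi t' - phi t) *: (z *: p)).
    exact: product_increment.
  have B1 : `|phi t' *: (u t' - u t - z *: p)| <= e / 3 * `|z|.
    rewrite normrZ; apply: (@le_trans _ _ ((B + 1) * (e / 3 / (B + 1) * `|z|))).
      by apply: ler_pM => //; rewrite (le_trans (hB _))//; lra.
    by rewrite mulrA mulrCA mulfV ?gt_eqF// mulr1.
  have B2 : `|(phi t' - phi t - z *: a) *: u t| <= e / 3 * `|z|.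
    rewrite normrZ; apply: (@le_trans _ _ (e / 3 / (`|u t| + 1) * `|z| * (`|u t| + 1))).
      by apply: ler_pM => //; lra.
    by rewrite mulrAC divfK// gt_eqF.
  have B3 : `|(phi t' - phi t) *: (z *: p)| <= e / 3 * `|z|.
    rewrite !normrZ.
    apply: (@le_trans _ _ ((`|a| + 1) * `|z| * (`|z| * (`|p| + 1)))).
      by apply: ler_pM => //; apply: ler_wpM2l => //; lra.
    rewrite (_ : _ * _ = `|z| * ((`|a| + 1) * (`|p| + 1)) * `|z|); last by ring.
    by rewrite ler_wpM2r// -ler_pdivlMr// ltW.
  apply: (le_trans (ler_normD _ _)).
  have := ler_normD ((phi t' - phi t - z *: a) *: u t) ((phi t' - phi t) *: (z *: p)).
  lra.
- have c1 : {for t, continuous (fun t => Dphi j t *: u t)}.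
    by apply: continuousZ; [exact: cDphi|exact: cu].
  have c2 : {for t, continuous (fun t => phi t *: Du j t)}.
    by apply: continuousZ; [exact: cphi|exact: cDu].
  exact: (continuousD c1 c2).
Qed.

Lemma C1_sum (X : normedModType R) (n : nat) (g : nat -> cube R -> X) Dg :
  (forall i, C1 (g i) (Dg i)) ->
  C1 (fun t => \sum_(i < n) g i t) (fun j t => \sum_(i < n) Dg i j t).
Proof.
move=> hC; elim: n => [|n IH].
  have := C1_const (0 : X); congr C1; first by apply/funext => t; rewrite big_ord0.
  by apply/funext => j; apply/funext => t; rewrite big_ord0.
have := C1_add IH (hC n); congr C1.
  by apply/funext => t; rewrite big_ord_recr.
by apply/funext => j; apply/funext => t; rewrite big_ord_recr.
Qed.

(** The quadratic bound on the remainder stands for differentiability of [b], uniformly in [x]; it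
    is what functions built from squares of [ramp] satisfy. *)
Lemma C1_coord (b b' : R -> R) (K : R) i : continuous b -> continuous b' ->
  (forall x y, `|b (x + y) - b x - y * b' x| <= K * y ^+ 2) ->
  C1 (fun t : cube R => b (coord t i))
     (fun j t => if j == i then b' (coord t i) else 0).
Proof.
move=> cb cb' hb; split=> [t|j t e e0|j].
- apply: (@continuous_comp _ _ _ (fun t : cube R => coord t i) b); last exact: cb.
  exact: coord_continuous.
- have K0 : 0 < `|K| + 1 by have := normr_ge0 K; lra.
  exists (e / (`|K| + 1)); first exact: divr_gt0.
  move=> y y01; rewrite coord_move ltr_pdivlMr// => yd.
  case: (eqVneq j i) => [ji|ij]; last first.
    by rewrite subrr scaler0 subr0 normr0 mulr_ge0// ltW.
  rewrite clamp_val_id//; rewrite ji in yd *.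
  move: yd; set x := coord t i => yd.
  have := hb x (y - x); rewrite (addrC x) subrK => /le_trans; apply.
  rewrite -[(y - x) ^+ 2]ger0_norm ?sqr_ge0// normrX expr2 mulrA ler_wpM2r//.
  rewrite (le_trans _ (ltW yd))// mulrC ler_wpM2l//.
  by rewrite (le_trans (ler_norm _))// lerDl.
- case: eqVneq => [_|_] t; last exact: cst_continuous.
  apply: (@continuous_comp _ _ _ (fun t : cube R => coord t i) b'); last exact: cb'.
  exact: coord_continuous.
Qed.

Lemma coord_shift m (t : cube R) j :
  coord (shift m t) j = if (j < m)%N then coord t j else coord t j.+1.
Proof. by rewrite /coord /shift; case: ifP. Qed.

Lemma shift_move_lt m j (t : cube R) y : (j < m)%N ->
  shift m (move j t y) = move j (shift m t) y.
Proof.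
move=> jm; apply: cube_ext => i; rewrite coord_shift !coord_move coord_shift.
case: ifPn => // im; have ij : (i.+1 == j) = false by apply/negbTE; lia.
have ij' : (i == j) = false by apply/negbTE; lia.
by rewrite ij ij'.
Qed.

Lemma shift_move_eq m (t : cube R) y : shift m (move m t y) = shift m t.
Proof.
apply: cube_ext => i; rewrite !coord_shift !coord_move.
case: ifPn => im; first by rewrite ltn_eqF.
by rewrite (_ : (i.+1 == m) = false)//; apply/negbTE; lia.
Qed.

Lemma shift_move_gt m j (t : cube R) y : (m < j.+1)%N ->
  shift m (move j.+1 t y) = move j (shift m t) y.
Proof.
move=> jm; apply: cube_ext => i; rewrite coord_shift !coord_move coord_shift.
case: ifPn => im; last by rewrite eqSS.
have -> : (i == j.+1) = false by apply/negbTE; lia.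
by have -> : (i == j) = false by apply/negbTE; lia.
Qed.

Lemma shift_continuous m : continuous (shift m : cube R -> cube R).
Proof.
apply: continuous_to_cube => j; rewrite /shift.
by case: (j < m)%N => t; exact: proj_cube_continuous.
Qed.

Definition Dshift (X : normedModType R) m (Dg : nat -> cube R -> X) j (t : cube R) : X :=
  if (j < m)%N then Dg j (shift m t) else if j == m then 0 else Dg j.-1 (shift m t).

Lemma C1_shift (X : normedModType R) m (g : cube R -> X) Dg :
  C1 g Dg -> C1 (g \o shift m) (Dshift m Dg).
Proof.
move=> [cg pg cDg]; have cS := @shift_continuous m.
have cc (h : cube R -> X) : continuous h -> continuous (h \o shift m).
  by move=> ch t; apply: continuous_comp; [exact: cS|exact: ch].
split=> [|j t e e0|j]; first exact: cc.
  rewrite /Dshift/=; case: ltnP => jm.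
    have [d d0 hd] := pg j (shift m t) e e0; exists d => // y y01 yd.
    have := hd y y01; rewrite coord_shift jm => /(_ yd).
    by rewrite shift_move_lt.
  case: eqVneq => [->|jneq].
    exists 1 => // y _ _; rewrite shift_move_eq subrr scaler0 subr0 normr0.
    by rewrite mulr_ge0// ltW.
  case: j jm jneq => [|j] jm jneq /=; first by lia.
  have mj : (m < j.+1)%N by lia.
  have [d d0 hd] := pg j (shift m t) e e0; exists d => // y y01 yd.
  have := hd y y01; rewrite coord_shift ltnNge -ltnS mj/= => /(_ yd).
  by rewrite shift_move_gt.
rewrite /Dshift; case: (j < m)%N; first exact: cc.
by case: (j == m); [exact: cst_continuous|exact: cc].
Qed.

End C1_operations.

(** * Cutoff functions of cells *)

Section bumps.
Context {R : realType}.
Implicit Types (x y : R).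

Definition ramp x : R := Num.max 0 x.

Lemma ramp_le0 x : x <= 0 -> ramp x = 0. Proof. exact: max_l. Qed.
Lemma ramp_ge0 x : 0 <= x -> ramp x = x. Proof. exact: max_r. Qed.

Lemma ramp_continuous : continuous ramp.
Proof.
move=> x; apply: continuous_max; [exact: cst_continuous|exact: cvg_id].
Qed.

Lemma ramp_sqr x y : `|ramp (x + y) ^+ 2 - ramp x ^+ 2 - y * (2 * ramp x)| <= y ^+ 2.
Proof.
rewrite ler_norml; have [x0|x0] := leP x 0; have [s0|s0] := leP (x + y) 0.
- by rewrite !ramp_le0//; apply/andP; split; nra.
- by rewrite (ramp_le0 x0) (ramp_ge0 (ltW s0)); apply/andP; split; nra.
- by rewrite (ramp_ge0 (ltW x0)) (ramp_le0 s0); apply/andP; split; nra.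
- by rewrite (ramp_ge0 (ltW x0)) (ramp_ge0 (ltW s0)); apply/andP; split; nra.
Qed.

(* A C^1 step: the second difference of [ramp ^ 2] with step 1/2, normalised. *)
Definition step x : R :=
  2 * ramp x ^+ 2 - 4 * ramp (x - 1 / 2) ^+ 2 + 2 * ramp (x - 1) ^+ 2.

Definition step' x : R := 4 * ramp x - 8 * ramp (x - 1 / 2) + 4 * ramp (x - 1).

Lemma step_increment x y : `|step (x + y) - step x - y * step' x| <= 8 * y ^+ 2.
Proof.
have := ramp_sqr x y; have := ramp_sqr (x - 1 / 2) y; have := ramp_sqr (x - 1) y.
rewrite /step /step' (addrAC x y (- (1 / 2))) (addrAC x y (- 1)).
rewrite !ler_norml => /andP[h1 h2] /andP[h3 h4] /andP[h5 h6].
apply/andP; split; lra.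
Qed.

Lemma stepE x : [/\ x <= 0 -> step x = 0 /\ step' x = 0,
  1 <= x -> step x = 1 /\ step' x = 0, 0 <= step x <= 1 & `|step' x| <= 2].
Proof.
have [x0|x0] := leP x 0.
  have -> : step x = 0 by rewrite /step !ramp_le0//; lra.
  have -> : step' x = 0 by rewrite /step' !ramp_le0//; lra.
  by split; [by []|move=> h; exfalso; lra|rewrite lexx ler01|rewrite normr0].
have [x1|x1] := leP 1 x.
  have -> : step x = 1 by rewrite /step !ramp_ge0//; lra.
  have -> : step' x = 0 by rewrite /step' !ramp_ge0//; lra.
  by split; [move=> h; exfalso; lra|by []|rewrite ler01 lexx|rewrite normr0].
have [x2|x2] := leP x (1 / 2).
  have -> : step x = 2 * x ^+ 2.
    by rewrite /step (ramp_ge0 (ltW x0)) !ramp_le0 ?subr_le0// ?(ltW x1)//; lra.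
  have -> : step' x = 4 * x.
    by rewrite /step' (ramp_ge0 (ltW x0)) !ramp_le0 ?subr_le0// ?(ltW x1)//; lra.
  split=> [h|h| |]; [lra|lra|apply/andP; split; nra|].
  by rewrite ger0_norm; lra.
have -> : step x = 1 - 2 * (1 - x) ^+ 2.
  rewrite /step (ramp_ge0 (ltW x0)) (ramp_le0 (_ : x - 1 <= 0)) ?ramp_ge0//; lra.
have -> : step' x = 4 * (1 - x).
  rewrite /step' (ramp_ge0 (ltW x0)) (ramp_le0 (_ : x - 1 <= 0)) ?ramp_ge0//; lra.
split=> [h|h| |]; [lra|lra|apply/andP; split; nra|].
by rewrite ger0_norm; lra.
Qed.

Lemma step_continuous : continuous step.
Proof.
have c a : continuous (fun x : R => ramp (x - a) ^+ 2).
  move=> x; apply: (@continuous_comp _ _ _ (fun x : R => ramp (x - a)) (fun z : R => z ^+ 2)).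
    apply: (@continuous_comp _ _ _ (fun x : R => x - a) ramp); last exact: ramp_continuous.
    by apply: cvgB; [exact: cvg_id|exact: cvg_cst].
  exact: exprn_continuous.
have c0 : continuous (fun x : R => ramp x ^+ 2).
  by move=> x; have := c 0 x; rewrite (_ : (fun x : R => _) = (fun x => ramp x ^+ 2))//;
    apply/funext => z; rewrite subr0.
move=> x; apply: cvgD; last by apply: cvgMl_tmp; exact: c.
by apply: cvgB; apply: cvgMl_tmp; [exact: c0|exact: c].
Qed.

Lemma step'_continuous : continuous step'.
Proof.
have c a : continuous (fun x : R => ramp (x - a)).
  move=> x; apply: (@continuous_comp _ _ _ (fun x : R => x - a) ramp); last exact: ramp_continuous.
  by apply: cvgB; [exact: cvg_id|exact: cvg_cst].
move=> x; apply: cvgD; last by apply: cvgMl_tmp; exact: c.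
by apply: cvgB; apply: cvgMl_tmp; [exact: ramp_continuous|exact: c].
Qed.

Lemma C1_step (al be : R) i : C1 (fun t : cube R => step (al * coord t i + be))
  (fun j t => if j == i then al * step' (al * coord t i + be) else 0).
Proof.
have ca : continuous (fun z : R => al * z + be).
  by move=> z; apply: cvgD; [apply: cvgMl_tmp; exact: cvg_id|exact: cvg_cst].
apply: (@C1_coord R (fun z => step (al * z + be)) (fun z => al * step' (al * z + be))
  (8 * al ^+ 2)).
- move=> z; apply: (@continuous_comp _ _ _ (fun z : R => al * z + be) step).
    exact: ca.
  exact: step_continuous.
- move=> z; apply: cvgMr.
  apply: (@continuous_comp _ _ _ (fun z : R => al * z + be) step'); first exact: ca.
  exact: step'_continuous.
- move=> x y; have -> : al * (x + y) + be = al * x + be + al * y by ring.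
  rewrite mulrA (mulrC y) -mulrA -exprMn; exact: step_increment.
Qed.

(** A cutoff for the cell [q i < c i * t_i < q i + 1], where coordinates with [c i = 0] are
    unconstrained. [K i] is the reciprocal of the relative width of the layer in which [phi] falls
    from 1 to 0, which accounts for the derivative bound. *)
Record cell_bump (n : nat) (c : nat -> nat) (q K : nat -> R)
    (phi : cube R -> R) (Dphi : nat -> cube R -> R) : Prop := CellBump {
  bump_C1 : C1 phi Dphi;
  bump_range : forall t, 0 <= phi t <= 1;
  bump_D0 : forall j t, (n <= j)%N -> Dphi j t = 0;
  bump_D : forall j t, `|Dphi j t| <= 4 * K j * (c j)%:R;
  bump_support : forall i t, (i < n)%N -> (0 < c i)%N ->
    ~ (q i < (c i)%:R * coord t i < q i + 1) -> phi t = 0 /\ forall j, Dphi j t = 0;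
  bump_core : forall t, (forall i, (i < n)%N -> (0 < c i)%N ->
     q i + (K i)^-1 <= (c i)%:R * coord t i <= q i + 1 - (K i)^-1) -> phi t = 1 }.

Lemma cell_bump_exists (n : nat) (c : nat -> nat) (q K : nat -> R) :
  (forall j, 0 < K j) -> exists phi Dphi, cell_bump n c q K phi Dphi.
Proof.
move=> K0; have Kc j : 0 <= 4 * K j * (c j)%:R.
  by rewrite !mulr_ge0// ltW.
elim: n => [|n [phi [Dphi [C pr D0 Db sup core]]]].
  exists (fun=> 1), (fun _ _ => 0); split=> //; first exact: C1_const.
  - by move=> t; rewrite ler01 lexx.
  - by move=> j t; rewrite normr0.
have [cn0|cn0] := posnP (c n).
  exists phi, Dphi; split=> //.
  - by move=> j t nj; exact: D0 (ltnW nj).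
  - move=> i t; rewrite ltnS leq_eqVlt => /orP[/eqP->|]; first by rewrite cn0.
    exact: sup.
  - by move=> t h; apply: core => i ni; apply: h; exact: leqW.
(* [f1] rises just after the lower face of the cell and [f2] falls just before the upper one; the
   factor [K n] gives both transitions the relative width [1 / K n]. *)
pose f1 (t : cube R) := step (K n * (c n)%:R * coord t n + - (K n * q n)).
pose f2 (t : cube R) := step (- (K n * (c n)%:R) * coord t n + K n * (q n + 1)).
have C1f1 := C1_step (K n * (c n)%:R) (- (K n * q n)) n.
have C1f2 := C1_step (- (K n * (c n)%:R)) (K n * (q n + 1)) n.
have C1f := C1_scale C1f1 C1f2; rewrite -/f1 -/f2 in C1f.
have a1E (t : cube R) : K n * (c n)%:R * coord t n + - (K n * q n) =
  K n * ((c n)%:R * coord t n - q n) by ring.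
have a2E (t : cube R) : - (K n * (c n)%:R) * coord t n + K n * (q n + 1) =
  K n * (q n + 1 - (c n)%:R * coord t n) by ring.
set Df := (fun (j : nat) (t : cube R) => _ + _) in C1f.
have f1b (t : cube R) : 0 <= f1 t <= 1.
  by rewrite /f1; case: (stepE (K n * (c n)%:R * coord t n + - (K n * q n))).
have f2b (t : cube R) : 0 <= f2 t <= 1.
  by rewrite /f2; case: (stepE (- (K n * (c n)%:R) * coord t n + K n * (q n + 1))).
have Dfn (t : cube R) : `|Df n t| <= 4 * K n * (c n)%:R.
  have Kn : 0 <= K n * (c n)%:R by rewrite mulr_ge0// ltW.
  rewrite /Df eqxx; case: (stepE (K n * (c n)%:R * coord t n + - (K n * q n))).
  move=> _ _ _ s1; case: (stepE (- (K n * (c n)%:R) * coord t n + K n * (q n + 1))).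
  move=> _ _ _ s2; apply: (le_trans (ler_normD _ _)).
  have -> : 4 * K n * (c n)%:R = K n * (c n)%:R * 2 * 1 + 1 * (K n * (c n)%:R * 2) by ring.
  have bnd (a b A B : R) : `|a| <= A -> `|b| <= B -> `|a * b| <= A * B.
    by move=> ? ?; rewrite normrM ler_pM.
  rewrite lerD//; apply: (bnd); first apply: bnd => //.
  - by rewrite ger0_norm.
  - by case/andP: (f2b t) => ? ?; rewrite ger0_norm.
  - by case/andP: (f1b t) => ? ?; rewrite ger0_norm.
  - by apply: bnd => //; rewrite normrN ger0_norm.
have Dfj j (t : cube R) : j != n -> Df j t = 0.
  by move=> jn; rewrite /Df (negbTE jn) scaler0 addr0 scale0r.
have fz (t : cube R) : ~ (q n < (c n)%:R * coord t n < q n + 1) ->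
    f1 t * f2 t = 0 /\ forall j, Df j t = 0.
  move=> nq; have [h|h] := leP ((c n)%:R * coord t n) (q n).
    have [h0 _ _ _] := stepE (K n * (c n)%:R * coord t n + - (K n * q n)).
    have [|s0 s'0] := h0.
      by rewrite a1E pmulr_rle0// subr_le0.
    rewrite -/(f1 t) in s0; rewrite s0 mul0r; split=> // j; rewrite /Df.
    by rewrite -/(f1 t) s0 s'0 mulr0 scale0r if_same scale0r addr0.
  have h' : q n + 1 <= (c n)%:R * coord t n.
    by rewrite leNgt; apply/negP => h'; apply: nq; rewrite h h'.
  have [h0 _ _ _] := stepE (- (K n * (c n)%:R) * coord t n + K n * (q n + 1)).
  have [|s0 s'0] := h0.
    by rewrite a2E pmulr_rle0// subr_le0.
  rewrite -/(f2 t) in s0; rewrite s0 mulr0; split=> // j; rewrite /Df.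
  by rewrite -/(f2 t) s0 s'0 mulr0 scaler0 if_same scaler0 addr0.
exists (fun t => phi t * (f1 t * f2 t)), (fun j t => Dphi j t * (f1 t * f2 t) + phi t * Df j t).
have fb (t : cube R) : 0 <= f1 t * f2 t <= 1.
  case/andP: (f1b t) => ? ?; case/andP: (f2b t) => ? ?.
  by rewrite mulr_ge0//= mulr_ile1.
split.
- exact: (C1_scale C C1f).
- move=> t; case/andP: (fb t) => ? ?; case/andP: (pr t) => ? ?.
  by rewrite mulr_ge0//= mulr_ile1.
- move=> j t nj; rewrite D0 ?(ltnW nj)// mul0r add0r Dfj ?mulr0//.
  by rewrite gtn_eqF.
- move=> j t; have [->|jn] := eqVneq j n.
    rewrite D0// mul0r add0r normrM -[leRHS]mul1r ler_pM//.
    by case/andP: (pr t) => ? ?; rewrite ger0_norm.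
  rewrite Dfj// mulr0 addr0 normrM -[leRHS]mulr1 ler_pM//.
  by case/andP: (fb t) => ? ?; rewrite ger0_norm.
- move=> i t; rewrite ltnS leq_eqVlt => /orP[/eqP->|ni] ci nq.
    by have [-> h] := fz t nq; rewrite mulr0; split=> // j; rewrite h !mulr0 addr0.
  have [-> h] := sup i t ni ci nq; rewrite mul0r; split=> // j.
  by rewrite h !mul0r addr0.
- move=> t h; rewrite core; last by move=> i ni; apply: h; exact: leqW.
  case/andP: (h n (ltnSn n) cn0) => h1 h2; rewrite mul1r.
  have Kn : K n * (K n)^-1 = 1 by rewrite mulfV// gt_eqF.
  have [_ g1 _ _] := stepE (K n * (c n)%:R * coord t n + - (K n * q n)).
  have [|s1 _] := g1.
    by rewrite a1E -[leLHS]Kn ler_pM2l//; lra.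
  have [_ g2 _ _] := stepE (- (K n * (c n)%:R) * coord t n + K n * (q n + 1)).
  have [|s2 _] := g2.
    by rewrite a2E -[leLHS]Kn ler_pM2l//; lra.
  by rewrite /f1 /f2 s1 s2 mulr1.
Qed.

End bumps.

(** * Neighbourhoods in the space of surfaces *)

Section surface_topology.
Context {R : realType} {X : normedModType R}.
Implicit Types (g h s : surface X).

Lemma sup_norm_le (g : cube R -> X) (M : R) : (forall t, `|g t| <= M) -> sup_norm g <= M.
Proof.
move=> gM; apply: ge_sup; first by exists `|g point|, point.
by move=> _ [t _ <-].
Qed.

Lemma le_sup_norm (g : cube R -> X) t : continuous g -> `|g t| <= sup_norm g.
Proof.
move=> /bounded_on_cube[M _ gM]; apply: ub_le_sup; last by exists t.
by exists M => _ [t' _ <-].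
Qed.

Lemma C1_opp (g : cube R -> X) Dg : C1 g Dg -> C1 (fun t => - g t) (fun j t => - Dg j t).
Proof.
move=> Cg; have := C1_scale (C1_const (-1 : R)) Cg; congr C1.
  by apply/funext => t; rewrite scaleN1r.
by apply/funext => j; apply/funext => t; rewrite scale0r add0r scaleN1r.
Qed.

Lemma surface_diff_C1 g h :
  C1 (fun t => h t - g t) (fun j t => partial j h t - partial j g t).
Proof. exact: C1_add (surface_C1 h) (C1_opp (surface_C1 g)). Qed.

Lemma partial_diff g h j t :
  partial j (fun t => h t - g t) t = partial j h t - partial j g t.
Proof. by apply: partialE; case: (surface_diff_C1 g h). Qed.

Lemma surface_ball_intro n (e e' : R) g h : e' < e -> (forall t, `|h t - g t| <= e') ->
  (forall j t, (j < n)%N -> `|partial j h t - partial j g t| <= e') ->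
  surface_ball n e g h.
Proof.
move=> ee' h0 hj [|k] kn /=; apply: le_lt_trans ee'; apply: sup_norm_le => //.
by move=> t; rewrite partial_diff; exact: hj.
Qed.

Lemma surface_ball_elim n (e : R) g h : surface_ball n e g h ->
  (forall t, `|h t - g t| < e) /\
  forall j t, (j < n)%N -> `|partial j h t - partial j g t| < e.
Proof.
move=> B; split=> [t|j t jn].
  apply: (le_lt_trans _ (B 0%N (leq0n _))) => /=; apply: le_sup_norm.
  exact: C1_continuous (surface_diff_C1 g h).
apply: (le_lt_trans _ (B j.+1 jn)) => /=; rewrite -partial_diff; apply: le_sup_norm.
rewrite (_ : partial j _ = fun t => partial j h t - partial j g t).
  exact: (@C1_partial_continuous _ _ _ _ (surface_diff_C1 g h) j).
by apply/funext => u; rewrite partial_diff.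
Qed.

Lemma surface_ball_nbhs n (e : R) g : 0 < e -> nbhs g (surface_ball n e g).
Proof.
move=> e0; rewrite nbhsE.
(* An open set inside the ball: the pointwise bound [d] leaves the margin [e'] for a further
   displacement. *)
pose V : set (surface X) := [set h | exists2 e' : R, 0 < e' &
  exists d : R, [/\ d + e' < e, forall t, `|h t - g t| <= d &
  forall j t, (j < n)%N -> `|partial j h t - partial j g t| <= d]].
exists V; last first.
  move=> h [e' e'0 [d [de h0 hj]]]; apply: (@surface_ball_intro _ _ d) => //; lra.
split; last first.
  exists (e / 3); first lra.
  exists (e / 3); split=> [|t|j t _]; first lra; rewrite subrr normr0; lra.
move=> h [e' e'0 [d [de h0 hj]]]; exists n, (e' / 2); first lra.
move=> h' /surface_ball_elim[h'0 h'j].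
exists (e' / 4); first lra.
exists (d + e' / 2); split=> [|t|j t jn]; first lra.
  rewrite -(subrKA (h t)); apply: (le_trans (ler_normD _ _)).
  have := h0 t; have := h'0 t; lra.
rewrite -(subrKA (partial j h t)); apply: (le_trans (ler_normD _ _)).
have := hj j t jn; have := h'j j t jn; lra.
Qed.

Lemma nbhs_surface_ball g (U : set (surface X)) : nbhs g U ->
  exists n, exists2 e : R, 0 < e & surface_ball n e g `<=` U.
Proof.
rewrite nbhsE => -[V [oV Vg] VU]; have [n [e e0 eV]] := oV g Vg.
by exists n, e => //; exact: subset_trans VU.
Qed.

Lemma shift_close m n (t : cube R) : (n <= m)%N -> close n t (shift m t).
Proof.
move=> nm j jn; rewrite coord_shift (leq_trans jn nm) subrr normr0.
by rewrite exprn_ge0.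
Qed.

Lemma shift_uniform (h : cube R -> X) (e : R) : continuous h -> 0 < e ->
  exists M, forall m t, (M <= m)%N -> `|h (shift m t) - h t| <= e.
Proof.
move=> ch e0; have [l hl] := uniform_modulus ch e0.
by exists l => m t lm; apply: hl; exact: shift_close.
Qed.

(** [shift m t] and [t] agree in the first [m] coordinates, so for large [m] uniform continuity on
    the cube applies. Taking [m > j] keeps [Dshift] on the branch where the [j]-th derivative is
    unchanged. *)
Lemma shift_uniform_partial g n (e : R) : 0 < e ->
  exists M, forall m t, (M <= m)%N -> `|g (shift m t) - g t| <= e /\
  forall j, (j < n)%N -> `|Dshift m (fun j => partial j g) j t - partial j g t| <= e.
Proof.
move=> e0; have [M0 hM0] := shift_uniform (C1_continuous (surface_C1 g)) e0.
elim: n => [|n [M hM]]; first by exists M0 => m t mM; split=> //; exact: hM0.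
have [M1 hM1] := shift_uniform (@C1_partial_continuous _ _ _ _ (surface_C1 g) n) e0.
exists (maxn n.+1 (maxn M M1)) => m t; rewrite !geq_max => /and3P[nm Mm M1m].
have [h0 hj] := hM m t Mm; split=> // j; rewrite ltnS leq_eqVlt => /orP[/eqP->|].
  by rewrite /Dshift nm; exact: hM1.
exact: hj.
Qed.

Lemma C1_coord_id (m : nat) :
  C1 (fun t : cube R => coord t m) (fun j _ => if j == m then 1 else 0).
Proof.
have := @C1_coord R id (fun=> 1) 0 m; apply.
- by move=> x; exact: cvg_id.
- exact: cst_continuous.
- move=> x y /=; have -> : x + y - x - y * 1 = 0 by ring.
  by rewrite normr0 mul0r.
Qed.

Lemma displaced_surface g m (u : cube R -> X) Du : C1 u Du ->
  exists s, (forall t, s t = g (shift m t) + coord t m *: u t) /\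
  forall j t, partial j s t = Dshift m (fun j => partial j g) j t +
    ((if j == m then 1 else 0) *: u t + coord t m *: Du j t).
Proof.
move=> Cu; have := C1_add (C1_shift m (surface_C1 g)) (C1_scale (C1_coord_id m) Cu).
move=> /C1_surface[s [sE spE]]; exists s; split=> [t|j t]; first by rewrite sE.
by rewrite spE.
Qed.

(** The ball sees only partial derivatives with [j < n <= m]; the derivatives of [u] in later
    coordinates may be arbitrarily large, as they can be for bumps that are very narrow there. *)
Lemma displaced_ball g m n (e : R) (u : cube R -> X) Du s : (n <= m)%N -> 0 < e ->
  (forall t, s t = g (shift m t) + coord t m *: u t) ->
  (forall j t, partial j s t = Dshift m (fun j => partial j g) j t +
    ((if j == m then 1 else 0) *: u t + coord t m *: Du j t)) ->
  (forall t, `|g (shift m t) - g t| <= e / 3 /\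
  forall j, (j < n)%N -> `|Dshift m (fun j => partial j g) j t - partial j g t| <= e / 3) ->
  (forall t, `|u t| <= e / 3) ->
  (forall j t, (j < m)%N -> `|Du j t| <= e / 3) ->
  surface_ball n e g s.
Proof.
move=> nm e0 sE spE gm ue Due.
have scale_le (c : R) (v : X) : 0 <= c <= 1 -> `|v| <= e / 3 -> `|c *: v| <= e / 3.
  move=> /andP[c0 c1] ve; rewrite normrZ ger0_norm//.
  by apply: le_trans ve; rewrite ler_piMl.
apply: (@surface_ball_intro _ _ (2 * e / 3)); first lra.
  move=> t; rewrite sE addrAC; apply: (le_trans (ler_normD _ _)).
  have [h _] := gm t; have := scale_le _ _ (coord_bounds t m) (ue t); lra.
move=> j t jn; have jm := leq_trans jn nm.
rewrite spE (ltn_eqF jm) scale0r add0r addrAC; apply: (le_trans (ler_normD _ _)).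
have [_ h] := gm t; have := scale_le _ _ (coord_bounds t m) (Due j t jm).
have := h j jn; lra.
Qed.

End surface_topology.

(** * Generic surfaces *)

Section category.
Context {T : topologicalType}.
Implicit Types (A B : set T).

Lemma nowhere_denseP A : nowhere_dense A <->
  forall U, open U -> U !=set0 -> exists V, [/\ open V, V !=set0, V `<=` U & V `&` A = set0].
Proof.
split=> [nA U oU [x Ux]|H].
  have nU : ~ (U `<=` closure A).
    move=> UA; have : ((closure A)^°) x.
      by rewrite /interior; apply: (filterS UA); exact: open_nbhs_nbhs.
    by rewrite nA.
  have [y Uy nAy] : exists2 y, U y & ~ closure A y.
    by apply: contrapT => h; apply: nU => y Uy; apply: contrapT => h'; apply: h; exists y.
  exists (U `&` ~` closure A); split.
  - by apply: openI => //; apply: closed_openC; exact: closed_closure.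
  - by exists y.
  - exact: subIsetl.
  - by apply/seteqP; split=> // z [[_ nz] Az]; apply: nz; exact: subset_closure.
apply/seteqP; split=> // x /= hx.
have [V [oV [y Vy] VU VA]] := H _ (open_interior (closure A)) (ex_intro _ x hx).
have /(_ V (open_nbhs_nbhs (conj oV Vy)))[z [Az Vz]] := interior_subset (VU y Vy).
by have : (V `&` A) z by []; rewrite VA.
Qed.

Lemma nowhere_dense_sub A B : A `<=` B -> nowhere_dense B -> nowhere_dense A.
Proof.
move=> AB /nowhere_denseP nB; apply/nowhere_denseP => U oU U0.
have [V [oV V0 VU VB]] := nB U oU U0; exists V; split=> //.
by apply/seteqP; split=> // x [Vx Ax]; rewrite -VB; split=> //; exact: AB.
Qed.

Lemma nowhere_dense_closed A : closed A -> nowhere_dense (A `\` A^°).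
Proof.
move=> cA; apply/nowhere_denseP => U oU [x Ux].
have [UA|nUA] := pselect (U `<=` A).
  exists U; split=> //; first by exists x.
  apply/seteqP; split=> // z [Uz [_]]; apply.
  by apply: (filterS UA); exact: open_nbhs_nbhs.
have [y Uy nAy] : exists2 y, U y & ~ A y.
  by apply: contrapT => h; apply: nUA => y Uy; apply: contrapT => h'; apply: h; exists y.
exists (U `&` ~` A); split.
- by apply: openI => //; exact: closed_openC.
- by exists y.
- exact: subIsetl.
- by apply/seteqP; split=> // z [[_ nz] [Az _]].
Qed.

Lemma meager_sub A B : A `<=` B -> meager B -> meager A.
Proof.
move=> AB [F nF BF]; exists (fun n => F n `&` A).
  by move=> n; apply: nowhere_dense_sub (nF n); exact: subIsetl.
by rewrite -setI_bigcupl -BF setIC; apply/esym/setIidl.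
Qed.

Lemma meager_bigcup (F : nat -> set T) : (forall n, meager (F n)) -> meager (\bigcup_n F n).
Proof.
move=> mF; have /choice[G hG] n : exists G : nat -> set T,
    (forall k, nowhere_dense (G k)) /\ F n = \bigcup_k G k.
  by have [G ? ?] := mF n; exists G.
exists (fun i => if @unpickle (nat * nat)%type i is Some p then G p.1 p.2 else set0).
  move=> i; case: unpickle => [p|]; first by case: (hG p.1).
  by rewrite /nowhere_dense closure0 interior0.
apply/seteqP; split=> x.
  move=> [n _]; have [_ ->] := hG n; move=> [k _ Gx].
  by exists (pickle (n, k)) => //; rewrite pickleK.
move=> [i _]; case: unpickle => // p Gx; exists p.1 => //.
by have [_ ->] := hG p.1; exists p.2.
Qed.

Lemma residual_sub A B : A `<=` B -> residual A -> residual B.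
Proof. by move=> AB; apply: meager_sub; exact: subsetC. Qed.

Lemma residual_bigcap (F : nat -> set T) :
  (forall n, residual (F n)) -> residual (\bigcap_n F n).
Proof. by move=> rF; rewrite /residual setC_bigcap; exact: meager_bigcup. Qed.

Lemma residualI A B : residual A -> residual B -> residual (A `&` B).
Proof.
move=> rA rB; apply: (@residual_sub (\bigcap_n (if n == 0%N then A else B))).
  by move=> x h; split; [exact: (h 0%N)|exact: (h 1%N)].
by apply: residual_bigcap => n; case: ifP.
Qed.

Lemma meager_nowhere_dense A : nowhere_dense A -> meager A.
Proof.
by move=> nA; exists (fun=> A) => //; apply/seteqP; split=> x; [exists 0%N|case].
Qed.

Lemma residualT : residual [set: T].
Proof.
rewrite /residual setCT; apply: meager_nowhere_dense.
by rewrite /nowhere_dense closure0 interior0.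
Qed.

Lemma residual_dense_nbhs A :
  (forall U, open U -> U !=set0 -> exists V, [/\ open V, V !=set0, V `<=` U & V `<=` A]) ->
  residual A.
Proof.
move=> H; apply: meager_nowhere_dense; apply/nowhere_denseP => U oU U0.
have [V [oV V0 VU VA]] := H U oU U0; exists V; split=> //.
by apply/seteqP; split=> // x [/VA].
Qed.

Definition locally_dense A (x : T) :=
  exists2 U : set T, open U /\ U x & U `<=` closure A.

(* A substitute for the Baire category theorem: the boundary of [closure A] is nowhere dense. *)
Lemma residual_locally_dense A : residual A ->
  residual [set x | A x /\ locally_dense A x].
Proof.
move=> rA; pose C := closure A.
have cC : closed C by exact: closed_closure.
have ndC := nowhere_dense_closed cC.
have rC : residual (~` (C `\` C^°)).
  by rewrite /residual setCK; exact: meager_nowhere_dense.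
apply: residual_sub (residualI rA rC) => x [Ax nx]; split=> //.
exists (C^°); last exact: interior_subset.
split; first exact: open_interior.
by apply: contrapT => h; apply: nx; split=> //; exact: subset_closure.
Qed.

End category.

(** * Finite measures and Borel sets *)

Section real_probability.
Context d (T : measurableType d) (R : realType) (mu : probability T R).
Implicit Types A B : set T.

Definition prob A : R := fine (mu A).

Lemma probE A : measurable A -> mu A = (prob A)%:E.
Proof. by move=> mA; rewrite fineK// fin_num_measure. Qed.

Lemma prob_ge0 A : 0 <= prob A.
Proof. by rewrite fine_ge0. Qed.

Lemma prob_le A B : measurable A -> measurable B -> A `<=` B -> prob A <= prob B.
Proof.
by move=> mA mB AB; rewrite -lee_fin -!probE// le_measure// inE.
Qed.

Lemma probU A B : measurable A -> measurable B -> prob (A `|` B) <= prob A + prob B.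
Proof.
move=> mA mB; rewrite -lee_fin EFinD -!probE//; last exact: measurableU.
exact: measureU2.
Qed.

Lemma prob_le_U C A B : measurable A -> measurable B -> measurable C ->
  C `<=` A `|` B -> prob C <= prob A + prob B.
Proof.
move=> mA mB mC CAB; apply: le_trans (probU mA mB).
by apply: prob_le => //; exact: measurableU.
Qed.

Lemma prob_split A B : measurable A -> measurable B ->
  prob A = prob (A `\` B) + prob (A `&` B).
Proof.
move=> mA mB; apply: EFin_inj; rewrite EFinD -!probE//.
- exact: measureDI.
- exact: measurableI.
- exact: measurableD.
Qed.

Lemma prob_increasing (F : nat -> set T) (e : R) : (forall n, measurable (F n)) ->
  (forall n, F n `<=` F n.+1) -> 0 < e ->
  exists n, prob ((\bigcup_n F n) `\` F n) <= e.
Proof.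
move=> mF incF e0; have mU : measurable (\bigcup_n F n) by exact: bigcup_measurable.
have ndF : nondecreasing_seq F.
  by apply/nondecreasing_seqP => n; apply/subsetPset.
have cv := nondecreasing_cvg_mu (mu := mu) mF mU ndF.
have cv' : (fun n => prob (F n)) @ \oo --> prob (\bigcup_n F n).
  by apply: fine_cvg; rewrite -probE.
have /cvgrPdist_lt/(_ e e0)[n _ /(_ n (leqnn n)) /=] := cv'.
have FU : F n `<=` \bigcup_n F n by move=> x Fx; exists n.
have := prob_split mU (mF n); rewrite (setIidr FU).
by move=> ->; rewrite addrK ger0_norm ?prob_ge0// => /ltW; exists n.
Qed.

Lemma prob_bigcup (F : nat -> set T) (e : R) : (forall n, measurable (F n)) ->
  0 <= e -> (forall n, prob (F n) <= e / (2 ^ n.+1)%:R) -> prob (\bigcup_n F n) <= e.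
Proof.
move=> mF e0 h; have mU : measurable (\bigcup_n F n) by exact: bigcup_measurable.
rewrite -lee_fin -probE//.
have := @measure_sigma_subadditive _ _ _ mu _ _ mF mU (@subset_refl _ _).
move=> /le_trans; apply.
apply: le_trans (epsilon_trick0 xpredT e0).
apply: lee_nneseries => // n _.
by have : (mu (F n) <= (e / (2 ^ n.+1)%:R)%:E)%E by rewrite probE// lee_fin.
Qed.

End real_probability.

Section borel_sets.
Context {R : realType} {X : normedModType R}.
Implicit Types A B : set X.

Definition borel : set (set X) := <<s @open X >>.

Lemma borel_sigma_algebra : sigma_algebra setT borel.
Proof. exact: smallest_sigma_algebra. Qed.

Lemma borel_open A : open A -> borel A.
Proof. exact: sub_sigma_algebra. Qed.

Lemma borelC A : borel A -> borel (~` A).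
Proof.
by move=> bA; rewrite -setTD; have [_ h _] := borel_sigma_algebra; exact: h.
Qed.

Lemma borel_closed A : closed A -> borel A.
Proof.
move=> cA; have oA : open (~` A) by exact: closed_openC.
by have := borelC (borel_open oA); rewrite setCK.
Qed.

Lemma borel_bigcup (F : nat -> set X) : (forall n, borel (F n)) -> borel (\bigcup_n F n).
Proof.
by move=> bF; have [_ _ h] := borel_sigma_algebra; exact: h.
Qed.

Lemma borel_bigcap (F : nat -> set X) : (forall n, borel (F n)) -> borel (\bigcap_n F n).
Proof.
move=> bF; have := borelC (borel_bigcup (fun n => borelC (bF n))).
by rewrite -setC_bigcap setCK.
Qed.

Lemma borelU A B : borel A -> borel B -> borel (A `|` B).
Proof.
move=> bA bB; rewrite -bigcup2E; apply: borel_bigcup => -[//|[//|n]].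
by apply: borel_open; exact: open0.
Qed.

Lemma borelI A B : borel A -> borel B -> borel (A `&` B).
Proof.
by move=> bA bB; have := borelC (borelU (borelC bA) (borelC bB)); rewrite -setCI setCK.
Qed.

Lemma borelD A B : borel A -> borel B -> borel (A `\` B).
Proof. by move=> bA bB; rewrite setDE; apply: borelI => //; exact: borelC. Qed.

Lemma borel_ind (P : set (set X)) : (forall A, open A -> P A) ->
  (forall A, borel A -> P A -> P (~` A)) ->
  (forall F : nat -> set X, (forall n, borel (F n)) -> (forall n, P (F n)) -> P (\bigcup_n F n)) ->
  forall A, borel A -> P A.
Proof.
move=> Po Pc Pu A bA; suff : (borel `&` P) A by case.
move: A bA; apply: smallest_sub; last by move=> A oA; split; [exact: borel_open|exact: Po].
split.
- by split; [apply: borel_open|apply: Po]; exact: open0.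
- by move=> A [bA PA]; rewrite setTD; split; [exact: borelC|exact: Pc].
- by move=> F FP; split; [apply: borel_bigcup => n|apply: Pu => n]; case: (FP n).
Qed.

(* Bounding the distance from below, with [A] allowed to be empty. *)
Definition far (A : set X) (e : R) : set X := [set x | forall z, A z -> e <= `|x - z|].

Lemma closed_far A (e : R) : closed (far A e).
Proof.
rewrite (_ : far A e = \bigcap_(z in A) [set x | e <= `|x - z|]); last first.
  by apply/seteqP; split=> x h z; exact: h.
apply: closed_bigI => z _.
rewrite (_ : [set x | _] = (fun x => `|x - z|) @^-1` [set y | e <= y])//.
apply: closed_comp; last exact: closed_ge.
move=> x _; apply: (@continuous_comp _ _ _ (fun x => x - z) (fun x : X => `|x|)).
  by apply: cvgB; [exact: cvg_id|exact: cvg_cst].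
exact: norm_continuous.
Qed.

Lemma far_closedE A : closed A -> \bigcup_k far A k.+1%:R^-1 = ~` A.
Proof.
move=> cA; apply/seteqP; split=> x.
  by move=> [k _ h] Ax; have := h x Ax; rewrite subrr normr0 leNgt invr_gt0 ltr0n.
move=> nAx; have /nbhs_ballP[e /= e0 eA] : nbhs x (~` A).
  by apply: open_nbhs_nbhs; split=> //; exact: closed_openC.
have /ltr_add_invr[k] := e0; rewrite add0r => ke.
exists k => // z Az; rewrite leNgt; apply/negP => h.
by apply: (eA z) => //; rewrite -ball_normE/=; exact: lt_trans ke.
Qed.

Lemma far_mono A k : far A k.+1%:R^-1 `<=` far A k.+2%:R^-1.
Proof.
move=> x h z Az; apply: le_trans (h z Az).
by rewrite lef_pV2 ?posrE// ler_nat.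
Qed.

End borel_sets.

(** * Generic continuity of the preimage of a Borel set *)

Section relative_continuity.
Context {R : realType} (X : normedModType R) (mu : probability (cube_measurable R) R).
Notation T := (cube_measurable R).
Implicit Types (g h : surface X) (E F : set X) (S : set (surface X)).

Definition pull (g : surface X) (E : set X) : set T := g @^-1` E.

Lemma measurable_pull g E : borel E -> measurable (pull g E).
Proof. by move=> bE; apply: borel_preimage_measurable bE; exact: surface_continuous. Qed.

Definition sym_diff g h E : set T := (pull g E `\` pull h E) `|` (pull h E `\` pull g E).

Lemma measurable_sym_diff g h E : borel E -> measurable (sym_diff g h E).
Proof.
by move=> bE; apply: measurableU; apply: measurableD; exact: measurable_pull.
Qed.

(** Continuity at [g], along [S], of [h |-> pull h E] for the pseudometric given by the measure of
    the symmetric difference. *)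
Definition rel_cont S E g := forall a : R, 0 < a -> exists2 U, nbhs g U &
  forall h, U h -> S h -> prob mu (sym_diff g h E) <= a.

Lemma rel_cont_sub S S' E g : S' `<=` S -> rel_cont S E g -> rel_cont S' E g.
Proof.
by move=> SS' r a a0; have [U nU hU] := r a a0; exists U => // h Uh /SS'; exact: hU.
Qed.

Lemma rel_contC S E g : rel_cont S E g -> rel_cont S (~` E) g.
Proof.
move=> r a a0; have [U nU hU] := r a a0; exists U => // h Uh Sh.
rewrite (_ : sym_diff _ _ _ = sym_diff g h E); first exact: hU.
apply/seteqP; split=> t /=; rewrite /sym_diff /pull/=.
  by move=> [[h1 h2]|[h1 h2]]; [right|left]; split=> //; apply: contrapT.
by move=> [[h1 h2]|[h1 h2]]; [right|left]; split=> // h3; apply: h3.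
Qed.

Lemma rel_contU S E E' g : borel E -> borel E' -> rel_cont S E g -> rel_cont S E' g ->
  rel_cont S (E `|` E') g.
Proof.
move=> bE bE' r r' a a0; have a20 : 0 < a / 2 by lra.
have [U nU hU] := r _ a20; have [U' nU' hU'] := r' _ a20.
exists (U `&` U'); first exact: filterI.
move=> h [Uh U'h] Sh; have := hU h Uh Sh; have := hU' h U'h Sh => h1 h2.
suff : prob mu (sym_diff g h (E `|` E')) <=
    prob mu (sym_diff g h E) + prob mu (sym_diff g h E') by lra.
apply: prob_le_U; do ?apply: measurable_sym_diff => //; first exact: borelU.
move=> t; rewrite /sym_diff /pull/= => -[[[e|e] /not_orP[n n']]|[[e|e] /not_orP[n n']]].
- by left; left.
- by right; left.
- by left; right.
- by right; right.
Qed.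

Lemma rel_contD S E E' g : borel E -> borel E' -> rel_cont S E g -> rel_cont S E' g ->
  rel_cont S (E `\` E') g.
Proof.
move=> bE bE' r r'; rewrite -(setCK (E `\` E')); apply: rel_contC.
rewrite setDE setCI setCK; apply: rel_contU => //; first exact: borelC.
exact: rel_contC.
Qed.

(** A surface uniformly close to [g] cannot enter [F] where [g] stays at distance at least [k.+1^-1]
    from [F]; the other parameters outside [pull g F] have small measure for large [k]. *)
Lemma closed_upper F g (a : R) : closed F -> 0 < a ->
  exists2 U, nbhs g U & forall h, U h -> prob mu (pull h F `\` pull g F) <= a.
Proof.
move=> cF a0.
have bf k : borel (far F k.+1%:R^-1) by apply: borel_closed; exact: closed_far.
have mf k : measurable (pull g (far F k.+1%:R^-1)) by exact: measurable_pull.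
have [|k] := prob_increasing mu mf _ a0; first by move=> k t; exact: far_mono.
have -> : \bigcup_k pull g (far F k.+1%:R^-1) = pull g (~` F).
  by rewrite -far_closedE// /pull preimage_bigcup.
move=> hk; exists (surface_ball 0 k.+1%:R^-1 g); first exact: surface_ball_nbhs.
move=> h /surface_ball_elim[hg _]; apply: le_trans hk; apply: prob_le.
- by apply: measurableD; apply: measurable_pull; exact: borel_closed.
- apply: measurableD => //; apply: measurable_pull; apply: borelC; exact: borel_closed.
move=> t [hF gF]; split=> // /(_ _ hF); rewrite leNgt distrC => /negP; apply.
exact: hg.
Qed.

(* For closed [F], [g |-> mu (g^-1 F)] is upper semicontinuous, hence continuous off countably
   many nowhere dense sets. *)
Lemma rel_cont_closed F : closed F ->
  exists2 S, residual S & forall g, S g -> rel_cont S F g.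
Proof.
move=> cF; have bF := borel_closed cF.
pose M g := prob mu (pull g F).
have usc g (a : R) : 0 < a -> exists2 U, nbhs g U & forall h, U h -> M h <= M g + a /\
    prob mu (pull h F `\` pull g F) <= a.
  move=> a0; have [U nU hU] := closed_upper g cF a0; exists U => // h /hU ha; split=> //.
  suff : M h <= M g + prob mu (pull h F `\` pull g F) by lra.
  apply: prob_le_U; [exact: measurable_pull|by apply: measurableD; exact: measurable_pull|
    exact: measurable_pull|].
  by move=> t ht; have [gt|gt] := pselect (pull g F t); [left|right].
pose C (q : rat) := [set g | ratr q <= M g].
have cC q : closed (C q).
  rewrite -openC openE => g /= /negP; rewrite -ltNge => gq.
  have q0 : 0 < (ratr q - M g) / 2 by lra.
  have [U nU hU] := usc g _ q0; apply: filterS nU => h /hU[h1 _] /=.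
  by apply/negP; rewrite -ltNge; lra.
pose qs n : rat := odflt 0 (unpickle n).
(* Off the boundaries of the closed sets [C q], the inequality [q < M g] gives [q <= M h] for [h]
   near [g]: at the points of [S] the function [M] is also lower semicontinuous. *)
pose S := \bigcap_n ~` (C (qs n) `\` (C (qs n))^°).
exists S.
  apply: residual_bigcap => n; rewrite /residual setCK; apply: meager_nowhere_dense.
  exact: nowhere_dense_closed.
move=> g Sg a a0; have a40 : 0 < a / 4 by lra.
have [|q] := @rat_in_itvoo R (M g - a / 4) (M g); first lra.
rewrite in_itv/= => /andP[q1 q2].
have int : (C q)^° g.
  have := Sg (pickle q) I; rewrite /qs pickleK/= => h; apply: contrapT => ni.
  by apply: h; split=> //=; exact: ltW.
have [U nU hU] := usc g _ a40.
exists (U `&` (C q)^°).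
  by apply: filterI => //; apply: open_nbhs_nbhs; split=> //; exact: open_interior.
move=> h [/hU[_ hF] /interior_subset /= Mh] _.
have mg := measurable_pull g bF; have mh := measurable_pull h bF.
(* Nearly equal measures and one small difference force the other difference to be small. *)
have e1 := prob_split mu mg mh; have e2 := prob_split mu mh mg.
rewrite (setIC (pull h F)) in e2.
have := probU mu (measurableD mg mh) (measurableD mh mg).
rewrite -/(sym_diff g h F); rewrite -/(M g) -/(M h) in e1 e2.
have {}Mh : ratr q <= M h by exact: Mh.
lra.
Qed.

(** Induction over Borel sets. Finite unions are formal; for a countable union the measure of the
    tail must be small uniformly near [g], and it is so off countably many nowhere dense sets. *)
Lemma rel_cont_borel E : borel E ->
  exists2 S, residual S & forall g, S g -> rel_cont S E g.
Proof.
move: E; apply: borel_ind.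
- move=> A oA; have [|S rS hS] := @rel_cont_closed (~` A); first exact: open_closedC.
  by exists S => // g Sg; rewrite -(setCK A); apply: rel_contC; exact: hS.
- by move=> A bA [S rS hS]; exists S => // g Sg; apply: rel_contC; exact: hS.
move=> F bF hF; have /choice[Sn hSn] n : exists S, residual S /\
    forall g, S g -> rel_cont S (F n) g by have [S ? ?] := hF n; exists S.
pose S := \bigcap_n Sn n.
have rS : residual S by apply: residual_bigcap => n; case: (hSn n).
have FS n g : S g -> rel_cont S (F n) g.
  by move=> Sg; apply: (rel_cont_sub _ ((hSn n).2 g (Sg n I))) => h; apply.
pose A n := \bigcup_(i < n) F i.
have AS n : A n.+1 = A n `|` F n.
  apply/seteqP; split=> x.
    by move=> [i /=]; rewrite ltnS leq_eqVlt => /orP[/eqP->|ni] Fx; [right|left; exists i].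
  by move=> [[i /= ni Fx]|Fx]; [exists i => //=; exact: leqW|exists n => /=].
have A0 : A 0%N = set0 by apply/seteqP; split=> // x [].
have bA n : borel (A n).
  elim: n => [|n IH]; first by rewrite A0; apply: borel_open; exact: open0.
  by rewrite AS; exact: borelU.
have rA n g : S g -> rel_cont S (A n) g.
  move=> Sg; elim: n => [|n IH]; last by rewrite AS; apply: rel_contU => //; exact: FS.
  rewrite A0 => a a0; exists setT; first exact: filterT.
  move=> h _ _; rewrite (_ : sym_diff _ _ _ = set0) ?/prob ?measure0 ?ltW//.
  by apply/seteqP; split=> // t [[]|[]].
pose E := \bigcup_n F n.
have bE : borel E by exact: borel_bigcup.
have EA : \bigcup_n A n = E.
  apply/seteqP; split=> x; first by move=> [n _ [i _ Fx]]; exists i.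
  by move=> [i _ Fx]; exists i.+1 => //; exists i => /=.
have incA n : A n `<=` A n.+1 by rewrite AS; exact: subsetUl.
have monoA n m : (n <= m)%N -> A n `<=` A m.
  by move=> nm x [i /= ni Fx]; exists i => //=; exact: leq_trans nm.
(* The surfaces of [S] for which the tail after [p.1] sets has measure at most [p.2.+1^-1]. Once the
   boundaries of the closures are removed, each of them lies in the interior of the closure of this
   set. *)
pose C (p : nat * nat) := [set g | S g /\
  prob mu (pull g (E `\` A p.1)) <= p.2.+1%:R^-1].
pose ps n : nat * nat := odflt (0, 0)%N (unpickle n).
pose S' := S `&` \bigcap_n ~` (closure (C (ps n)) `\` (closure (C (ps n)))^°).
exists S'.
  apply: residualI => //; apply: residual_bigcap => n; rewrite /residual setCK.
  by apply: meager_nowhere_dense; apply: nowhere_dense_closed; exact: closed_closure.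
have mEA h n : measurable (pull h (E `\` A n)) by apply: measurable_pull; exact: borelD.
move=> g [Sg gC] a a0; have a40 : 0 < a / 4 by lra.
have /ltr_add_invr[k] := a40; rewrite add0r => ka.
have k0 : 0 < k.+1%:R^-1 :> R by rewrite invr_gt0.
have [n hn] : exists n, prob mu (pull g (E `\` A n)) <= k.+1%:R^-1.
  have mA n : measurable (pull g (A n)) by exact: measurable_pull.
  have [|n] := prob_increasing mu mA _ k0; first by move=> n t; exact: incA.
  rewrite (_ : \bigcup_n pull g (A n) = pull g E); first by exists n.
  by rewrite -EA /pull preimage_bigcup.
have int : (closure (C (n, k)))^° g.
  have := gC (pickle (n, k)) I; rewrite /ps pickleK/= => h; apply: contrapT => ni.
  by apply: h; split=> //; apply: subset_closure; split.
(* The bound passes from [C (n, k)] to the surfaces of [S] in its closure: nearly all of the tail is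
   a difference of two finite unions [A N] and [A n], where relative continuity is already known. *)
have tail h : S h -> closure (C (n, k)) h -> prob mu (pull h (E `\` A n)) <= k.+1%:R^-1.
  move=> Sh ch; rewrite leNgt; apply/negP => lt.
  pose D N := pull h (A N `\` A n).
  have mD N : measurable (D N) by apply: measurable_pull; exact: borelD.
  pose r := prob mu (pull h (E `\` A n)) - k.+1%:R^-1.
  have r0 : 0 < r / 4 by rewrite divr_gt0// subr_gt0.
  have [|N] := prob_increasing mu mD _ r0.
    by move=> N t [AN nA]; split=> //; exact: incA.
  have -> : \bigcup_N D N = pull h (E `\` A n).
    apply/seteqP; split=> t; first by move=> [N' _ [AN nA]]; split=> //=; rewrite -EA; exists N'.
    move=> [Et nA]; have [N' _ AN] : (\bigcup_n A n) (h t) by rewrite EA.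
    by exists N'.
  have DE : D N `<=` pull h (E `\` A n).
    by move=> t [AN nA]; split=> //=; rewrite -EA; exists N.
  have e1 := prob_split mu (mEA h n) (mD N); rewrite (setIidr DE) in e1.
  move=> e2.
  have [U nU hU] := rel_contD (bA N) (bA n) (rA N h Sh) (rA n h Sh) r0.
  have [h' [[Sh' Ch'] Uh']] := ch U nU.
  have := hU h' Uh' Sh' => sd.
  have h1 : prob mu (D N) <= prob mu (pull h' (A N `\` A n)) +
      prob mu (sym_diff h h' (A N `\` A n)).
    apply: prob_le_U => //.
    - by apply: measurable_pull; exact: borelD.
    - by apply: measurable_sym_diff; exact: borelD.
    by move=> t Dt; have [d|d] := pselect (pull h' (A N `\` A n) t); [left|right; left].
  have h2 : prob mu (pull h' (A N `\` A n)) <= prob mu (pull h' (E `\` A n)).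
    apply: prob_le => //; first by apply: measurable_pull; exact: borelD.
    by move=> t [AN nA]; split=> //=; rewrite -EA; exists N.
  move: Ch' => /= Ch'; rewrite /r in r0 e2 sd.
  move: (k.+1%:R^-1 : R) e1 e2 h1 h2 Ch' sd r0 => kap; clear; lra.
have [U nU hU] := rA n g Sg _ a40.
exists (U `&` (closure (C (n, k)))^°).
  by apply: filterI => //; apply: open_nbhs_nbhs; split=> //; exact: open_interior.
move=> h [Uh /interior_subset ch] [Sh _].
have h1 := le_trans (tail h Sh ch) (ltW ka); have h2 := hU h Uh Sh.
have hn' := le_trans hn (ltW ka).
have h3 : prob mu (pull g (E `\` A n) `|` pull h (E `\` A n)) <=
    prob mu (pull g (E `\` A n)) + prob mu (pull h (E `\` A n)) by exact: probU.
suff : prob mu (sym_diff g h E) <= prob mu (sym_diff g h (A n)) +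
    prob mu (pull g (E `\` A n) `|` pull h (E `\` A n)) by clear -h1 h2 h3 hn' a0; lra.
apply: prob_le_U; [exact: measurable_sym_diff|exact: measurableU|exact: measurable_sym_diff|].
have AE : A n `<=` E by move=> x Ax; rewrite -EA; exists n.
move=> t [[gE hE]|[hE gE]].
  have [Ag|Ag] := pselect (pull g (A n) t); last by right; left.
  by left; left; split=> // /AE.
have [Ah|Ah] := pselect (pull h (A n) t); last by right; right.
by left; right; split=> // /AE.
Qed.

Lemma borel_regular g B : borel B -> forall e : R, 0 < e ->
  exists F O, [/\ closed F, open O, F `<=` B, B `<=` O & prob mu (pull g (O `\` F)) <= e].
Proof.
move: B; apply: borel_ind.
- move=> A oA e e0.
  have cA : closed (~` A) by exact: open_closedC.
  have fE := far_closedE cA; rewrite setCK in fE.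
  have bA := borel_open oA.
  have bf k : borel (far (~` A) k.+1%:R^-1) by apply: borel_closed; exact: closed_far.
  have mf k : measurable (pull g (far (~` A) k.+1%:R^-1)) by exact: measurable_pull.
  have [|k] := prob_increasing mu mf _ e0; first by move=> k t; exact: far_mono.
  have -> : \bigcup_k pull g (far (~` A) k.+1%:R^-1) = pull g A.
    by rewrite -[in RHS]fE /pull preimage_bigcup.
  move=> hk; exists (far (~` A) k.+1%:R^-1), A; split=> //; first exact: closed_far.
  by rewrite -[X in _ `<=` X]fE => x fx; exists k.
- move=> A bA hA e e0; have [F [U [cF oU FA AU h]]] := hA e e0.
  exists (~` U), (~` F); split.
  - exact: open_closedC.
  - exact: closed_openC.
  - exact: subsetC.
  - exact: subsetC.
  - by rewrite (_ : ~` F `\` ~` U = U `\` F)//; rewrite setDE setCK setDE setIC.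
move=> A bA hA e e0; have e20 : 0 < e / 2 by lra.
have /choice[FO hFO] n : exists FO : set X * set X, [/\ closed FO.1, open FO.2,
    FO.1 `<=` A n, A n `<=` FO.2 &
    prob mu (pull g (FO.2 `\` FO.1)) <= e / 2 / (2 ^ n.+1)%:R].
  have en : 0 < e / 2 / (2 ^ n.+1)%:R by rewrite divr_gt0// ltr0n expn_gt0.
  by have [F [U hU]] := hA n _ en; exists (F, U).
pose F n := (FO n).1; pose U n := (FO n).2.
have cF n : closed (F n) by case: (hFO n).
have oU n : open (U n) by case: (hFO n).
have bF n := borel_closed (cF n); have bU n := borel_open (oU n).
pose G n := \bigcup_(i < n) F i.
have cG n : closed (G n).
  by rewrite /G bigcup_mkord; apply: closed_bigsetU => i _; exact: cF.
have bG n := borel_closed (cG n).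
have GE : \bigcup_n G n = \bigcup_n F n.
  apply/seteqP; split=> x; first by move=> [n _ [i _ Fx]]; exists i.
  by move=> [i _ Fx]; exists i.+1 => //; exists i => /=.
have mG n : measurable (pull g (G n)) by exact: measurable_pull.
have [|N hN] := prob_increasing mu mG _ e20.
  by move=> n t [i /= ni Ft]; exists i => //=; exact: leqW.
exists (G N), (\bigcup_n U n); split=> //.
- exact: bigcup_open.
- by move=> x [i _ Fx]; exists i => //; case: (hFO i) => _ _ + _ _; exact.
- by move=> x [i _ Ax]; exists i => //; case: (hFO i) => _ _ _ + _; exact.
have mD n : measurable (pull g (U n `\` F n)) by apply: measurable_pull; exact: borelD.
have hD : prob mu (\bigcup_n pull g (U n `\` F n)) <= e / 2.
  by apply: prob_bigcup => // [|n]; [exact: ltW|case: (hFO n)].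
suff : prob mu (pull g (\bigcup_n U n `\` G N)) <= prob mu (\bigcup_n pull g (U n `\` F n)) +
    prob mu (\bigcup_n pull g (G n) `\` pull g (G N)) by lra.
apply: prob_le_U.
- exact: bigcup_measurable.
- by apply: measurableD => //; exact: bigcup_measurable.
- by apply: measurable_pull; apply: borelD => //; exact: borel_bigcup.
move=> t [[n _ Ut] nG]; have [Ft|nF] := pselect (pull g (F n) t); last by left; exists n.
by right; split=> //; exists n.+1 => //; exists n => /=.
Qed.

End relative_continuity.

(** * Porosity and regular points *)

Section porosity_lemmas.
Context {R : realType} {X : normedModType R}.
Implicit Types (f : X -> R) (x u v w : X).

Definition is_lipschitz (L : R) f := forall x y, `|f x - f y| <= L * `|x - y|.

Lemma porous0 : porous (set0 : set X).
Proof. by exists (1 / 2) => //; apply/andP; split; lra. Qed.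

(** The thresholds [K] and [j] are integers so that, with rational [a < b] and [v] in a dense
    sequence, countably many such sets account for the failures of regularity. *)
Definition crooked f v (a b : R) (K j : nat) : set X :=
  [set x | (forall s : R, 0 < s -> s < j.+1%:R^-1 -> f (x + s *: v) - f x <= a * s) /\
    forall d : R, 0 < d -> exists s u, [/\ 0 < s, s < d, `|u| <= K%:R * s &
      b * s < f (x + u + s *: v) - f (x + u)]].

(* Near [x + u] the increments along [v] still exceed [a * s], so the ball misses the set. *)
Lemma crooked_porous f L v (a b : R) (K j : nat) : 0 <= L -> is_lipschitz L f -> a < b ->
  porous (crooked f v a b K j).
Proof.
move=> L0 fL ab.
have M0 : 0 < 2 * L * K%:R + (b - a) + 1.
  have h : 0 <= 2 * L * K%:R by rewrite mulr_ge0// mulr_ge0.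
  lra.
(* Moving the base point by [c * K * s] changes the increment along [s *: v] by at most
   [2 * L * c * K * s]; this [c] keeps the change within [(b - a) * s]. *)
pose c := (b - a) / (2 * L * K%:R + (b - a) + 1) / 2.
have c0 : 0 < c by rewrite /c divr_gt0// divr_gt0//; lra.
have cM : c * (2 * L * K%:R + (b - a) + 1) = (b - a) / 2.
  by rewrite /c mulrAC divfK// gt_eqF.
have LK : 0 <= L * K%:R by rewrite mulr_ge0.
have c1 : c < 1 by rewrite -(ltr_pM2r M0) cM mul1r; lra.
have cK : 2 * (L * (c * K%:R)) <= b - a.
  have -> : 2 * (L * (c * K%:R)) = c * (2 * L * K%:R + (b - a) + 1) - c * ((b - a) + 1) by ring.
  rewrite cM; have : 0 < c * (b - a + 1) by rewrite mulr_gt0//; lra.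
  lra.
exists c; first by rewrite c0.
move=> x [_ xb].
have dn0 (n : nat) : 0 < Num.min (j.+1%:R^-1) (n.+1%:R^-1) :> R.
  by rewrite lt_min !invr_gt0 !ltr0n.
have /choice[su hsu] (n : nat) : exists su : R * X, [/\ 0 < su.1,
    su.1 < Num.min (j.+1%:R^-1) (n.+1%:R^-1), `|su.2| <= K%:R * su.1 &
    b * su.1 < f (x + su.2 + su.1 *: v) - f (x + su.2)].
  by have [s [u hu]] := xb _ (dn0 n); exists (s, u).
exists (fun n => x + (su n).2).
  apply/cvgrPdist_le => e e0.
  have /ltr_add_invr[N] : 0 < e / (K%:R + 1) by apply: divr_gt0 => //; rewrite ltr_wpDl.
  rewrite add0r => hN; near=> n.
  rewrite opprD addrA subrr add0r normrN.
  have [s0 + + _] := hsu n; rewrite lt_min => /andP[_ sn] un.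
  apply: (le_trans un).
  have sN : (su n).1 <= e / (K%:R + 1).
    apply: ltW; apply: (lt_trans sn); apply: le_lt_trans hN.
    by rewrite lef_pV2 ?posrE ?ltr0n// ler_nat ltnS; near: n; exact: nbhs_infty_ge.
  apply: (@le_trans _ _ ((K%:R + 1) * (e / (K%:R + 1)))).
    by apply: ler_pM => //; [exact: ltW|rewrite lerDl].
  by rewrite mulrC divfK// gt_eqF// ltr_wpDl.
move=> n; have [s0 + uK hb] := hsu n; rewrite lt_min => /andP[sj _].
move: (su n).1 (su n).2 s0 sj uK hb => s u s0 sj uK hb.
apply/seteqP; split=> // y [] /=; rewrite /closed_ball_/= (addrC x) addrK => yu [ya _].
rewrite (addrC u) in yu.
have h1 := ya s s0 sj.
have h2 := fL (x + u + s *: v) (y + s *: v); have h3 := fL (x + u) y.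
have e1 : x + u + s *: v - (y + s *: v) = x + u - y by rewrite opprD addrA (addrAC _ (- y)) addrK.
rewrite e1 in h2.
have yK : L * `|x + u - y| <= L * (c * (K%:R * s)).
  by rewrite ler_wpM2l// (le_trans yu)// ler_wpM2l// ltW.
have cs : 2 * (L * (c * (K%:R * s))) <= (b - a) * s.
  have -> : 2 * (L * (c * (K%:R * s))) = 2 * (L * (c * K%:R)) * s by ring.
  by rewrite ler_wpM2r// ltW.
move: h2 h3; rewrite !ler_norml => /andP[h2 h2'] /andP[h3 h3'].
clear -h1 h2 h2' h3 h3' yK cs hb; lra.
Unshelve. all: by end_near. Qed.

(** The index holds the direction, the two rational slopes, the pair [(K, j)] and a sign; [- f]
    accounts for slopes that are too small nearby. *)
Definition irregular_piece f (V : nat -> X)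
    (i : nat * (rat * rat) * (nat * nat) * bool) : set X :=
  if i.1.1.2.1 < i.1.1.2.2 then
    crooked (if i.2 then f else fun x => - f x) (V i.1.1.1)
      (ratr i.1.1.2.1) (ratr i.1.1.2.2) i.1.2.1 i.1.2.2
  else set0.

Definition irregular f (V : nat -> X) : set X :=
  \bigcup_n (if unpickle n is Some i then irregular_piece f V i else set0).

Lemma is_lipschitzN L f : is_lipschitz L f -> is_lipschitz L (fun x => - f x).
Proof. by move=> fL x y; rewrite -opprD normrN. Qed.

Lemma irregular_sigma_porous f L V : 0 <= L -> is_lipschitz L f ->
  sigma_porous (irregular f V).
Proof.
move=> L0 fL.
exists (fun n => if unpickle n is Some i then irregular_piece f V i else set0) => // n.
case: unpickle => [i|]; last exact: porous0.
rewrite /irregular_piece; case: ifPn => ab; last exact: porous0.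
apply: (@crooked_porous _ L) => //; last by rewrite ltr_rat.
by case: (i.2) => //; exact: is_lipschitzN.
Qed.

Definition directional f x v (d : R) := forall e : R, 0 < e -> exists2 r : R, 0 < r &
  forall s, `|s| < r -> `|f (x + s *: v) - f x - s * d| <= e * `|s|.

(** The base point may vary by [rho] and the error is relative to [rho], not to [s]. This makes the
    derivative additive in [v] and lets it pass to limits of directions. *)
Definition uniform_deriv f x v (d : R) := forall e : R, 0 < e ->
  exists2 r : R, 0 < r & forall rho u s, 0 < rho -> rho < r -> `|u| <= rho -> `|s| <= rho ->
    `|f (x + u + s *: v) - f (x + u) - s * d| <= e * rho.

(** Two rationals [a < b] are placed between [d] and [d + e]: the slopes at [x] are eventually at
    most [a], so outside [crooked] the slopes at the points [x + u] are eventually at most [b]. *)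
Let upper f V n x d : ~ irregular f V x -> directional f x (V n) d ->
  forall (e : R) (K : nat), 0 < e -> exists2 r : R, 0 < r & forall s u, 0 < s -> s < r ->
    `|u| <= K%:R * s -> f (x + u + s *: V n) - f (x + u) <= (d + e) * s.
Proof.
move=> nx hd e K e0.
have [|b] := @rat_in_itvoo R (d + e / 2) (d + e); first lra.
rewrite in_itv/= => /andP[b1 b2].
have [|a] := @rat_in_itvoo R d (d + e / 2); first lra.
rewrite in_itv/= => /andP[a1 a2].
have ad : 0 < ratr a - d by lra.
have [r r0 hr] := hd _ ad; have /ltr_add_invr[j] := r0; rewrite add0r => jr.
have nc : ~ crooked f (V n) (ratr a) (ratr b) K j x.
  move=> cx; apply: nx; exists (pickle (n, (a, b), (K, j), true)) => //.
  rewrite pickleK /irregular_piece/= ifT//.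
  by rewrite -(ltr_rat R); lra.
have : exists2 r' : R, 0 < r' & forall s u, 0 < s -> s < r' -> `|u| <= K%:R * s ->
    f (x + u + s *: V n) - f (x + u) <= ratr b * s.
  apply: contrapT => h; apply: nc; split=> [s s0 sj|r' r'0].
    have := hr s; rewrite gtr0_norm// => /(_ (lt_trans sj jr)).
    by rewrite ler_norml => /andP[_]; clear; lra.
  apply: contrapT => h'; apply: h; exists r' => // s u s0 sr' uK.
  by rewrite leNgt; apply/negP => lt; apply: h'; exists s, u.
move=> [r' r'0 hr']; exists r' => // s u s0 sr' uK.
by rewrite (le_trans (hr' s u s0 sr' uK))// ler_pM2r// ltW.
Qed.

Lemma irregularN f V : irregular (fun x => - f x) V = irregular f V.
Proof.
have H g : irregular (fun x => - g x) V `<=` irregular g V.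
  move=> x [n _]; case E : (unpickle n) => [[[[m ab] Kj] sg]|//] h.
  exists (pickle (m, ab, Kj, ~~ sg)) => //; rewrite pickleK.
  move: h; rewrite /irregular_piece/=; case: ifP => // _; case: sg {E} => //=.
  by rewrite (_ : (fun x => - - g x) = g)//; apply/funext => y; rewrite opprK.
apply/seteqP; split; first exact: H.
have := H (fun x => - f x).
by rewrite (_ : (fun x => - - f x) = f)//; apply/funext => y; rewrite opprK.
Qed.

Lemma directionalN f x v d : directional f x v d -> directional (fun x => - f x) x v (- d).
Proof.
move=> h e e0; have [r r0 hr] := h e e0; exists r => // s sr.
by rewrite mulrN -!opprD normrN; exact: hr.
Qed.

(** If [|s| <= th * rho], the claim is a Lipschitz estimate. Otherwise [rho] is at most a fixed
    multiple of [|s|], and [upper] applies to [f] and [- f]. For negative [s] the base point becomes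
    [x + u + s *: v], whence the factor [1 + |v|] in [K]. *)
Lemma regular_uniform f L V n x d : 0 <= L -> is_lipschitz L f -> ~ irregular f V x ->
  directional f x (V n) d -> uniform_deriv f x (V n) d.
Proof.
move=> L0 fL nx hd e e0; set v := V n in hd *.
have C0 : 0 < L * `|v| + `|d| + 1.
  by have := mulr_ge0 L0 (normr_ge0 v); have := normr_ge0 d; lra.
pose th := e / (L * `|v| + `|d| + 1).
have th0 : 0 < th by exact: divr_gt0.
pose K := (Num.truncn ((1 + `|v|) / th)).+1.
have Kth : (1 + `|v|) / th <= K%:R.
  by apply/ltW; rewrite truncnS_gt.
have [r r0 hr] := upper nx hd K e0.
have nxN : ~ irregular (fun x => - f x) V x by rewrite irregularN.
have [r' r'0 hr'] := upper nxN (directionalN hd) K e0.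
exists (Num.min r r'); first by rewrite lt_min r0.
have main s u : 0 < s -> s < Num.min r r' -> `|u| <= K%:R * s ->
    `|f (x + u + s *: v) - f (x + u) - s * d| <= e * s.
  move=> s0; rewrite lt_min => /andP[sr sr'] uK.
  have := hr s u s0 sr uK; have := hr' s u s0 sr' uK; rewrite -/v.
  by clear; rewrite ler_norml => h1 h2; apply/andP; split; lra.
move=> rho u s rho0 rhor urho srho.
have [ss|ss] := leP `|s| (th * rho).
  have h1 := fL (x + u + s *: v) (x + u).
  rewrite [x + u + _ - _]addrAC subrr add0r normrZ in h1.
  apply: (le_trans (ler_normB _ _)); rewrite normrM.
  have : (L * `|v| + `|d| + 1) * `|s| <= e * rho.
    have -> : e = (L * `|v| + `|d| + 1) * th by rewrite /th mulrC divfK// gt_eqF.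
    by rewrite -mulrA ler_pM2l.
  have := normr_ge0 s; clear -h1; lra.
have big w : `|w| <= (1 + `|v|) * rho -> `|w| <= K%:R * `|s|.
  move=> hw; apply: (le_trans hw).
  apply: (@le_trans _ _ ((1 + `|v|) / th * `|s|)); last by rewrite ler_wpM2r.
  by rewrite -mulrA ler_wpM2l ?addr_ge0// mulrC ler_pdivlMr// mulrC ltW.
have [s0|s0|s0] := ltgtP s 0.
- have sN : 0 < - s by rewrite oppr_gt0.
  have sE : `|s| = - s by rewrite ltr0_norm.
  have := @main (- s) (u + s *: v) sN; rewrite -sE => /(_ (le_lt_trans srho rhor)).
  have uv : `|u + s *: v| <= K%:R * `|s|.
    apply: big; apply: (le_trans (ler_normD _ _)); rewrite normrZ mulrDl mul1r lerD//.
    by rewrite mulrC ler_wpM2l.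
  move=> /(_ uv); rewrite sE.
  have -> : x + (u + s *: v) + - s *: v = x + u by rewrite scaleNr addrA addrK.
  rewrite addrA => h.
  have -> : f (x + u + s *: v) - f (x + u) - s * d =
      - (f (x + u) - f (x + u + s *: v) - - s * d) by ring.
  by rewrite normrN (le_trans h)// ler_wpM2l ?(ltW e0)// -sE.
- apply: le_trans (_ : e * s <= _).
    apply: main => //; first by rewrite -(gtr0_norm s0); exact: le_lt_trans rhor.
    rewrite -(gtr0_norm s0); apply: big; apply: (le_trans urho).
    by rewrite ler_peMl// ?lerDl// ltW.
  by rewrite ler_wpM2l ?(ltW e0)// -(gtr0_norm s0).
- by move: ss; rewrite s0 normr0 ltNge mulr_ge0// ltW.
Qed.

End porosity_lemmas.

(** * From directional derivatives to a linear derivative *)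

Section regular_derivative.
Context {R : realType} {X : normedModType R}.
Implicit Types (f : X -> R) (x u v w : X).

Lemma uniform_deriv_gap f L x v w d d' : 0 <= L -> is_lipschitz L f ->
  uniform_deriv f x v d -> uniform_deriv f x w d' -> `|d - d'| <= L * `|v - w|.
Proof.
move=> L0 fL hv hw; apply/ler_addgt0Pr => e e0; have e20 : 0 < e / 2 by lra.
have [r r0 hr] := hv _ e20; have [r' r'0 hr'] := hw _ e20.
pose s := Num.min r r' / 2.
have m0 : 0 < Num.min r r' by rewrite lt_min r0.
have s0 : 0 < s by rewrite /s; lra.
have : s < Num.min r r' by rewrite /s; lra.
rewrite lt_min => /andP[sr sr'].
have ss : `|s| <= s by rewrite gtr0_norm.
have z0 : `|0 : X| <= s by rewrite normr0 ltW.
have := hr s 0 s s0 sr z0 ss; have := hr' s 0 s s0 sr' z0 ss; rewrite !addr0 => h1 h2.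
have := fL (x + s *: v) (x + s *: w).
rewrite opprD addrACA subrr add0r -scalerBr normrZ gtr0_norm// => h3.
rewrite -(ler_pM2l s0) -{1}(gtr0_norm s0) -normrM.
move: h1 h2 h3; rewrite !ler_norml => /andP[a1 a2] /andP[b1 b2] /andP[c1 c2].
by apply/andP; split; clear -a1 a2 b1 b2 c1 c2; lra.
Qed.

(** The increment along [w] is taken from the base point [x + u + s *: v], which lies within
    [rho * (1 + |v|)] of [x]; this is where uniformity in the base point is used. *)
Lemma uniform_derivD f x v w d d' : uniform_deriv f x v d -> uniform_deriv f x w d' ->
  uniform_deriv f x (v + w) (d + d').
Proof.
move=> hv hw e e0; have e20 : 0 < e / 2 by lra.
have K0 : 0 < 1 + `|v| by have := normr_ge0 v; lra.
have [r r0 hr] := hv _ e20.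
have [r' r'0 hr'] := hw _ (divr_gt0 e20 K0).
exists (Num.min r (r' / (1 + `|v|))); first by rewrite lt_min r0 divr_gt0.
move=> rho u s rho0; rewrite lt_min => /andP[rr rr'] urho srho.
have h1 := hr rho u s rho0 rr urho srho.
have rK : rho * (1 + `|v|) < r' by rewrite -ltr_pdivlMr.
have rrK : rho <= rho * (1 + `|v|) by rewrite ler_pMr// lerDl.
have := hr' (rho * (1 + `|v|)) (u + s *: v) s (mulr_gt0 rho0 K0) rK.
have uv : `|u + s *: v| <= rho * (1 + `|v|).
  apply: (le_trans (ler_normD _ _)); rewrite normrZ mulrDr mulr1 lerD//.
  by rewrite ler_wpM2r.
move=> /(_ uv (le_trans srho rrK)); rewrite addrA.
have -> : e / 2 / (1 + `|v|) * (rho * (1 + `|v|)) = e / 2 * rho.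
  by rewrite mulrA mulrAC divfK// gt_eqF.
rewrite scalerDr addrA => h2.
have -> : f (x + u + s *: v + s *: w) - f (x + u) - s * (d + d') =
  (f (x + u + s *: v + s *: w) - f (x + u + s *: v) - s * d') +
  (f (x + u + s *: v) - f (x + u) - s * d) by ring.
apply: (le_trans (ler_normD _ _)); clear -h1 h2; lra.
Qed.

Lemma uniform_derivZ f x v d (c : R) : uniform_deriv f x v d ->
  uniform_deriv f x (c *: v) (c * d).
Proof.
move=> hv e e0; have K0 : 0 < 1 + `|c| by have := normr_ge0 c; lra.
have [r r0 hr] := hv _ (divr_gt0 e0 K0).
exists (r / (1 + `|c|)); first by rewrite divr_gt0.
move=> rho u s rho0; rewrite ltr_pdivlMr// => rr urho srho.
have rrK : rho <= rho * (1 + `|c|) by rewrite ler_pMr// lerDl.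
have sc : `|s * c| <= rho * (1 + `|c|).
  by rewrite normrM ler_pM// lerDr.
have := hr _ u (s * c) (mulr_gt0 rho0 K0) rr (le_trans urho rrK) sc.
have -> : e / (1 + `|c|) * (rho * (1 + `|c|)) = e * rho.
  by rewrite mulrA mulrAC divfK// gt_eqF.
by rewrite scalerA mulrA.
Qed.

Lemma uniform_deriv_limit f L x v (d : R) (V : nat -> X) (D : nat -> R) : 0 <= L ->
  is_lipschitz L f -> (forall e : R, 0 < e -> exists n, `|v - V n| < e) ->
  (forall n, uniform_deriv f x (V n) (D n)) -> (forall n, `|d - D n| <= L * `|v - V n|) ->
  uniform_deriv f x v d.
Proof.
move=> L0 fL dV hD hd e e0.
have K0 : 0 < 4 * (L + 1) by lra.
have [n hn] := dV _ (divr_gt0 e0 K0).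
have hn' : 4 * (L + 1) * `|v - V n| <= e.
  by move: hn; rewrite ltr_pdivlMr// mulrC => /ltW.
have e20 : 0 < e / 2 by lra.
have [r r0 hr] := hD n _ e20; exists r => // rho u s rho0 rr urho srho.
have h1 := hr rho u s rho0 rr urho srho.
have := fL (x + u + s *: v) (x + u + s *: V n).
rewrite opprD addrACA subrr add0r -scalerBr normrZ => h2.
have -> : f (x + u + s *: v) - f (x + u) - s * d =
  (f (x + u + s *: v) - f (x + u + s *: V n)) +
  (f (x + u + s *: V n) - f (x + u) - s * D n) - s * (d - D n) by ring.
apply: (le_trans (ler_normB _ _)).
have h3 := ler_normD (f (x + u + s *: v) - f (x + u + s *: V n))
  (f (x + u + s *: V n) - f (x + u) - s * D n).
have h4 : `|s * (d - D n)| <= `|s| * (L * `|v - V n|).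
  by rewrite normrM ler_wpM2l.
have h5 : `|s| * (L * `|v - V n|) <= rho * (e / 4).
  apply: ler_pM => //; first by rewrite mulr_ge0.
  have := normr_ge0 (v - V n); clear -hn' L0; nra.
clear -h1 h2 h3 h4 h5; lra.
Qed.

Definition regular_at f x (psi : X -> R) := forall v, uniform_deriv f x v (psi v).

(** [p] is McShane's Lipschitz extension of [V n |-> D n]. Its values are again uniform derivatives,
    and linearity follows from their uniqueness. *)
Lemma regular_derivative f L x (V : nat -> X) (D : nat -> R) : 0 <= L -> is_lipschitz L f ->
  (forall v (e : R), 0 < e -> exists n, `|v - V n| < e) ->
  (forall n, uniform_deriv f x (V n) (D n)) ->
  exists psi : {linear X -> R}, regular_at f x psi /\ forall v, `|psi v| <= L * `|v|.
Proof.
move=> L0 fL dV hD.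
have gap n m : `|D n - D m| <= L * `|V n - V m| := uniform_deriv_gap L0 fL (hD n) (hD m).
pose S v := [set D n + L * `|v - V n| | n in [set: nat]].
pose p v := inf (S v).
have low v n m : D n - L * `|v - V n| <= D m + L * `|v - V m|.
  have := gap n m; rewrite ler_norml => /andP[h1 h2].
  have : L * `|V n - V m| <= L * (`|v - V n| + `|v - V m|).
    rewrite ler_wpM2l// -(subrKA v) (le_trans (ler_normD _ _))//.
    by rewrite (distrC (V n)).
  by clear -h1 h2; lra.
have hS v : has_inf (S v).
  split; first by exists (D 0%N + L * `|v - V 0%N|), 0%N.
  by exists (D 0%N - L * `|v - V 0%N|) => _ [m _ <-]; exact: low.
have pD v n : `|p v - D n| <= L * `|v - V n|.
  rewrite ler_norml; apply/andP; split.
    rewrite lerBrDl; apply: lb_le_inf; first by case: (hS v).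
    by move=> _ [m _ <-]; exact: low.
  rewrite lerBlDl; apply: ge_inf; first by case: (hS v).
  by exists n.
have hp v : uniform_deriv f x v (p v).
  by apply: (uniform_deriv_limit L0 fL (dV v) hD) => n; exact: pD.
have uniq v d d' : uniform_deriv f x v d -> uniform_deriv f x v d' -> d = d'.
  move=> h h'; apply/eqP; rewrite -subr_eq0 -normr_le0.
  by have := uniform_deriv_gap L0 fL h h'; rewrite subrr normr0 mulr0.
have plin : linear p.
  move=> c v w; apply: (uniq _ _ _ (hp _)).
  exact: uniform_derivD (uniform_derivZ _ (hp v)) (hp w).
pose M := GRing.isLinear.Build R X R _ p plin.
pose psi : {linear X -> R} := HB.pack p M.
exists psi; split; first exact: hp.
have p0 : p 0 = 0.
  by have := plin 1 0 0; rewrite scaler0 addr0 [1 *: _]mul1r => h; clear -h; lra.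
move=> v; have := uniform_deriv_gap L0 fL (hp v) (hp 0).
by rewrite p0 !subr0.
Qed.

(** One direction is added at a time, each from the base point reached by the previous ones. *)
Lemma regular_at_directions f L x (psi : {linear X -> R}) (v : nat -> X) n : 0 <= L ->
  is_lipschitz L f -> regular_at f x psi ->
  forall e : R, 0 < e -> exists2 r : R, 0 < r & forall rho u (a : nat -> R),
    0 < rho -> rho < r -> `|u| <= rho -> (forall j, (j < n)%N -> `|a j| <= rho) ->
    `|f (x + u + \sum_(j < n) a j *: v j) - f (x + u) - psi (\sum_(j < n) a j *: v j)|
      <= e * rho.
Proof.
move=> L0 fL reg; elim: n => [|n IH] e e0.
  exists 1 => // rho u a rho0 _ _ _.
  by rewrite big_ord0 addr0 linear0 !subrr normr0 mulr_ge0// ltW.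
have e20 : 0 < e / 2 by lra.
pose C := 1 + \sum_(j < n) `|v j|.
have C1 : 1 <= C by rewrite lerDl sumr_ge0.
have C0 : 0 < C by lra.
have [r r0 hr] := IH _ e20; have [r' r'0 hr'] := reg (v n) _ (divr_gt0 e20 C0).
exists (Num.min r (r' / C)); first by rewrite lt_min r0 divr_gt0.
move=> rho u a rho0; rewrite lt_min => /andP[rr]; rewrite ltr_pdivlMr// => rr' urho arho.
have an j : (j < n)%N -> `|a j| <= rho by move=> jn; apply: arho; exact: leqW.
have h1 := hr rho u a rho0 rr urho an.
rewrite big_ord_recr/=; set w := \sum_(i < n) _ in h1 *.
have rC : rho <= rho * C by rewrite ler_pMr.
have uw : `|u + w| <= rho * C.
  apply: (le_trans (ler_normD _ _)); rewrite /C mulrDr mulr1 lerD//.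
  apply: (le_trans (ler_norm_sum _ _ _)); rewrite mulr_sumr; apply: ler_sum => i _.
  by rewrite normrZ ler_wpM2r// an.
have := hr' _ (u + w) (a n) (mulr_gt0 rho0 C0) rr' uw (le_trans (arho n (ltnSn n)) rC).
rewrite !addrA linearD/=.
have -> : e / 2 / C * (rho * C) = e / 2 * rho by rewrite mulrA mulrAC divfK// gt_eqF.
move=> h2; rewrite (_ : psi (a n *: v n) = a n * psi (v n)); last exact: linear_mul.
have -> : f (x + u + w + a n *: v n) - f (x + u) - (psi w + a n * psi (v n)) =
   (f (x + u + w + a n *: v n) - f (x + u + w) - a n * psi (v n)) +
   (f (x + u + w) - f (x + u) - psi w) by ring.
apply: (le_trans (ler_normD _ _)); clear -h1 h2; lra.
Qed.

Definition second_difference f x (w u : X) : R := f (x + w + u) - f (x + w) - (f (x + u) - f x).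

(* Uniform smallness of second differences along any finite set of directions;
   the derivative has disappeared, so this is invariant under adding a linear form. *)
Definition regular2 f x := forall (n : nat) (v : nat -> X) (e : R), 0 < e ->
  exists2 r : R, 0 < r & forall rho u (a : nat -> R), 0 < rho -> rho < r ->
    `|u| <= rho -> (forall j, (j < n)%N -> `|a j| <= rho) ->
    `|second_difference f x (\sum_(j < n) a j *: v j) u| <= e * rho.

(** The first order expansions from [x + u] and from [x] have the same linear part, which
    cancels. *)
Lemma regular_at_regular2 f L x (psi : {linear X -> R}) : 0 <= L ->
  is_lipschitz L f -> regular_at f x psi -> regular2 f x.
Proof.
move=> L0 fL reg n v e e0; have e20 : 0 < e / 2 by lra.
have [r r0 hr] := regular_at_directions v n L0 fL reg e20.
exists r => // rho u a rho0 rr urho arho.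
have h1 := hr rho u a rho0 rr urho arho.
have z0 : `|0 : X| <= rho by rewrite normr0 ltW.
have := hr rho 0 a rho0 rr z0 arho; rewrite addr0 => h2.
move: h1 h2; rewrite /second_difference; set w := \sum_(j < n) _ => h1 h2.
have -> : f (x + w + u) - f (x + w) - (f (x + u) - f x) =
  (f (x + u + w) - f (x + u) - psi w) - (f (x + w) - f x - psi w).
  by rewrite (addrAC x w); ring.
apply: (le_trans (ler_normB _ _)); clear -h1 h2; lra.
Qed.

Lemma regular2_sub_linear f x (phi : {linear X -> R}) :
  regular2 f x -> regular2 (fun y => f y - phi y) x.
Proof.
move=> h n v e e0; have [r r0 hr] := h n v e e0; exists r => // rho u a rho0 rr urho arho.
apply: le_trans (hr rho u a rho0 rr urho arho).
rewrite le_eqVlt; apply/orP; left; apply/eqP; congr (`| _ |).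
by rewrite /second_difference !linearD/=; ring.
Qed.

End regular_derivative.

(** * Borel sets of points with prescribed slopes *)

Section borel_conditions.
Context {R : realType} {X : normedModType R}.
Implicit Types (f g : X -> R) (x u v w : X).

Lemma is_lipschitz_continuous f L : 0 <= L -> is_lipschitz L f -> continuous f.
Proof.
move=> L0 fL x; apply/cvgrPdist_lt => e e0.
have K0 : 0 < L + 1 by lra.
have eL : 0 < e / (L + 1) by exact: divr_gt0.
near=> y; apply: (le_lt_trans (fL _ _)).
have : `|x - y| < e / (L + 1) by near: y; exact: cvgr_dist_lt.
rewrite ltr_pdivlMr//; apply: le_lt_trans.
by rewrite mulrC ler_wpM2l// lerDl.
Unshelve. all: by end_near. Qed.

Lemma increment_continuous f u : continuous f -> continuous (fun x => f (x + u) - f x).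
Proof.
move=> cf x; apply: cvgB; last exact: cf.
apply: (@continuous_comp _ _ _ (fun x => x + u) f); last exact: cf.
by apply: cvgD; [exact: cvg_id|exact: cvg_cst].
Qed.

Lemma abs_continuous (h : X -> R) : continuous h -> continuous (fun x => `|h x|).
Proof.
move=> ch x; apply: (@continuous_comp _ _ _ h (fun z : R => `|z|)); first exact: ch.
exact: norm_continuous.
Qed.

Lemma open_gt_set (h : X -> R) (a : R) : continuous h -> open [set x | a < h x].
Proof.
move=> ch; rewrite (_ : [set x | _] = h @^-1` [set z | a < z])//.
by apply: open_comp; [move=> x _; exact: ch|exact: open_gt].
Qed.

Lemma closed_le_set (h : X -> R) (a : R) : continuous h -> closed [set x | h x <= a].
Proof.
move=> ch; rewrite (_ : [set x | _] = h @^-1` [set z | z <= a])//.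
by apply: closed_comp; [move=> x _; exact: ch|exact: closed_le].
Qed.

Definition dquot f v (s : R) x : R := (f (x + s *: v) - f x) / s.

(** Failure of the Cauchy criterion for the quotients along [v], with gap [k.+1^-1]. The union over
    all pairs of real increments is one of open sets for continuous [f], so the set is Borel. *)
Definition oscillating f v (k : nat) : set X := \bigcap_j
  \bigcup_(p in [set p : R * R | [/\ p.1 != 0, p.2 != 0, `|p.1| < j.+1%:R^-1 &
     `|p.2| < j.+1%:R^-1]]) [set x | k.+1%:R^-1 < `|dquot f v p.1 x - dquot f v p.2 x|].

Lemma borel_oscillating f v k : continuous f -> borel (oscillating f v k).
Proof.
move=> cf; apply: borel_bigcap => j; apply: borel_open; apply: bigcup_open => -[s s'] _ /=.
apply: open_gt_set; apply: abs_continuous => x; rewrite /dquot.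
have c (r : R) : {for x, continuous (fun x => (f (x + r *: v) - f x) / r)}.
  by apply: cvgMr_tmp; exact: increment_continuous.
by have := continuousB (c s) (c s').
Qed.

(** By the Cauchy criterion the quotients converge to their lower limit [sup W]. *)
Lemma not_oscillating_directional f L v x : 0 <= L -> is_lipschitz L f ->
  (forall k, ~ oscillating f v k x) -> exists d, directional f x v d.
Proof.
move=> L0 fL nosc; pose Q s := dquot f v s x.
have QL s : `|Q s| <= L * `|v|.
  rewrite /Q /dquot; have [->|s0] := eqVneq s 0.
    by rewrite invr0 mulr0 normr0 mulr_ge0.
  rewrite normrM normfV ler_pdivrMr ?normr_gt0//.
  have := fL (x + s *: v) x; rewrite addrAC subrr add0r normrZ.
  by rewrite (mulrC `|s|) mulrA.
pose W := [set b : R | exists2 r : R, 0 < r & forall s, s != 0 -> `|s| < r -> b <= Q s].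
have small (r : R) : 0 < r -> exists s : R, s != 0 /\ `|s| < r.
  move=> r0; exists (r / 2); rewrite gtr0_norm ?divr_gt0// gt_eqF ?divr_gt0//.
  by split=> //; lra.
have supW : has_sup W.
  split; first by exists (- (L * `|v|)), 1 => // s _ _; have := QL s; rewrite ler_norml => /andP[].
  exists (L * `|v|) => b [r r0 hb]; have [s [s0 sr]] := small r r0.
  by rewrite (le_trans (hb s s0 sr))// (le_trans (ler_norm _)).
exists (sup W) => e e0; have e20 : 0 < e / 2 by lra.
have /ltr_add_invr[k] := e20; rewrite add0r => /ltW ke.
have [j hj] : exists j : nat, forall s s', s != 0 -> s' != 0 ->
    `|s| < j.+1%:R^-1 -> `|s'| < j.+1%:R^-1 -> `|Q s - Q s'| <= e / 2.
  apply: contrapT => h; apply: (nosc k) => j _; apply: contrapT => h'.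
  apply: h; exists j => s s' s0 s'0 sj s'j; apply: le_trans ke.
  by rewrite leNgt; apply/negP => lt; apply: h'; exists (s, s').
have j0 : 0 < j.+1%:R^-1 :> R by rewrite invr_gt0.
exists j.+1%:R^-1 => // s sj.
have [->|s0] := eqVneq s 0.
  by rewrite scale0r addr0 subrr mul0r subrr !normr0 mulr0.
have -> : f (x + s *: v) - f x - s * sup W = (Q s - sup W) * s.
  by rewrite mulrBl /Q /dquot divfK// (mulrC s).
rewrite normrM ler_wpM2r//.
have h1 : Q s - e / 2 <= sup W.
  apply: ub_le_sup; first exact: supW.2.
  exists j.+1%:R^-1 => // s' s'0 s'j.
  by have := hj s s' s0 s'0 sj s'j; rewrite ler_norml => /andP[_]; clear; lra.
have h2 : sup W <= Q s + e / 2.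
  apply: ge_sup; first exact: supW.1.
  move=> b [r r0 hb].
  have [s' [s'0]] := small (Num.min r j.+1%:R^-1) ltac:(by rewrite lt_min r0).
  rewrite lt_min => /andP[s'r s'j]; apply: (le_trans (hb s' s'0 s'r)).
  by have := hj s s' s0 s'0 sj s'j; rewrite ler_norml => /andP[+ _]; clear; lra.
by rewrite ler_norml; apply/andP; split; clear -h1 h2 e0; lra.
Qed.

(** Slopes at most [eta * |V n|] in the limit, with no derivative assumed to exist. The uncountable
    intersection over [s] is one of closed sets for continuous [g], so the set is Borel. *)
Definition small_slopes g (V : nat -> X) (eta : R) : set X :=
  \bigcap_n \bigcap_k \bigcup_j \bigcap_(s in [set s : R | `|s| < j.+1%:R^-1])
    [set x | `|g (x + s *: V n) - g x| <= (eta * `|V n| + k.+1%:R^-1) * `|s|].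

Lemma borel_small_slopes g V eta : continuous g -> borel (small_slopes g V eta).
Proof.
move=> cg; apply: borel_bigcap => n; apply: borel_bigcap => k; apply: borel_bigcup => j.
apply: borel_closed; apply: closed_bigI => s _; apply: closed_le_set.
by apply: abs_continuous; exact: increment_continuous.
Qed.

(** A direction [w] is replaced by a close [V n]; both the Lipschitz error and the change of
    [eta * |V n|] are controlled by [|w - V n|]. *)
Lemma small_slopesP g V eta L x : 0 <= L -> is_lipschitz L g -> 0 <= eta ->
  (forall v (e : R), 0 < e -> exists n, `|v - V n| < e) -> small_slopes g V eta x ->
  forall w (e : R), 0 < e -> exists2 r : R, 0 < r & forall s, `|s| < r ->
    `|g (x + s *: w) - g x| <= (eta * `|w| + e) * `|s|.
Proof.
move=> L0 gL eta0 dV xE w e e0.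
have K0 : 0 < 2 * (L + eta + 1) by lra.
have [n hn] := dV w _ (divr_gt0 e0 K0).
have e20 : 0 < e / 2 by lra.
have /ltr_add_invr[k] := e20; rewrite add0r => /ltW ke.
have [j _ hj] := xE n I k I.
have j0 : 0 < j.+1%:R^-1 :> R by rewrite invr_gt0.
exists j.+1%:R^-1 => // s sj.
have h1 := hj s sj; rewrite /= in h1.
have h2 := gL (x + s *: w) (x + s *: V n).
rewrite opprD addrACA subrr add0r -scalerBr normrZ in h2.
have h3 := ler_normD (g (x + s *: w) - g (x + s *: V n)) (g (x + s *: V n) - g x).
rewrite subrKA in h3; apply: (le_trans h3).
have h4 : `|V n| <= `|w| + `|w - V n|.
  by rewrite -{1}(subrK w (V n)) (le_trans (ler_normD _ _))// distrC addrC.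
have h5 : (L + eta) * `|w - V n| <= e / 2.
  move: hn; rewrite ltr_pdivlMr// => /ltW; have := normr_ge0 (w - V n); clear; nra.
apply: (@le_trans _ _ ((L * `|w - V n| + (eta * `|V n| + e / 2)) * `|s|)); last first.
  rewrite ler_wpM2r//; have := ler_wpM2l eta0 h4; clear -h5; lra.
rewrite mulrDl lerD//; first by rewrite (le_trans h2)// mulrCA mulrC.
by rewrite (le_trans h1)// ler_wpM2r// lerD2l.
Qed.

Definition large_slope g (eps : R) : set X :=
  \bigcap_k \bigcup_(u in [set u : X | 0 < `|u| < k.+1%:R^-1])
    [set x | eps * `|u| < `|g (x + u) - g x|].

Lemma borel_large_slope g eps : continuous g -> borel (large_slope g eps).
Proof.
move=> cg; apply: borel_bigcap => k; apply: borel_open; apply: bigcup_open => u _.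
by apply: open_gt_set; apply: abs_continuous; exact: increment_continuous.
Qed.

Lemma large_slopeP g (eps r : R) x : large_slope g eps x -> 0 < r ->
  exists u, [/\ 0 < `|u|, `|u| < r & eps * `|u| < `|g (x + u) - g x|].
Proof.
move=> xl /ltr_add_invr[k]; rewrite add0r => kr.
have [u /andP[u0 uk] h] := xl k I; exists u; split=> //; exact: lt_trans kr.
Qed.

Lemma not_large_slope g (eps : R) x : ~ large_slope g eps x ->
  exists2 r : R, 0 < r & forall u, `|u| < r -> `|g (x + u) - g x| <= eps * `|u|.
Proof.
move=> nl; apply: contrapT => h; apply: nl => k _; apply: contrapT => h'.
apply: h; exists k.+1%:R^-1; first by rewrite invr_gt0.
move=> u uk; rewrite leNgt; apply/negP => lt; apply: h'; exists u => //=.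
rewrite uk andbT normr_gt0; apply: contraTneq lt => ->.
by rewrite addr0 subrr !normr0 mulr0 ltxx.
Qed.

End borel_conditions.

(** * Directional derivatives along generic surfaces *)

Section generic_directional.
Context {R : realType} (X : normedModType R) (mu : probability (cube_measurable R) R).
Hypothesis mu_product : is_product_lebesgue mu.
Notation lam := (@lebesgue_measure R).
Implicit Types (g h : surface X) (v : X).

Definition aligned v (e : R) : set (surface X) :=
  [set g | exists m, exists2 c : R, 0 < c & forall t, `|c *: partial m g t - v| <= e].

(** In [g \o shift m] the coordinate [m] is free, and adding [t_m * tau * v] makes the [m]-th
    partial derivative exactly [tau * v]. All surfaces of a small ball that controls this derivative
    remain aligned. *)
Lemma residual_aligned v (e : R) : 0 < e -> residual (aligned v e).
Proof.
move=> e0; apply: residual_dense_nbhs => U oU [g Ug].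
have [n [r r0 rU]] := nbhs_surface_ball (open_nbhs_nbhs (conj oU Ug)).
have r30 : 0 < r / 3 by lra.
have [M hM] := shift_uniform_partial g n r30.
pose m := maxn n M.
have K0 : 0 < `|v| + 1 by have := normr_ge0 v; lra.
pose tau := r / 3 / (`|v| + 1); have tau0 : 0 < tau by exact: divr_gt0.
have [s [sE spE]] := displaced_surface g m (C1_const (tau *: v)).
have tv : `|tau *: v| <= r / 3.
  rewrite normrZ gtr0_norm// /tau mulrAC ler_pdivrMr// ler_pM2l//; lra.
have sU : U s.
  apply: rU; apply: (@displaced_ball _ _ g m n r (fun=> tau *: v) (fun _ _ => 0)) => //.
  - exact: leq_maxl.
  - by move=> t; apply: hM; exact: leq_maxr.
  - by move=> j t _; rewrite normr0 ltW.
pose B := surface_ball m.+1 (tau * e) s.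
have nB : nbhs s B by apply: surface_ball_nbhs; exact: mulr_gt0.
exists (U `&` B^°); split.
- by apply: openI => //; exact: open_interior.
- by exists s.
- exact: subIsetl.
move=> h [_ /interior_subset /surface_ball_elim[_ hB]].
exists m, tau^-1; first by rewrite invr_gt0.
move=> t; have := hB m t (ltnSn m); rewrite spE /Dshift ltnn eqxx scale1r scaler0 addr0 add0r.
move=> hb; have -> : tau^-1 *: partial m h t - v = tau^-1 *: (partial m h t - tau *: v).
  by rewrite scalerBr scalerA mulVf ?gt_eqF// scale1r.
by rewrite normrZ gtr0_norm ?invr_gt0// ler_pdivrMl// ltW.
Qed.

Lemma surface_move_lipschitz g m t : exists2 M : R, 0 <= M &
  forall x y, `|g (move m t x) - g (move m t y)| <= M * `|x - y|.
Proof.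
have [M M0 hM] := bounded_on_cube (@C1_partial_continuous _ _ _ _ (surface_C1 g) m).
exists M => // x y; wlog xy : x y / x <= y.
  by move=> H; have [/H//|/ltW /H] := leP x y; rewrite distrC (distrC y).
have cl (z : R) : clamp_val (clamp_val z) = clamp_val z.
  by rewrite clamp_val_id// (unit_interval_bounds (clamp z)).
have mE z : move m t z = move m t (clamp_val z).
  by apply: cube_ext => j; rewrite !coord_move cl.
have b (z : R) : 0 <= clamp_val z <= 1 := unit_interval_bounds (clamp z).
have /andP[x0 _] := b x; have /andP[_ y1] := b y.
have cxy : clamp_val x <= clamp_val y.
  rewrite /clamp_val !maxEge !minEle.
  by do !case: ifPn => //=; rewrite -?ltNge => *; lra.
have := @mean_value _ _ m g _ t 0 M _ _ (surface_C1 g) x0 cxy y1.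
rewrite scaler0 subr0 distrC -!mE => H; apply: (le_trans (H _)).
  by move=> z _ _; rewrite subr0.
rewrite ler_wpM2l//; have := clamp_lipschitz y x.
rewrite (distrC x y) ger0_norm ?subr_ge0// => /le_trans; apply; exact: lexx.
Qed.

(** The curve and its tangent at [s] differ by a small multiple of the increment, and so do the
    values of the Lipschitz function [f] on them. *)
Lemma surface_derivative_directional f L g m t (s d : R) : 0 <= L -> is_lipschitz L f ->
  0 < s < 1 -> has_derivative (fun y => f (g (move m t y))) s d ->
  directional f (g (move m t s)) (partial m g (move m t s)) d.
Proof.
move=> L0 fL /andP[s0 s1] hd e e0.
have e20 : 0 < e / 2 by lra.
have K0 : 0 < 2 * (L + 1) by lra.
have [r r0 hr] := hd _ e20.
have s01 : 0 <= s <= 1 by rewrite !ltW.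
have pg := C1_partial (surface_C1 g) m (move m t s).
have [r' r'0 hr'] := is_partial_move pg s01 (divr_gt0 e0 K0).
exists (Num.min (Num.min r r') (Num.min s (1 - s))).
  by rewrite !lt_min r0 r'0 s0 subr_gt0.
move=> y; rewrite !lt_min -!andbA => /and4P[yr yr' ys y1s].
have sy01 : 0 <= s + y <= 1.
  by move: ys y1s; rewrite !ltr_norml => /andP[? ?] /andP[? ?]; apply/andP; split; lra.
have h1 := hr y yr.
have h2 := hr' (s + y) sy01; rewrite addrAC subrr add0r in h2.
move/(_ yr') : h2 => h2; set x := g (move m t s) in h1 h2 *; set w := partial _ _ _ in h2 *.
have h3 := fL (x + y *: w) (g (move m t (s + y))).
have e3 : `|x + y *: w - g (move m t (s + y))| = `|g (move m t (s + y)) - x - y *: w|.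
  by rewrite distrC opprD addrA.
rewrite e3 in h3.
have h4 : L * (e / (2 * (L + 1)) * `|y|) <= e / 2 * `|y|.
  rewrite mulrA ler_wpM2r// mulrA ler_pdivrMr//; clear -L0 e0; nra.
have h5 := le_trans h3 (ler_wpM2l L0 h2).
have -> : f (x + y *: w) - f x - y * d = (f (x + y *: w) - f (g (move m t (s + y)))) +
  (f (g (move m t (s + y))) - f x - d * y) by ring.
apply: (le_trans (ler_normD _ _)); clear -h1 h4 h5; lra.
Qed.

(** At almost every point of an [m]-th line [f] is differentiable along the partial derivative, a
    multiple of which is close to [v]; near 0 the quotients along [v] then vary by no more than the
    gap in [oscillating]. *)
Lemma generic_not_oscillating f L v : 0 <= L -> is_lipschitz L f ->
  exists2 S : set (surface X), residual S &
    forall g, S g -> forall k, mu (pull g (oscillating f v k)) = 0%E.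
Proof.
move=> L0 fL; have cf := is_lipschitz_continuous L0 fL.
exists (\bigcap_n aligned v n.+1%:R^-1).
  by apply: residual_bigcap => n; apply: residual_aligned; rewrite invr_gt0.
move=> g Sg k.
have K0 : 0 < 4 * (L + 1) by lra.
pose kap : R := k.+1%:R^-1; have k0 : 0 < kap by rewrite invr_gt0.
(* For this [n], replacing [v] by a multiple of the partial derivative changes the quotient by at
   most [kap / 4], half of what [near_d] allows. *)
have /ltr_add_invr[n] := divr_gt0 k0 K0; rewrite add0r => /ltW nk.
have [m [c c0 hc]] := Sg n I.
pose A := pull g (oscillating f v k).
have mA : measurable (A : set (cube_measurable R)).
  by apply: measurable_pull; exact: borel_oscillating.
apply: (slice_null mu_product (m := m) mA) => t.
have mSl := measurable_slice m t mA.
have [M M0 hM] := surface_move_lipschitz g m t.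
pose h y := f (g (move m t y)).
have hL y y' : `|h y' - h y| <= L * M * `|y' - y|.
  by apply: (le_trans (fL _ _)); rewrite -mulrA ler_wpM2l.
have nder := lipschitz_derivable_ae (mulr_ge0 L0 M0) hL.
suff : lam.-negligible (slice m t A) by move/(negligibleP lam mSl).
have neg1 (a : R) : lam.-negligible [set a].
  by apply/negligibleP; [exact: measurable_set1|exact: lebesgue_measure_set1].
apply: negligibleS (negligibleU (negligibleU (neg1 0) (neg1 1)) nder) => s [/andP[s0 s1] As].
have [sE|s0'] := eqVneq s 0; first by left; left.
have [sE|s1'] := eqVneq s 1; first by left; right.
right=> d hd.
have s01 : 0 < s < 1 by rewrite !lt_neqAle s0 s1 s1' eq_sym s0'.
have dir := surface_derivative_directional L0 fL s01 hd.
set x := g (move m t s) in dir As; set w := partial m g _ in dir.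
have hw : `|c *: w - v| <= n.+1%:R^-1 := hc (move m t s).
have [r r0 hr] := dir (kap / (4 * c)) (divr_gt0 k0 (mulr_gt0 (ltr0n _ 4) c0)).
have /ltr_add_invr[j] : 0 < r / c by exact: divr_gt0.
rewrite add0r => jr.
have near_d y : y != 0 -> `|y| < j.+1%:R^-1 -> `|dquot f v y x - c * d| <= kap / 2.
  move=> y0 yj.
  have yc : `|y * c| < r.
    by rewrite normrM (gtr0_norm c0) -ltr_pdivlMr//; exact: lt_trans jr.
  have h1 := hr _ yc; rewrite -scalerA in h1.
  have h2 := fL (x + y *: (c *: w)) (x + y *: v).
  rewrite opprD addrACA subrr add0r -scalerBr normrZ in h2.
  have yn : 0 < `|y| by rewrite normr_gt0.
  have -> : dquot f v y x - c * d = (f (x + y *: v) - f x - y * c * d) / y.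
    by rewrite /dquot; field.
  rewrite normrM normfV ler_pdivrMr//.
  have h3 : kap / (4 * c) * `|y * c| = kap / 4 * `|y|.
    by rewrite normrM (gtr0_norm c0); field; rewrite gt_eqF.
  rewrite h3 in h1.
  have h4 : L * (`|y| * `|c *: w - v|) <= `|y| * (L * (kap / (4 * (L + 1)))).
    by rewrite mulrCA ler_wpM2l// ler_wpM2l// (le_trans hw).
  have h5 : L * (kap / (4 * (L + 1))) <= kap / 4.
    rewrite mulrA ler_pdivrMr//.
    have -> : kap / 4 * (4 * (L + 1)) = L * kap + kap by field.
    by clear -k0; lra.
  have h6 := ler_wpM2l (ltW yn) h5.
  have -> : f (x + y *: v) - f x - y * c * d = (f (x + y *: (c *: w)) - f x - y * c * d) -
    (f (x + y *: (c *: w)) - f (x + y *: v)) by ring.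
  apply: (le_trans (ler_normB _ _)); clear -h1 h2 h4 h6; lra.
have [[y y'] /= [y0 y'0 yj y'j] lt] := As j I.
have := near_d y y0 yj; have := near_d y' y'0 y'j.
have := ler_normB (dquot f v y x - c * d) (dquot f v y' x - c * d).
rewrite opprB addrA subrK.
by move: lt; rewrite -/kap; clear; lra.
Qed.

End generic_directional.

(** * Perturbations along a free coordinate *)

Section cells.
Context {R : realType}.

Lemma mean_value_abs (X : normedModType R) j (g : cube R -> X) Dg t (p : X) (M x y : R) :
  C1 g Dg -> 0 <= x <= 1 -> 0 <= y <= 1 ->
  (forall z, 0 <= z <= 1 -> `|z - x| <= `|y - x| -> `|Dg j (move j t z) - p| <= M) ->
  `|g (move j t y) - g (move j t x) - (y - x) *: p| <= M * `|y - x|.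
Proof.
move=> Cg /andP[x0 x1] /andP[y0 y1] hM; have [xy|/ltW yx] := leP x y.
  rewrite (ger0_norm (_ : 0 <= y - x)) ?subr_ge0//; apply: (mean_value Cg) => // z xz zy.
  apply: hM; first by apply/andP; split; lra.
  by rewrite !ger0_norm ?subr_ge0//; lra.
have -> : g (move j t y) - g (move j t x) - (y - x) *: p =
    - (g (move j t x) - g (move j t y) - (x - y) *: p).
  by rewrite -[x - y]opprB scaleNr [RHS]opprD [- - _]opprK !opprB.
rewrite normrN (distrC y x) (ger0_norm (_ : 0 <= x - y)) ?subr_ge0//.
apply: (mean_value Cg) => // z yz zx; apply: hM; first by apply/andP; split; lra.
by rewrite distrC ger0_norm ?subr_ge0// distrC ger0_norm ?subr_ge0//; lra.
Qed.

(** The coordinates are changed one at a time; each change is estimated by the mean value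
    inequality, with the derivative at [t] as reference and its uniform modulus as error. *)
Lemma C1_expansion (X : normedModType R) (g : cube R -> X) Dg m (kap : R) :
  C1 g Dg -> 0 < kap -> exists2 r : R, 0 < r & forall (rho : R) (t t' : cube R),
    0 <= rho -> rho <= r ->
    (forall j, (j < m)%N -> `|coord t' j - coord t j| <= rho) ->
    (forall j, (m <= j)%N -> coord t' j = coord t j) ->
    `|g t' - g t - \sum_(j < m) (coord t' j - coord t j) *: Dg j t| <= kap * rho.
Proof.
move=> Cg; elim: m kap => [|m IH] kap kap0.
  exists 1 => // rho t t' rho0 _ _ e; have -> : t' = t by apply: cube_ext => j; exact: e.
  rewrite big_ord0 !subrr normr0; exact: mulr_ge0 (ltW kap0) rho0.
have k20 : 0 < kap / 2 by lra.
have [r r0 hr] := IH _ k20.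
have [l hl] := uniform_modulus (@C1_partial_continuous _ _ _ _ Cg m) k20.
exists (Num.min r (2^-1 ^+ l)); first by rewrite lt_min r0 half_gt0.
move=> rho t t' rho0; rewrite le_min => /andP[rr rl] near far.
pose t1 := move m t' (coord t m).
have t1j j : coord t1 j = if j == m then coord t m else coord t' j.
  by rewrite coord_move; case: ifP => // _; rewrite clamp_val_id// coord_bounds.
have h1 : `|g t1 - g t - \sum_(j < m) (coord t' j - coord t j) *: Dg j t| <= kap / 2 * rho.
  have := hr rho t t1 rho0 rr; rewrite (eq_bigr (fun j : 'I_m => (coord t' j - coord t j) *: Dg j t)).
    apply=> j mj; rewrite t1j.
      by rewrite (ltn_eqF mj); apply: near; exact: leqW.
    by case: eqVneq => [->//|jm]; apply: far; rewrite ltn_neqAle eq_sym jm.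
  by move=> j _; rewrite t1j (ltn_eqF (ltn_ord j)).
have t'E : t' = move m t1 (coord t' m).
  by apply: cube_ext => j; rewrite coord_move t1j; case: eqVneq => // ->;
    rewrite clamp_val_id// coord_bounds.
have t1E : t1 = move m t1 (coord t m) by rewrite /t1 move_move.
have h2 : `|g t' - g t1 - (coord t' m - coord t m) *: Dg m t| <= kap / 2 * rho.
  rewrite [in X in g X - _]t'E [in X in _ - g X]t1E.
  apply: (@le_trans _ _ (kap / 2 * `|coord t' m - coord t m|)).
    apply: (mean_value_abs Cg); rewrite ?coord_bounds// => z z01 zt.
    apply: hl => j jl; rewrite coord_move t1j; case: eqVneq => [->|jm].
      by rewrite clamp_val_id// (le_trans zt)// (le_trans (near m _)).
    have [jm'|jm'] := ltnP j m; first by rewrite (le_trans (near j (leqW jm'))).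
    by rewrite far ?ltn_neqAle 1?eq_sym ?jm// subrr normr0 ltW// half_gt0.
  by rewrite ler_wpM2l ?(ltW k20)//; exact: near.
rewrite big_ord_recr/=.
have -> : g t' - g t - (\sum_(i < m) (coord t' i - coord t i) *: Dg i t +
    (coord t' m - coord t m) *: Dg m t) =
  (g t1 - g t - \sum_(i < m) (coord t' i - coord t i) *: Dg i t) +
  (g t' - g t1 - (coord t' m - coord t m) *: Dg m t).
  move: (\sum_(i < m) _) ((_ - _) *: Dg m t) => a b.
  rewrite addrACA opprD; congr (_ + _).
  by rewrite [in RHS]addrC subrKA.
by apply: (le_trans (ler_normD _ _)); clear -h1 h2; lra.
Qed.

Lemma dyadic_between (z : R) : 0 < z -> z <= 1 -> exists k, 2^-1 ^+ k.+1 < z /\ z <= 2^-1 ^+ k.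
Proof.
move=> z0 z1; have [l lz] := half_lt z0.
have ex : exists k, 2^-1 ^+ k < z by exists l.
have [k kz kmin] := ex_minnP ex.
case: k kz kmin => [|k] kz kmin.
  by move: kz; rewrite expr0 ltNge z1.
exists k; split=> //; rewrite leNgt; apply/negP => /kmin; by rewrite ltnn.
Qed.

(** Partial sums of any admissible levels, shifted by [l0], are nondecreasing and still
    admissible. *)
Lemma monotone_levels (P : nat -> nat -> Prop) : (forall k, exists l, P k l) ->
  (forall k l l', (l <= l')%N -> P k l -> P k l') -> forall l0 : nat,
  exists l : nat -> nat, [/\ forall k, P k (l k), forall k k', (k <= k')%N -> (l k <= l k')%N &
    forall k, (l0 <= l k)%N].
Proof.
move=> /choice[l hl] mono l0; exists (fun k => l0 + \sum_(i < k.+1) l i)%N; split.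
- move=> k; apply: mono (hl k); rewrite big_ord_recr/= addnA; exact: leq_addl.
- move=> k k' kk'; rewrite leq_add2l.
  rewrite -!(big_mkord xpredT l) (big_cat_nat (n := k.+1) (m := 0) (p := k'.+1))//=.
  exact: leq_addr.
- by move=> k; exact: leq_addr.
Qed.

(** Weierstrass's product inequality. *)
Lemma prod_ge_one_sub (n : nat) (x : nat -> R) : (forall i, 0 <= x i <= 1) ->
  1 - \sum_(i < n) x i <= \prod_(i < n) (1 - x i).
Proof.
move=> x01; elim: n => [|n IH]; first by rewrite !big_ord0 subr0.
rewrite !big_ord_recr/=; have /andP[h0 h1] := x01 n.
have s0 : 0 <= \sum_(i < n) x i by apply: sumr_ge0 => i _; case/andP: (x01 i).
have : (1 - \sum_(i < n) x i) * (1 - x n) <= \prod_(i < n) (1 - x i) * (1 - x n).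
  by rewrite ler_wpM2r// subr_ge0.
have := mulr_ge0 s0 h0; lra.
Qed.

Notation lam := (@lebesgue_measure R).

Definition slab (q N : R) : set R := [set x | q <= N * x < q + 1].
Definition core_slab (q N K : R) : set R := [set x | q + K^-1 <= N * x <= q + 1 - K^-1].

Definition itv_prob (A : set R) : R := fine (lam (A `&` `[0, 1])).

Lemma itv_probE (A : set R) : measurable A -> lam (A `&` `[0, 1]) = (itv_prob A)%:E.
Proof.
move=> mA; rewrite fineK// ge0_fin_numE//.
have mI : measurable (A `&` `[0 : R, 1]) by exact: measurableI.
apply: (@le_lt_trans _ _ (lam `[0, 1])); first by apply: le_measure; rewrite ?inE.
by rewrite lebesgue_measure_itv/= lte_fin ltr01 -EFinD ltry.
Qed.

(** A slab inside [[0, 1]] has length [1 / N], and its core loses [1 / (K * N)] at each end. When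
    [q >= N] the slab meets [[0, 1]] at most in the point 1. *)
Lemma itv_prob_core (q N : nat) (K : R) : (0 < N)%N -> 2 <= K ->
  (1 - 2 / K) * itv_prob (slab q%:R N%:R) <=
  itv_prob (slab q%:R N%:R `&` core_slab q%:R N%:R K).
Proof.
move=> N0 K2; have N0' : 0 < N%:R :> R by rewrite ltr0n.
have K0 : 0 < K by lra.
have K1 : 0 <= 1 - 2 / K by rewrite subr_ge0 ler_pdivrMr// mul1r.
have Ki0 : 0 < K^-1 by rewrite invr_gt0.
have mS : measurable (slab q%:R N%:R) by exact: measurable_slab.
have mC : measurable (core_slab q%:R N%:R K).
  rewrite (_ : core_slab _ _ _ = (fun x => N%:R * x) @^-1` `[q%:R + K^-1, q%:R + 1 - K^-1]).
    by rewrite -[X in measurable X]setTI; exact: (mulrl_measurable _).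
  by apply/seteqP; split=> x /=; rewrite in_itv.
have mSC : measurable (slab q%:R N%:R `&` core_slab q%:R N%:R K) by exact: measurableI.
have [qN|qN] := leqP q.+1 N.
  have qN' : q%:R + 1 <= N%:R :> R by rewrite natr1 ler_nat.
  have up : itv_prob (slab q%:R N%:R) <= N%:R^-1.
    rewrite -lee_fin -itv_probE//.
    apply: (@le_trans _ _ (lam `[q%:R / N%:R, (q%:R + 1) / N%:R])).
      apply: le_measure; rewrite ?inE//; first exact: measurableI.
      move=> x [/andP[h1 h2] _] /=; rewrite in_itv/=.
      by rewrite ler_pdivrMr// ler_pdivlMr// !(mulrC x) h1 ltW.
    rewrite lebesgue_measure_itv/= lte_fin ltr_pM2r ?invr_gt0// ltrDl ltr01.
    by rewrite -EFinD -mulrBl addrAC subrr add0r mul1r lexx.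
  have low : (1 - 2 / K) / N%:R <= itv_prob (slab q%:R N%:R `&` core_slab q%:R N%:R K).
    rewrite -lee_fin -itv_probE//.
    apply: (@le_trans _ _ (lam `[(q%:R + K^-1) / N%:R, (q%:R + 1 - K^-1) / N%:R])).
      rewrite lebesgue_measure_itv/= lte_fin; case: ifPn => [lt|].
        rewrite -EFinD lee_fin -mulrBl ler_wpM2r ?invr_ge0 ?(ltW N0')//.
        by move: (K^-1) (q%:R : R) => x y; lra.
      rewrite -leNgt ler_pM2r ?invr_gt0// => h; rewrite lee_fin.
      rewrite pmulr_lle0 ?invr_gt0//; move: h; move: (K^-1) (q%:R : R) => x y; lra.
    apply: le_measure; rewrite ?inE//; first exact: measurableI.
    move=> x /=; rewrite in_itv/= ler_pdivrMr// ler_pdivlMr// !(mulrC x) => /andP[h1 h2].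
    have q0 : 0 <= q%:R :> R by [].
    split; last first.
      rewrite in_itv/=; apply/andP; split.
        rewrite -(pmulr_rge0 _ N0'); clear -h1 q0 Ki0; lra.
      rewrite -(ler_pM2l N0') mulr1; clear -h2 qN' Ki0; lra.
    split; last by rewrite /core_slab/= h1.
    by rewrite /slab/=; apply/andP; split; clear -h1 h2 Ki0; lra.
  by apply: le_trans low; rewrite ler_wpM2l.
have -> : itv_prob (slab q%:R N%:R) = 0.
  apply/eqP; rewrite eq_le fine_ge0// andbT -lee_fin -itv_probE//.
  apply: (@le_trans _ _ (lam [set 1])); last by rewrite lebesgue_measure_set1.
  apply: le_measure; rewrite ?inE//.
    exact: measurableI.
  move=> x [/andP[h1 _]]; rewrite /= in_itv/= => /andP[x0 x1].
  apply/eqP; rewrite eq_le x1/= -(ler_pM2l N0') mulr1 (le_trans _ h1)// ler_nat.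
  by rewrite -ltnS.
by rewrite mulr0 fine_ge0.
Qed.

Section core.
Variables (mu : probability (cube_measurable R) R).
Hypothesis mu_product : is_product_lebesgue mu.

Lemma prob_box n (A : nat -> set R) : (forall j, measurable (A j)) ->
  prob mu (box n A) = \prod_(j < n) itv_prob (A j).
Proof.
move=> mA; apply: EFin_inj; rewrite -probE; last exact: measurable_box.
apply: (etrans (mu_box mu_product n mA)).
elim: n => [|n IH]; first by rewrite !big_ord0.
by rewrite !big_ord_recr/= IH EFinM itv_probE.
Qed.

Definition cell (n : nat) (c : nat -> nat) (q : seq nat) : set (cube R) :=
  [set t | code n c t = q].

Definition core (n : nat) (c : nat -> nat) (q : seq nat) (K : nat -> R) : set (cube R) :=
  cell n c q `&` [set t | forall j, (j < n)%N -> (0 < c j)%N ->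
    (nth 0%N q j)%:R + (K j)^-1 <= (c j)%:R * coord t j <= (nth 0%N q j)%:R + 1 - (K j)^-1].

Let slabs c q j := [set x : R | (nth 0%N q j)%:R <= (c j)%:R * x < (nth 0%N q j).+1%:R].
Let core_slabs c q (K : nat -> R) j := slabs c q j `&`
  (if (0 < c j)%N then core_slab (nth 0%N q j)%:R (c j)%:R (K j) else setT).

Let m_slabs c q j : measurable (slabs c q j). Proof. exact: measurable_slab. Qed.

Let m_core_slabs c q K j : measurable (core_slabs c q K j).
Proof.
apply: measurableI; first exact: m_slabs.
case: ifP => // _.
rewrite (_ : core_slab _ _ _ = (fun x => (c j)%:R * x) @^-1`
    `[(nth 0%N q j)%:R + (K j)^-1, (nth 0%N q j)%:R + 1 - (K j)^-1]).
  by rewrite -[X in measurable X]setTI; exact: (mulrl_measurable _).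
by apply/seteqP; split=> x /=; rewrite in_itv.
Qed.

Let coreE n c q K : size q = n -> core n c q K = box n (core_slabs c q K).
Proof.
move=> sq; rewrite /core /cell (cell_boxE _ sq); apply/seteqP; split=> t /=.
  move=> [h1 h2] j jn; split; first exact: h1.
  by case: ifP => // cj; exact: h2.
move=> h; split=> j jn; first by case: (h j jn).
by move=> cj; have [_] := h j jn; rewrite cj.
Qed.

Lemma measurable_core n c q K : measurable (core n c q K : set (cube_measurable R)).
Proof.
have [sq|sq] := eqVneq (size q) n; first by rewrite coreE//; apply: measurable_box.
rewrite (_ : core _ _ _ _ = set0)//; apply/seteqP; split=> // t [/= tq _].
by rewrite -tq size_mkseq eqxx in sq.
Qed.

(** Each constrained coordinate keeps at least the proportion [1 - 2 / K j], and the product of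
    these is at least [1 / 2]. *)
Lemma core_prob n c q (K : nat -> R) : (forall j, 2 <= K j) ->
  (\sum_(j < n) 2 / K j <= 1 / 2) -> prob mu (cell n c q) <= 2 * prob mu (core n c q K).
Proof.
move=> K2 sumK; have [sq|sq] := eqVneq (size q) n; last first.
  rewrite (_ : cell n c q = set0) ?/prob ?measure0 ?mulr_ge0 ?fine_ge0//.
  by apply/seteqP; split=> // t /= tq; rewrite -tq size_mkseq eqxx in sq.
rewrite coreE// /cell cell_boxE// !prob_box//; last by move=> j; exact: (m_slabs c q j).
have K0 j : 0 < K j by apply: lt_le_trans (K2 j).
have x01 j : 0 <= 2 / K j <= 1.
  by rewrite divr_ge0 ?(ltW (K0 j))//= ler_pdivrMr// mul1r.
have h : \prod_(j < n) (1 - 2 / K j) * \prod_(j < n) itv_prob (slabs c q j) <=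
    \prod_(j < n) itv_prob (core_slabs c q K j).
  rewrite -big_split/=; apply: ler_prod => j _; apply/andP; split.
    by rewrite mulr_ge0 ?fine_ge0// subr_ge0; case/andP: (x01 j).
  rewrite /core_slabs; case: posnP => [cj|cj].
    rewrite setIT ler_piMl ?fine_ge0// gerBl; by case/andP: (x01 j).
  rewrite (_ : slabs c q j = slab (nth 0%N q j)%:R (c j)%:R); last first.
    by rewrite /slabs/slab -natr1.
  exact: itv_prob_core.
have p0 : 0 <= \prod_(j < n) itv_prob (slabs c q j) by apply: prodr_ge0 => j _; rewrite fine_ge0.
have h2 : 1 / 2 <= \prod_(j < n) (1 - 2 / K j).
  apply: le_trans (prod_ge_one_sub n x01); lra.
have := ler_wpM2r p0 h2; clear -h; lra.
Qed.

Lemma core_move n c q K m t y : c m = 0%N -> core n c q K t -> core n c q K (move m t y).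
Proof.
move=> cm [/= tq h]; split=> /=.
  rewrite -tq /code; apply: eq_mkseq => j.
  by rewrite coord_move; case: eqVneq => // ->; rewrite cm !mul0r.
move=> j jn cj; rewrite coord_move; case: eqVneq => [jm|_]; last exact: h.
by rewrite jm cm in cj.
Qed.

End core.
End cells.

(** * Increments along the lines of the free coordinate *)

Section slice_increment.
Context {R : realType}.
Notation lam := (@lebesgue_measure R).

(** Real induction for [h] and for [- h], the exceptional set being an open set barely larger than
    [Z]: the speed is at most [p] off [Z], and on [Z] the Lipschitz constant is paid. *)
Lemma increment_le (h : R -> R) (A p : R) (Z : set R) : 0 <= A -> 0 <= p ->
  measurable Z -> Z `<=` `[0, 1] ->
  (forall s s' : R, 0 <= s -> s <= s' -> s' <= 1 -> `|h s' - h s| <= A * (s' - s)) ->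
  (forall s : R, 0 <= s -> s < 1 -> ~ Z s ->
     exists s', [/\ s < s', s' <= 1 & `|h s' - h s| <= p * (s' - s)]) ->
  `|h 1 - h 0| <= p + A * fine (lam Z).
Proof.
move=> A0 p0 mZ Z01 hA hp.
have lZ : (lam Z <= 1%:E)%E.
  rewrite (_ : 1%:E = lam `[0 : R, 1]); first by apply: le_measure; rewrite ?inE.
  by rewrite lebesgue_measure_itv/= lte_fin ltr01 -EFinD subr0.
have fZ : lam Z \is a fin_num by rewrite ge0_fin_numE// (le_lt_trans lZ)// ltry.
have open_bound (O : set R) : open O -> Z `<=` O ->
    `|h 1 - h 0| <= p + A * occupied O 0 1.
  (* The growth lemma is used with slope [- p] and the worse bound [A + p], whose sum is the factor
     [A] in front of the measure. *)
  move=> oO ZO; have A1 : 0 <= A + p + - p by rewrite addrK.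
  have Alow s s' : 0 <= s -> s <= s' -> s' <= 1 -> `|h s' - h s| <= (A + p) * (s' - s).
    move=> s0 ss s1; apply: le_trans (hA _ _ s0 ss s1) _.
    by rewrite ler_wpM2r ?subr_ge0// lerDl.
  have up : - p * (1 - 0) - (A + p + - p) * occupied O 0 1 <= h 1 - h 0.
    apply: growth_open => //.
      move=> s s' s0 ss s1; have := Alow _ _ s0 ss s1; rewrite ler_norml => /andP[+ _].
      by rewrite mulNr.
    move=> s s0 s1 nO; have [|s' [ss' s'1 h']] := hp s s0 s1; first by move/ZO.
    exists s'; split=> //; move: h'; rewrite ler_norml => /andP[+ _]; by rewrite mulNr.
  have down : - p * (1 - 0) - (A + p + - p) * occupied O 0 1 <= - h 1 - - h 0.
    apply: (@growth_open _ O (fun x => - h x)) => //.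
      move=> s s' s0 ss s1; have := Alow _ _ s0 ss s1; rewrite ler_norml => /andP[_ +].
      rewrite mulNr; move: (_ * _) => z; lra.
    move=> s s0 s1 nO; have [|s' [ss' s'1 h']] := hp s s0 s1; first by move/ZO.
    exists s'; split=> //; move: h'; rewrite ler_norml => /andP[_ +].
    rewrite mulNr; move: (_ * _) => z; lra.
  move: up down; rewrite addrK subr0 mulr1; move: (A * _) => z; rewrite ler_norml => *.
  by apply/andP; split; lra.
apply/ler_addgt0Pr => e e0; have e1 : 0 < e / (A + 1) by apply: divr_gt0 => //; lra.
have [|O [oO ZO lO]] := lebesgue_regularity_outer mZ _ e1.
  by rewrite (le_lt_trans lZ)// ltry.
apply: le_trans (open_bound O oO ZO) _.
have mO : measurable O by exact: open_measurable.
have mO1 : measurable (O `&` `[0 : R, 1]) by exact: measurableI.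
have occ : occupied O 0 1 <= fine (lam Z) + e / (A + 1).
  have lO1 : (lam (O `&` `[0%R : R, 1%R]%classic) <= lam Z + (e / (A + 1))%:E)%E.
    apply: (@le_trans _ _ (lam (Z `|` (O `\` Z)))).
      apply: le_measure; rewrite ?inE//; first by apply: measurableU => //; exact: measurableD.
      by move=> x [Ox _]; case: (pselect (Z x)) => Zx; [left|right].
    have mOZ : measurable (O `\` Z) by exact: measurableD.
    have := @measureU2 _ _ _ lam Z (O `\` Z) mZ mOZ => /le_trans; apply.
    by rewrite leeD2l// ltW.
  rewrite /occupied -lee_fin EFinD (fineK fZ) fineK//.
  rewrite ge0_fin_numE// (le_lt_trans lO1)// -(fineK fZ) -EFinD ltry//.
have := ler_wpM2l A0 occ; rewrite mulrDr => h1.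
suff : A * (e / (A + 1)) <= e by lra.
rewrite mulrCA ger_pMr// ler_pdivrMr ?mul1r; lra.
Qed.

End slice_increment.

Section steep_core.
Context {R : realType} {X : completeNormedModType R}.
Notation lam := (@lebesgue_measure R).

(* Along the [m]-th line through [t], [f] changes by about [eps / 2 * `|u|], whereas its slope at
   the points of [small_slopes] is at most [eps / 16 * `|u|]. *)
Lemma core_slice (f : X -> R) (L eps tau : R) (V : nat -> X) (sig : surface X) m t (y u : X) :
  0 < L -> is_lipschitz L f -> 0 < eps ->
  (forall v (e : R), 0 < e -> exists n, `|v - V n| < e) ->
  0 < `|u| -> tau <= `|u| -> 8 * L * tau <= eps * `|u| ->
  eps / 2 * `|u| <= `|f (y + u) - f y| ->
  (forall x : R, 0 <= x <= 1 -> `|sig (move m t x) - (y + x *: u)| <= tau) ->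
  (forall x : R, 0 <= x <= 1 -> `|partial m sig (move m t x) - u| <= tau) ->
  ((eps / (16 * L))%:E <=
    lam (slice m t (sig @^-1` (~` small_slopes f V (eps / 64)))))%E.
Proof.
move=> L0 fL eps0 dV u0 tu tL fu near_sig near_partial.
set E := small_slopes f V (eps / 64).
have cf := is_lipschitz_continuous (ltW L0) fL.
have bE : borel (~` E) by apply: borelC; exact: borel_small_slopes.
have mZ : measurable (slice m t (sig @^-1` (~` E))).
  by apply: measurable_slice; exact: measurable_pull.
set Z := slice _ _ _; have Z01 : Z `<=` `[0, 1] by move=> x [x01 _]; rewrite /= in_itv.
pose h x := f (sig (move m t x)).
have C := surface_C1 sig.
have hA s s' : 0 <= s -> s <= s' -> s' <= 1 -> `|h s' - h s| <= (2 * L * `|u|) * (s' - s).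
  move=> s0 ss s1; apply: le_trans (fL _ _) _.
  have := @mean_value _ _ m sig _ t u tau s s' C s0 ss s1.
  have H : forall z, s <= z -> z <= s' -> `|partial m sig (move m t z) - u| <= tau.
    by move=> z sz zs; apply: near_partial; apply/andP; split; lra.
  move=> /(_ H); set d := sig _ - sig _ => hd.
  have : `|d| <= `|d - (s' - s) *: u| + `|(s' - s) *: u|.
    by rewrite -{1}(subrK ((s' - s) *: u) d) ler_normD.
  have ss0 : 0 <= s' - s by rewrite subr_ge0.
  rewrite normrZ (ger0_norm ss0) => hd'.
  have d2 : `|d| <= 2 * `|u| * (s' - s).
    have := ler_wpM2r ss0 tu; clear -hd hd'; lra.
  by have := ler_wpM2l (ltW L0) d2; move: (`|u|) => nu; clear; lra.
(* The slope [eps / 16 * |u|] is four times [eps / 64 * |u|]: two parts come from [|w| <= 2 * |u|],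
   one from the error in [small_slopesP], one from replacing the curve by its tangent. *)
have hp s : 0 <= s -> s < 1 -> ~ Z s ->
    exists s', [/\ s < s', s' <= 1 & `|h s' - h s| <= (eps / 16 * `|u|) * (s' - s)].
  move=> s0 s1 nZ; have s01 : 0 <= s <= 1 by rewrite s0 ltW.
  have Es : E (sig (move m t s)) by apply: contrapT => nE; apply: nZ; split.
  set w := partial m sig (move m t s).
  have wu : `|w| <= 2 * `|u|.
    have := near_partial _ s01; rewrite -/w.
    have : `|w| <= `|w - u| + `|u| by rewrite -{1}(subrK u w) ler_normD.
    clear -tu; lra.
  have k0 : 0 < eps / 64 * `|u| by apply: mulr_gt0 => //; lra.
  have eps64 : 0 <= eps / 64 by clear -eps0; lra.
  have [r r0 hr] := small_slopesP (ltW L0) fL eps64 dV Es w k0.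
  have kL : 0 < eps / 64 * `|u| / L by exact: divr_gt0.
  have [d d0 hd] := is_partial_move (C1_partial C m (move m t s)) s01 kL.
  pose z := Num.min (Num.min (r / 2) (d / 2)) (1 - s).
  have [zr zd z1 z0] : [/\ z < r, z < d, z <= 1 - s & 0 < z].
    split; rewrite /z ?gt_min ?ge_min ?lexx ?orbT//.
    - by rewrite (_ : r / 2 < r)//; lra.
    - by rewrite (_ : d / 2 < d) ?orbT//; lra.
    - by rewrite !lt_min; apply/andP; split; [apply/andP; split|]; lra.
  exists (s + z); split; [lra|lra|].
  have sz01 : 0 <= s + z <= 1 by apply/andP; split; lra.
  have szs : s + z - s = z by rewrite addrAC subrr add0r.
  have := hd (s + z) sz01; rewrite szs (ger0_norm (ltW z0)) => /(_ zd) h1.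
  have := hr z; rewrite (ger0_norm (ltW z0)) => /(_ zr) h2.
  have h3 := fL (sig (move m t (s + z))) (sig (move m t s) + z *: w).
  have h4 : `|sig (move m t (s + z)) - (sig (move m t s) + z *: w)|
      <= eps / 64 * `|u| / L * z by rewrite opprD addrA.
  have h5 := ler_wpM2l (ltW L0) h4.
  have h6 : L * (eps / 64 * `|u| / L * z) = eps / 64 * `|u| * z.
    by rewrite mulrA (mulrC L) divfK ?gt_eqF.
  have h7 : `|h (s + z) - h s| <= `|f (sig (move m t (s + z))) - f (sig (move m t s) + z *: w)|
      + `|f (sig (move m t s) + z *: w) - f (sig (move m t s))|.
    by rewrite -[X in `|X| <= _](subrKA (f (sig (move m t s) + z *: w))) ler_normD.
  have h8 : (eps / 64 * `|w| + eps / 64 * `|u|) * z <= (eps / 64 * (2 * `|u|) + eps / 64 * `|u|) * z.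
    by rewrite ler_wpM2r ?(ltW z0)// lerD2r ler_wpM2l.
  move: h7 h8 h5 h3 h2; rewrite h6; set a := `|f _ - _|; set b := `|f _ - _|.
  set n := `|_ - (_ + _)|; clear; move: (`|u|) (`|w|) => nu nw.
  lra.
have A0 : 0 <= 2 * L * `|u| by rewrite !mulr_ge0// ltW.
have p0 : 0 <= eps / 16 * `|u| by rewrite !mulr_ge0// ltW.
have fl : lam Z = (fine (lam Z))%:E.
  rewrite fineK// ge0_fin_numE//.
  apply: (@le_lt_trans _ _ (lam `[0 : R, 1])); first by apply: le_measure; rewrite ?inE.
  by rewrite lebesgue_measure_itv/= lte_fin ltr01 -EFinD ltry.
rewrite fl lee_fin; have := increment_le A0 p0 mZ Z01 hA hp; move: (fine (lam Z)) => q hle.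
have i0 : 0 <= (0 : R) <= 1 by apply/andP; split.
have i1 : 0 <= (1 : R) <= 1 by apply/andP; split.
have n0 := near_sig _ i0; have n1 := near_sig _ i1.
rewrite scale0r addr0 in n0; rewrite scale1r in n1.
have g0 := fL (sig (move m t 0)) y; have g1 := fL (sig (move m t 1)) (y + u).
have L0' := ltW L0.
have g0' := ler_wpM2l L0' n0; have g1' := ler_wpM2l L0' n1.
have tri : `|f (y + u) - f y| <= `|h 1 - h 0| + `|h 1 - f (y + u)| + `|h 0 - f y|.
  move: (f (y + u)) (f y) (h 1) (h 0) => a b a' b'.
  rewrite (_ : a - b = (a' - b') - (a' - a) + (b' - b)).
    by rewrite (le_trans (ler_normD _ _))// lerD2r// (le_trans (ler_normB _ _)).
  by rewrite opprB; clear; lra.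
(* Out of [eps / 2 * |u|], the endpoints cost [2 * L * tau <= eps / 4 * |u|] and the slopes off [Z]
   cost [eps / 16 * |u|]. *)
have fin : 3 * eps / 16 * `|u| <= 2 * L * `|u| * q.
  have e1 := le_trans g0 g0'; have e2 := le_trans g1 g1'.
  move: hle tri fu e1 e2 tL; rewrite /h.
  move: (`|u|) (`|f _ - _|) (`|f _ - _|) (`|f _ - _|) (`|f _ - _|) => nu a b b' b''.
  move: (2 * L * nu * q) => z; clear; lra.
rewrite ler_pdivrMr; last by clear -L0; lra.
have : 3 * eps / 16 <= 2 * L * q.
  by rewrite -(ler_pM2r u0) -[X in _ <= X]mulrA (mulrC q) mulrA.
clear -eps0; lra.
Qed.

End steep_core.

(** * Cells on which a large increment persists *)

Section steep_cells.
Context {R : realType} {X : completeNormedModType R}.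
Implicit Types (f : X -> R) (g : surface X).

(* The increment [u] is chosen of the size of the cell times [kap0]; the smallness of second
   differences carries the large increment from [g s] to the whole cell. *)
Lemma steep_nearby f (L eps kap kap0 : R) g (m : nat) (l : nat -> nat) (s : cube R) (O : set X) :
  0 <= L -> is_lipschitz L f -> 0 < eps -> 0 < kap -> 0 < kap0 ->
  32 * (1 + L) * kap <= eps * kap0 -> kap0 <= 1 ->
  (forall k t t', close (l k) t t' -> `|g t' - g t| <= kap * 2^-1 ^+ k) ->
  regular2 f (g s) -> large_slope f eps (g s) -> open O -> O (g s) ->
  exists k, exists u : X, [/\ kap0 * 2^-1 ^+ k / 2 <= `|u|, `|u| <= kap0 * 2^-1 ^+ k &
    forall s', (forall j, (j < m)%N -> `|coord s' j - coord s j| <= 2^-1 ^+ k) ->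
      (forall j, (m <= j < l k)%N -> `|coord s' j - coord s j| <= 2^-1 ^+ l k) ->
      eps / 2 * `|u| <= `|f (g s' + u) - f (g s')| /\ O (g s')].
Proof.
move=> L0 fL eps0 kap_gt0 kap0_gt0 kapL kap01 hl reg steep oO Os.
pose v j := partial j g s; pose x := g s.
have e0 : 0 < eps * kap0 / 16 by rewrite !mulr_gt0.
have [r2 r20 hr2] := reg m v _ e0.
have [r1 r10 hr1] := C1_expansion m (surface_C1 g) kap_gt0.
have [rO /= rO0 hO] : nbhs_ball x O by apply/nbhs_ballP; exact: open_nbhs_nbhs.
(* [rho * M] exceeds the distance from [x] to [g s'], so that [g s'] stays in the ball contained in
   [O]. *)
pose M := \sum_(j < m) `|v j| + 2 * kap + 1.
have S0 : 0 <= \sum_(j < m) `|v j| by apply: sumr_ge0.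
have M0 : 0 < M by rewrite /M; move: S0; move: (\sum_(j < m) _) => z; lra.
pose r := Num.min (Num.min r1 r2) (Num.min 1 (rO / M)).
have r0 : 0 < r by rewrite !lt_min r10 r20 ltr01 divr_gt0.
(* The bound [kap0 * r / 2] on [|u|] ensures [rho < r] for the dyadic [rho = 2^-k] with
   [rho / 2 < |u| / kap0 <= rho]. *)
have [u [u0 ur fu]] := large_slopeP steep (divr_gt0 (mulr_gt0 kap0_gt0 r0) (ltr0Sn R 1)).
have z0 : 0 < `|u| / kap0 by exact: divr_gt0.
have zr : `|u| / kap0 < r / 2 by rewrite ltr_pdivrMr// mulrAC (mulrC r).
have r1' : r <= 1 by rewrite /r !ge_min lexx !orbT.
have z1 : `|u| / kap0 <= 1 by move: r1' zr; clear; lra.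
have [k []] := dyadic_between z0 z1; rewrite exprS => zk kz.
exists k, u; move: zk kz; have := half_gt0 (R := R) k.
pose rho : R := 2^-1 ^+ k; rewrite -/rho => rho0 zk kz.
have rhor : rho < r by move: zk zr; clear; lra.
have uk : `|u| <= kap0 * rho by move: kz; rewrite ler_pdivrMr// mulrC.
have ku : kap0 * rho / 2 <= `|u|.
  by move: zk; rewrite ltr_pdivlMr// => /ltW; clear; lra.
split=> // s' near_s far_s.
have [[rr1 rr2] rrO] : (rho < r1 /\ rho < r2) /\ rho * M < rO.
  by move: rhor; rewrite !lt_min ltr_pdivlMr// => /andP[/andP[-> ->] /andP[_ ->]].
pose a j := coord s' j - coord s j; pose w := \sum_(j < m) a j *: v j.
(* Splits the passage from [s] to [s']: the first [m] coordinates are handled by the first order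
   expansion, the later ones by the modulus of continuity. *)
pose s1 : cube R := fun j => if (j < m)%N then s' j else s j.
have s1E j : coord s1 j = if (j < m)%N then coord s' j else coord s j.
  by rewrite /coord /s1; case: ifP.
have h1 : `|g s1 - x - w| <= kap * rho.
  have := hr1 rho s s1 (ltW rho0) (ltW rr1).
  rewrite (_ : \sum_(j < m) _ = w).
    apply=> j jm; rewrite s1E; first by rewrite jm; exact: near_s.
    by rewrite ltnNge jm.
  by apply: eq_bigr => j _; rewrite s1E ltn_ord.
have h2 : `|g s' - g s1| <= kap * rho.
  apply: hl => j jl; rewrite s1E; case: ltnP => jm; first by rewrite subrr normr0 ltW// half_gt0.
  by apply: far_s; rewrite jm.
have h3 : `|g s' - (x + w)| <= 2 * (kap * rho).
  rewrite -(subrKA (g s1)) (le_trans (ler_normD _ _))//.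
  move: h1 h2; rewrite -[g s1 - x - w]addrA -opprD.
  by move: (`|_ - _|) (`|_ - _|) => p q; clear; lra.
have aj j : (j < m)%N -> `|a j| <= rho by exact: near_s.
have wM : `|w| <= rho * \sum_(j < m) `|v j|.
  rewrite mulr_sumr (le_trans (ler_norm_sum _ _ _))//; apply: ler_sum => j _.
  by rewrite normrZ ler_wpM2r//; exact: aj.
split; last first.
  apply: hO; rewrite -ball_normE/= distrC (le_lt_trans _ rrO)//.
  have : `|g s' - x| <= `|g s' - (x + w)| + `|w|.
    have -> : g s' - x = g s' - (x + w) + w by rewrite opprD addrA subrK.
    exact: ler_normD.
  move: h3 wM; rewrite /M; move: (\sum_(j < m) `|v j|) (`|w|) (`|_ - _|) (`|_ - _|).
  by move: rho0; clear; move=> rho0 S nw p q; lra.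
have ur' : `|u| <= rho by apply: le_trans uk _; rewrite ger_pMl.
have := hr2 rho u a rho0 rr2 ur' aj; rewrite -/w -/x /second_difference => h4.
have h5 := fL (g s' + u) (x + w + u).
rewrite (_ : g s' + u - (x + w + u) = g s' - (x + w)) in h5; last first.
  by rewrite opprD addrACA subrr addr0.
have h6 := fL (g s') (x + w).
have h7 := ler_wpM2l L0 h3.
have h8 : `|f (x + u) - f x| <= `|f (g s' + u) - f (g s')| +
   `|f (x + w + u) - f (x + w) - (f (x + u) - f x)| + `|f (g s' + u) - f (x + w + u)| +
   `|f (g s') - f (x + w)|.
  move: (f (x + u)) (f x) (f (g s' + u)) (f (g s')) (f (x + w + u)) (f (x + w)).
  clear; move=> a b c d e h.
  rewrite [X in `|X| <= _](_ : a - b = (c - d) - (e - h - (a - b)) - (c - e) + (d - h)); last by lra.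
  apply: le_trans (ler_normD _ _) _; rewrite lerD2r.
  apply: le_trans (ler_normB _ _) _; rewrite lerD2r; exact: ler_normB.
(* Since [kap0 * rho <= 2 * |u|], the second difference costs at most [eps / 8 * |u|] and the two
   Lipschitz errors together [eps / 4 * |u|], less than half of [eps * |u|]. *)
have h9 : 4 * L * kap * rho <= eps * kap0 / 8 * rho.
  rewrite ler_wpM2r ?(ltW rho0)//.
  have := mulr_ge0 L0 (ltW kap_gt0); clear -kapL kap_gt0; lra.
have h10 : eps * (kap0 * rho / 2) <= eps * `|u| by rewrite ler_wpM2l// ltW.
move: fu h4 h5 h6 h7 h8 h9 h10 (mulr_ge0 (ltW eps0) (ltW u0)); rewrite -/x.
move: (`|f _ - _|) (`|f _ - _ - _|) (`|f _ - _|) (`|f _ - _|) (`|f _ - _|).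
move: (`|u|) (`|_ - _|); clear; move=> *; lra.
Qed.

Lemma sum_single (W : nmodType) (n : nat) (a : nat -> W) i0 : (i0 < n)%N ->
  (forall i, i != i0 -> a i = 0) -> \sum_(i < n) a i = a i0.
Proof.
move=> i0n ha; rewrite (bigD1 (Ordinal i0n))//= big1 ?addr0// => i.
by rewrite -val_eqE; exact: ha.
Qed.

Lemma norm_sum_disjoint (n : nat) (a : nat -> X) (e : R) : 0 <= e ->
  (forall i, `|a i| <= e) -> (forall i j, i != j -> a i = 0 \/ a j = 0) ->
  `|\sum_(i < n) a i| <= e.
Proof.
move=> e0 ae disj; case: (pselect (exists i : 'I_n, a i != 0)) => [[i ai]|none].
  rewrite (sum_single (ltn_ord i))// => j ji.
  by case: (disj j i ji) => // /eqP; rewrite (negPf ai).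
rewrite big1 ?normr0// => i _; apply/eqP; apply: contrapT => /negP ai.
by apply: none; exists i.
Qed.

Variables (mu : probability (cube_measurable R) R).
Hypothesis mu_product : is_product_lebesgue mu.
Notation T := (cube_measurable R).

(** One cell [C] with its core [D], cutoff and increment. The coordinate [m] is free: [D] is
    invariant under moving it and [phi] does not vary along it. Slopes are bounded only in the
    coordinates below [m], which is all that [displaced_ball] asks. *)
Record piece (m : nat) (e : R) (C D : set T) (phi : cube R -> R) (Dphi : nat -> cube R -> R)
    (u : X) : Prop := Piece {
  piece_measurable : measurable C;
  piece_core_measurable : measurable D;
  piece_core_sub : D `<=` C;
  piece_core_prob : prob mu C <= 2 * prob mu D;
  piece_C1 : C1 phi Dphi;
  piece_off : forall t, ~ C t -> phi t = 0 /\ forall j, Dphi j t = 0;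
  piece_on : forall t, D t -> phi t = 1;
  piece_move : forall t y, D t -> D (move m t y);
  piece_flat : forall t, Dphi m t = 0;
  piece_size : forall t, `|phi t *: u| <= e;
  piece_slope : forall j t, (j < m)%N -> `|Dphi j t *: u| <= e }.

Lemma piece0 m (e : R) : 0 <= e -> piece m e set0 set0 (fun=> 0) (fun _ _ => 0) 0.
Proof.
move=> e0; split=> //; first by rewrite /prob measure0 mulr0.
- exact: C1_const.
- by move=> t; rewrite scaler0 normr0.
- by move=> j t _; rewrite scaler0 normr0.
Qed.

Lemma piece_cell m n k N (e : R) (u : X) (t0 : cube R) :
  let c j := if (j < m)%N then (2 ^ k)%N else if j == m then 0%N else N in
  let q := code n c t0 in
  (m < n)%N -> 32 * (m.+1)%:R * `|u| * (2 ^ k)%:R <= e -> `|u| <= e ->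
  exists D phi Dphi, piece m e (cell n c q) D phi Dphi u.
Proof.
move=> c q mn ue ue'.
(* Half of the admissible loss goes to the first [m] coordinates and half to the at most [n] others.
   The value for [j < m] does not involve [n], so the slopes there do not depend on how many later
   coordinates are cut. *)
pose K j : R := if (j < m)%N then 8 * m.+1%:R else 8 * n%:R.
have n0 : (0 : R) < n%:R by rewrite ltr0n (leq_ltn_trans _ mn).
have n1 : (1 : R) <= n%:R by rewrite ler1n (leq_ltn_trans _ mn).
have m1 : (1 : R) <= m.+1%:R by rewrite ler1n.
have quarter (z : R) : 1 <= z -> 2 / (8 * z) = (4 * z)^-1 /\ (4 * z)^-1 * z = 1 / 4.
  by move=> z1; have z0 : z != 0 by [rewrite gt_eqF//; lra]; split; field.
have [qm _] := quarter _ m1; have [qn qn'] := quarter _ n1.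
have K2 j : 2 <= K j by rewrite /K; case: ifP => _; lra.
have K0 j : 0 < K j by apply: lt_le_trans (K2 j).
have sq : size q = n by rewrite size_mkseq.
have [phi [Dphi [C pr D0 Db sup core_on]]] :=
  @cell_bump_exists R n c (fun j => (nth 0%N q j)%:R) K K0.
have sumK : \sum_(j < n) 2 / K j <= 1 / 2.
  apply: (@le_trans _ _ (\sum_(j < n) (4 * n%:R)^-1 +
      \sum_(j < n | (j < m)%N) (4 * m.+1%:R)^-1)).
    rewrite [X in _ + X]big_mkcond/= -big_split/=; apply: ler_sum => j _.
    rewrite /K; case: ifP => _.
      by rewrite qm lerDr invr_ge0 mulr_ge0.
    by rewrite addr0 qn.
  have sumc p (z : R) : \sum_(j < p) z = z * p%:R by rewrite sumr_const card_ord mulr_natr.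
  rewrite (big_ord_narrow (ltnW mn)) !sumc qn'.
  have : (4 * m.+1%:R)^-1 * m%:R <= 1 / 4 :> R.
    rewrite mulrC ler_pdivrMr; last by clear -m1; lra.
    by rewrite mulrA divfK// mul1r ler_nat.
  by move: (_^-1 * _) => z z4; lra.
exists (core n c q K), phi, Dphi; split.
- exact: measurable_cell.
- exact: measurable_core.
- by move=> t [].
- exact: core_prob.
- exact: C.
- move=> t nC; have [j jn [cj nj]] : exists2 j, (j < n)%N & (0 < c j)%N /\
      ~ ((nth 0%N q j)%:R <= (c j)%:R * coord t j < (nth 0%N q j)%:R + 1).
    apply: contrapT => none; apply: nC; apply/codeP; split=> // j jn.
    have [cj|cj] := posnP (c j); last first.
      by rewrite -natr1; apply: contrapT => h; apply: none; exists j.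
    have := (codeP n c t0 q).1 erefl => -[_ /(_ _ jn)]; by rewrite cj !mul0r.
  apply: (sup j) => // /andP[h1 h2]; apply: nj.
  by rewrite (ltW h1).
- move=> t [_ h]; apply: core_on => j jn cj; exact: h.
- by move=> t y; apply: core_move; rewrite /c ltnn eqxx.
- move=> t; apply/eqP; rewrite -normr_le0 (le_trans (Db _ _))//.
  by rewrite /c ltnn eqxx mulr0.
- move=> t; rewrite normrZ; have /andP[p0 p1] := pr t.
  by rewrite (ger0_norm p0) (le_trans _ ue')// ler_piMl.
- move=> j t jm; rewrite normrZ (le_trans _ ue)//.
  have := Db j t; rewrite /K /c jm => /(ler_wpM2r (normr_ge0 u)) /le_trans; apply.
  by rewrite le_eqVlt; apply/orP; left; apply/eqP; ring.
Qed.

End steep_cells.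

(** * Disjoint cells and the displacement they carry *)

Section cell_family.
Context {R : realType} {X : completeNormedModType R}.
Variables (mu : probability (cube_measurable R) R).
Hypothesis mu_product : is_product_lebesgue mu.
Notation T := (cube_measurable R).

(** The later coordinates are cut at the scale [2^- l k], at which [g] varies little compared with
    [2^-k], the scale of the first ones; coordinate [m] stays free. *)
Definition mesh (m : nat) (l : nat -> nat) (k j : nat) : nat :=
  if (j < m)%N then (2 ^ k)%N else if j == m then 0%N else (2 ^ l k)%N.

(** One coordinate more than [l k] is recorded, because deleting coordinate [m] moves the later ones
    down by one. *)
Definition label (m : nat) (l : nat -> nat) (k : nat) (t : cube R) : seq nat :=
  code (l k).+1 (mesh m l k) t.

Lemma label_refine m l k k' t t' : (forall k k', (k <= k')%N -> (l k <= l k')%N) ->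
  (k <= k')%N -> label m l k' t = label m l k' t' -> label m l k t = label m l k t'.
Proof.
move=> l_mono kk'; apply: code_refine; first by rewrite ltnS l_mono.
move=> j _; rewrite /mesh; case: ifP => _; last case: ifP => _; [right|by left|right].
  by exists (2 ^ (k' - k))%N; rewrite ?expn_gt0// -expnD subnKC.
by exists (2 ^ (l k' - l k))%N; rewrite ?expn_gt0// -expnD subnKC// l_mono.
Qed.

(* The labels of different levels refine each other, so the good cells of minimal level are
   pairwise disjoint. *)
Lemma cell_family m l (e : R) (Good : nat -> cube R -> X -> Prop) :
  (forall k k', (k <= k')%N -> (l k <= l k')%N) -> (forall k, (m <= l k)%N) -> 0 <= e ->
  (forall k t t' u, label m l k t = label m l k t' -> Good k t u -> Good k t' u) ->
  (forall k t u, Good k t u -> 32 * m.+1%:R * `|u| * (2 ^ k)%:R <= e /\ `|u| <= e) ->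
  exists (C D : nat -> set T) (phi : nat -> cube R -> R) (Dphi : nat -> nat -> cube R -> R)
    (u : nat -> X), [/\ forall i, piece mu m e (C i) (D i) (phi i) (Dphi i) (u i),
    forall i j t, C i t -> C j t -> i = j,
    forall i t, C i t -> exists k, Good k t (u i) &
    forall k t v, Good k t v -> exists i, C i t].
Proof.
move=> l_mono ml e0 inv size.
(* Level [k] is the smallest at which the cell of [t] is good; finer labels determining the coarser
   ones, this depends only on the cell. *)
pose sel k t := (exists u, Good k t u) /\ forall k', (k' < k)%N -> ~ exists u, Good k' t u.
have sel_inv k t t' : label m l k t = label m l k t' -> sel k t -> sel k t'.
  move=> tt' [[u gu] low]; split; first by exists u; exact: inv gu.
  move=> k' k'k [u' gu']; apply: (low _ k'k); exists u'; apply: inv gu'.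
  by apply: label_refine (esym tt') => //; exact: ltnW.
(* Pieces are indexed by codes of pairs of a level and a label; an index that codes no selected cell
   receives the empty piece. *)
have family i : exists y : set T * set T * (cube R -> R) * (nat -> cube R -> R) * X,
    [/\ piece mu m e y.1.1.1.1 y.1.1.1.2 y.1.1.2 y.1.2 y.2,
      forall t, y.1.1.1.1 t -> exists k, [/\ pickle (k, label m l k t) = i, sel k t &
        Good k t y.2] &
      forall k t, pickle (k, label m l k t) = i -> sel k t -> y.1.1.1.1 t].
  case: (pselect (exists k, exists t, pickle (k, label m l k t) = i /\ sel k t)); last first.
    move=> none; exists (set0, set0, fun=> 0, fun _ _ => 0, 0); split=> //=.
    - exact: piece0.
    - by move=> k t ki st; apply: none; exists k, t.
  move=> [k [t [ki st]]]; have [[u gu] _] := st; have [ue ue'] := size _ _ _ gu.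
  have mn : (m < (l k).+1)%N by rewrite ltnS.
  have [D [phi [Dphi P]]] := piece_cell mu_product (2 ^ l k) t mn ue ue'.
  exists (cell (l k).+1 (mesh m l k) (label m l k t), D, phi, Dphi, u); split=> /=.
  - exact: P.
  - move=> t' t't; have tt' : label m l k t = label m l k t' by exact: esym t't.
    exists k; split; [by rewrite -tt'|exact: sel_inv st|exact: inv gu].
  - move=> k' t' ki' st'; have : (k', label m l k' t') = (k, label m l k t).
      by apply: (pcan_inj pickleK); rewrite ki ki'.
    by move=> kk; have := congr1 snd kk; have := congr1 fst kk => /= ->.
have [y hy] := choice family.
exists (fun i => (y i).1.1.1.1), (fun i => (y i).1.1.1.2), (fun i => (y i).1.1.2),
  (fun i => (y i).1.2), (fun i => (y i).2); split.
- by move=> i; have [] := hy i.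
- move=> i j t Ci Cj; have [_ /(_ t Ci)[k [ki [gk lowk] _]] _] := hy i.
  have [_ /(_ t Cj)[k' [ki' [gk' lowk'] _]] _] := hy j.
  have kk' : k = k'.
    by have [/lowk'/(_ gk)|/lowk/(_ gk')|] := ltngtP k k'.
  by rewrite -ki -ki' kk'.
- by move=> i t Ci; have [_ /(_ t Ci)[k [_ _ gk]] _] := hy i; exists k.
- move=> k t v gk.
  have ex : exists k, `[< exists u, Good k t u >] by exists k; apply/asboolP; exists v.
  have [k0 /asboolP gk0 kmin] := ex_minnP ex.
  exists (pickle (k0, label m l k0 t)).
  have [_ _ cover] := hy (pickle (k0, label m l k0 t)); apply: (cover k0) => //.
  split=> // k' k'k; move/asboolP/kmin; by rewrite leqNgt k'k.
Qed.

Lemma pieces_prob m (e : R) (C D : nat -> set T) phi Dphi (u : nat -> X) (n : nat) :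
  (forall i, piece mu m e (C i) (D i) (phi i) (Dphi i) (u i)) ->
  (forall i j t, C i t -> C j t -> i = j) ->
  prob mu (\bigcup_(i < n) C i) <= 2 * prob mu (\bigcup_(i < n) D i).
Proof.
move=> P disj; have mU (F : nat -> set T) k : (forall i, measurable (F i)) ->
    measurable (\bigcup_(i < k) F i).
  by move=> mF; apply: bigcup_measurable => i _; exact: mF.
have mC i : measurable (C i) := piece_measurable (P i).
have mD i : measurable (D i) := piece_core_measurable (P i).
have bigcupS (F : nat -> set T) k : \bigcup_(i < k.+1) F i = \bigcup_(i < k) F i `|` F k.
  apply/seteqP; split=> t.
    move=> [i /=]; rewrite ltnS leq_eqVlt => /orP[/eqP->|ik] Ft; first by right.
    by left; exists i.
  by case=> [[i /= ik Ft]|Ft]; [exists i => //=; exact: ltnW|exists k => /=].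
elim: n => [|n IH].
  rewrite (_ : \bigcup_(i < 0) C i = set0).
    by rewrite /prob measure0 mulr_ge0 ?fine_ge0.
  by apply/seteqP; split=> // t [].
rewrite (bigcupS C) (bigcupS D).
apply: (le_trans (probU _ (mU _ _ mC) (mC n))).
have -> : prob mu (\bigcup_(i < n) D i `|` D n) =
    prob mu (\bigcup_(i < n) D i) + prob mu (D n).
  rewrite (prob_split _ _ (mD n)); last exact: measurableU (mU _ _ mD) (mD n).
  congr (_ + _); congr (prob mu _); apply/seteqP; split=> t.
  - by move=> [[]].
  - move=> [i /= ni Di]; split; first by left; exists i.
    move=> Dn; have E := disj _ _ _ (piece_core_sub (P i) Di) (piece_core_sub (P n) Dn).
    by rewrite E ltnn in ni.
  - by move=> [].
  - by move=> Dn; split=> //; right.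
have := piece_core_prob (P n); clear -IH; lra.
Qed.

(** At each point at most one summand is nonzero, so the bounds of a single piece hold for the
    sum. *)
Lemma pieces_displacement m (e : R) (C D : nat -> set T) phi Dphi (u : nat -> X) (n : nat) :
  0 <= e -> (forall i, piece mu m e (C i) (D i) (phi i) (Dphi i) (u i)) ->
  (forall i j t, C i t -> C j t -> i = j) ->
  exists W DW, [/\ C1 W DW, forall t, `|W t| <= e,
    forall j t, (j < m)%N -> `|DW j t| <= e, forall t, DW m t = 0 &
    forall i t, (i < n)%N -> D i t -> W t = u i].
Proof.
move=> e0 P disj.
have off i j t : i != j -> (phi i t = 0 /\ forall k, Dphi i k t = 0) \/
    (phi j t = 0 /\ forall k, Dphi j k t = 0).
  move=> ij; case: (pselect (C i t)) => [Ci|nC]; last by left; exact: piece_off nC.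
  right; apply: (piece_off (P j)) => Cj; by rewrite (disj _ _ _ Ci Cj) eqxx in ij.
exists (fun t => \sum_(i < n) phi i t *: u i),
  (fun j t => \sum_(i < n) (Dphi i j t *: u i + phi i t *: 0)); split.
- exact: (C1_sum n (fun i => C1_scale (piece_C1 (P i)) (C1_const (u i)))).
- move=> t; apply: (norm_sum_disjoint n (a := fun i => phi i t *: u i)) => //.
    by move=> i; exact: piece_size (P i) t.
  by move=> i j /(off _ _ t)[[-> _]|[-> _]]; rewrite scale0r; [left|right].
- move=> j t jm; under eq_bigr do rewrite scaler0 addr0.
  apply: (norm_sum_disjoint n (a := fun i => Dphi i j t *: u i)) => //.
    by move=> i; exact: piece_slope (P i) _ _ jm.
  by move=> i i' /(off _ _ t)[[_ ->]|[_ ->]]; rewrite scale0r; [left|right].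
- by move=> t; rewrite big1// => i _; rewrite (piece_flat (P i)) scale0r scaler0 addr0.
- move=> i t ni Di; rewrite (sum_single (a := fun i => phi i t *: u i) ni).
    by rewrite (piece_on (P i) Di) scale1r.
  move=> j ji; rewrite (piece_off (P j) _).1 ?scale0r//.
  by move=> /(disj _ _ _ (piece_core_sub (P i) Di))/esym/eqP; rewrite (negPf ji).
Qed.

End cell_family.

(** * The perturbed surface *)

Section steep_points.
Context {R : realType} {X : completeNormedModType R}.
Variables (mu : probability (cube_measurable R) R).
Hypothesis mu_product : is_product_lebesgue mu.
Notation T := (cube_measurable R).
Implicit Types (g h : surface X).

Lemma finite_lower_bound (a : nat -> R) n :
  exists2 d : R, 0 < d & forall i, (i < n)%N -> 0 < a i -> d <= a i.
Proof.
elim: n => [|n [d d0 hd]]; first by exists 1.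
case: (ltP 0 (a n)) => an.
  exists (Num.min d (a n)); first by rewrite lt_min d0.
  move=> i; rewrite ltnS leq_eqVlt => /orP[/eqP->|ni] ai; first by rewrite ge_min lexx orbT.
  by rewrite ge_min hd.
exists d => // i; rewrite ltnS leq_eqVlt => /orP[/eqP->|ni]; last exact: hd.
by rewrite ltNge an.
Qed.

Lemma pull_shift_prob g m A : borel A -> prob mu (shift m @^-1` pull g A) = prob mu (pull g A).
Proof. by move=> bA; rewrite /prob mu_shift//; exact: measurable_pull. Qed.

Lemma measurable_pull_shift g m A : borel A -> measurable (shift m @^-1` pull g A : set T).
Proof.
move=> bA; rewrite -[X in measurable X]setTI.
exact: (@measurable_shift R m measurableT _ (measurable_pull g bA)).
Qed.

Lemma label_near m l k (t t' : cube R) : label m l k t = label m l k t' -> (m <= l k)%N ->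
  (forall j, (j < m)%N -> `|coord (shift m t') j - coord (shift m t) j| <= 2^-1 ^+ k) /\
  (forall j, (m <= j < l k)%N ->
     `|coord (shift m t') j - coord (shift m t) j| <= 2^-1 ^+ l k).
Proof.
move=> tt' ml; have h j : (j < (l k).+1)%N -> (0 < mesh m l k j)%N ->
    `|coord t' j - coord t j| <= (mesh m l k j)%:R^-1.
  move=> jl cj; have := code_close jl tt'.
  by rewrite -ler_pdivlMr ?ltr0n// div1r.
split=> j.
  move=> jm; rewrite !coord_shift jm.
  have := h j (ltn_trans jm (ml : (m < (l k).+1)%N)).
  by rewrite /mesh jm expn_gt0/= natrX exprVn; apply.
move=> /andP[mj jl]; rewrite !coord_shift ltnNge mj/=.
have mE : mesh m l k j.+1 = (2 ^ l k)%N.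
  by rewrite /mesh ltnNge (leqW mj)/= gtn_eqF.
have := h j.+1 jl; rewrite mE.
by rewrite expn_gt0/= natrX exprVn; apply.
Qed.

(* [g \o shift m] has the law of [g] and does not depend on the [m]-th coordinate, which is free
   to carry the steep increments [u i] of the cells. *)
Lemma steep_perturbation f (L eps a : R) (V : nat -> X) P F O g (M : nat)
    (S U : set (surface X)) :
  1 <= L -> is_lipschitz L f -> 0 < eps -> 0 < a ->
  (forall v (e : R), 0 < e -> exists n, `|v - V n| < e) ->
  borel P -> (forall x, ~ P x -> regular2 f x) -> mu (pull g P) = 0%E ->
  borel F -> F `<=` large_slope f eps -> open O -> F `<=` O ->
  open U -> U g -> U `<=` closure S ->
  exists m h Z, [/\ (M <= m)%N /\ measurable (Z : set T), U h /\ S h,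
    forall t, Z t -> O (g (shift m t)),
    prob mu (pull g F) - a <= 2 * prob mu Z &
    eps / (16 * L) * prob mu Z <=
      prob mu (Z `&` pull h (~` small_slopes f V (eps / 64)))].
Proof.
move=> L1 fL eps0 a0 dV bP regP nullP bF steepF oO FO oU Ug Uc.
have L0 : 0 < L by lra.
have [n [e e0 eU]] := nbhs_surface_ball (open_nbhs_nbhs (conj oU Ug)).
have e30 : 0 < e / 3 by lra.
have [M1 hM1] := shift_uniform_partial g n e30.
pose m := maxn n (maxn M M1).
have [nm [Mm M1m]] : (n <= m)%N /\ (M <= m)%N /\ (M1 <= m)%N.
  by rewrite /m !leq_max !leqnn !orbT.
have m1 : (1 : R) <= m.+1%:R by rewrite ler1n.
have m10 : (0 : R) < 32 * m.+1%:R by lra.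
(* The slopes of a bump are bounded by [32 * m.+1 * 2^k * |u|], which is at most [e / 3] when
   [|u| <= kap0 * 2^-k]. *)
pose kap0 := Num.min 1 (e / 3 / (32 * m.+1%:R)).
have kap0_gt0 : 0 < kap0 by rewrite lt_min ltr01 divr_gt0.
have kap0_le1 : kap0 <= 1 by rewrite ge_min lexx.
have kap0m : 32 * m.+1%:R * kap0 <= e / 3.
  by rewrite mulrC -ler_pdivlMr// ge_min lexx orbT.
have kap0e : kap0 <= e / 3.
  apply: le_trans kap0m; rewrite ler_peMl ?(ltW kap0_gt0)//; clear -m1; lra.
have den0 : 0 < 32 * (1 + L) by clear -L0; lra.
(* The precision, relative to [2^-k], with which [steep_nearby] needs to know [g] on a cell. *)
pose kap := eps * kap0 / (32 * (1 + L)).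
have kap_gt0 : 0 < kap by rewrite divr_gt0// mulr_gt0.
have kapE : 32 * (1 + L) * kap <= eps * kap0 by rewrite /kap mulrC divfK// gt_eqF.
have levels k : exists l, forall t t', close l t t' -> `|g t' - g t| <= kap * 2^-1 ^+ k.
  by apply: uniform_modulus; [exact: surface_continuous|rewrite mulr_gt0// half_gt0].
have [l [hl l_mono ml]] := monotone_levels levels
  (fun k l l' ll' fit t t' tt' => fit t t' (close_mono ll' tt')) m.
(* The increment has to be large on the whole cell, so that goodness depends only on the label. *)
pose Good k (t : cube R) (u : X) := [/\ kap0 * 2^-1 ^+ k / 2 <= `|u|, `|u| <= kap0 * 2^-1 ^+ k &
  forall t', label m l k t = label m l k t' ->
    eps / 2 * `|u| <= `|f (g (shift m t') + u) - f (g (shift m t'))| /\ O (g (shift m t'))].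
have Good_inv k t t' u : label m l k t = label m l k t' -> Good k t u -> Good k t' u.
  by move=> tt' [h1 h2 h3]; split=> // t'' t't''; apply: h3; rewrite tt'.
have Good_size k t u : Good k t u -> 32 * m.+1%:R * `|u| * (2 ^ k)%:R <= e / 3 /\ `|u| <= e / 3.
  move=> [_ h2 _]; split.
    apply: le_trans kap0m; rewrite -!mulrA ler_pM2l// ler_pM2l ?ltr0n//.
    rewrite -ler_pdivlMr; last by rewrite ltr0n expn_gt0.
    by rewrite natrX -exprVn.
  apply: (le_trans h2); apply: le_trans kap0e; rewrite ler_piMr ?(ltW kap0_gt0)//.
  by have := half_mono (R := R) (leq0n k); rewrite expr0.
have [C [D [phi [Dphi [u [pieces disj goodC cover]]]]]] :=
  cell_family mu_product l_mono ml (ltW e30) Good_inv Good_size.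
have mC i : measurable (C i) := piece_measurable (pieces i).
have mD i : measurable (D i) := piece_core_measurable (pieces i).
have mCn k : measurable (\bigcup_(i < k) C i) by exact: bigcup_measurable (fun i _ => mC i).
have mDn k : measurable (\bigcup_(i < k) D i) by exact: bigcup_measurable (fun i _ => mD i).
have mCU : measurable (\bigcup_k \bigcup_(i < k) C i) by exact: bigcup_measurable (fun k _ => mCn k).
(* Finitely many cells suffice up to measure [a]; finiteness yields a common positive lower bound
   for the norms of their increments. *)
have [I hI] := prob_increasing mu mCn (fun k t '(ex_intro2 i ik Ct) =>
  ex_intro2 _ _ i (ltnW ik) Ct) a0.
pose Z := \bigcup_(i < I) D i.
have mZ : measurable Z by exact: mDn.
have probZ : prob mu (pull g F) - a <= 2 * prob mu Z.
  apply: le_trans (pieces_prob I pieces disj); rewrite lerBlDr -(pull_shift_prob g m bF).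
  have mP := measurable_pull_shift g m bP.
  have mCD := measurableD mCU (mCn I).
  apply: (@le_trans _ _ (prob mu (\bigcup_(i < I) C i) +
      prob mu ((\bigcup_k \bigcup_(i < k) C i) `\` (\bigcup_(i < I) C i) `|`
        shift m @^-1` pull g P))).
    apply: prob_le_U => //; first exact: measurableU.
      exact: measurable_pull_shift.
    move=> t Ft; have [Pt|nPt] := pselect (P (g (shift m t))); first by right; right.
    have [CI|nCI] := pselect ((\bigcup_(i < I) C i) t); [by left|right; left; split=> //].
    have [k [v [v1 v2 v3]]] := steep_nearby m (ltW L0) fL eps0 kap_gt0 kap0_gt0 kapE kap0_le1
      hl (regP _ nPt) (steepF _ Ft) oO (FO _ Ft).
    have : Good k t v.
      split=> // t' tt'; have [near_t' far_t'] := label_near tt' (ml k).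
      exact: v3.
    by move=> /cover[i Ci]; exists i.+1 => //; exists i => /=.
  rewrite lerD2l (le_trans (probU _ mCD mP))//.
  by rewrite /prob mu_shift ?nullP//= ?addr0//; exact: measurable_pull.
have [W [DW [CW We DWe DWm Won]]] := pieces_displacement I (ltW e30) pieces disj.
have [g1 [g1E Dg1]] := displaced_surface g m CW.
have g1ball : surface_ball n e g g1.
  by apply: (displaced_ball nm e0 g1E Dg1) => // t; exact: hM1.
have [d d0 hd] := finite_lower_bound (fun i => `|u i|) I.
(* Serves all pieces at once: [tau <= |u i|] and [8 * L * tau <= eps * |u i|], as [core_slice]
   asks. *)
pose tau := Num.min d (eps * d / (8 * L)).
have L80 : 0 < 8 * L by clear -L0; lra.
have tau0 : 0 < tau by rewrite lt_min d0 divr_gt0// mulr_gt0.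
have Ug1 : U g1 by exact: eU.
(* [g1] need not belong to [S], but surfaces of [S] are dense near it. The ball for [m.+1] also
   controls the [m]-th partial derivative, on which the estimate along lines rests. *)
have [h [Sh [hball Uh]]] := Uc _ Ug1 _ (filterI (surface_ball_nbhs m.+1 g1 tau0)
  (open_nbhs_nbhs (conj oU Ug1))).
have [near0 nearD] := surface_ball_elim hball.
have bE : borel (~` small_slopes f V (eps / 64)).
  by apply: borelC; apply: borel_small_slopes; exact: is_lipschitz_continuous (ltW L0) fL.
have mE := measurable_pull h bE.
exists m, h, Z; split=> //.
  move=> t [i Ii Di]; have [k [_ _ /(_ t erefl)[]]] := goodC _ _ (piece_core_sub (pieces i) Di).
  by [].
have mZE : measurable (Z `&` pull h (~` small_slopes f V (eps / 64))) by exact: measurableI.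
rewrite -lee_fin EFinM -!probE//; apply: (slice_ge (m := m) mu_product) => //.
  by rewrite divr_ge0 ?(ltW eps0)// mulr_ge0// ltW.
move=> t [i Ii Di].
have -> : slice m t (Z `&` pull h (~` small_slopes f V (eps / 64))) =
    slice m t (h @^-1` (~` small_slopes f V (eps / 64))).
  apply/seteqP; split=> x [x01]; first by move=> [_].
  by move=> Ex; split=> //; split=> //; exists i => //; exact: piece_move (pieces i) _ _ Di.
have [k [uk _ /(_ t erefl)[fu _]]] := goodC _ _ (piece_core_sub (pieces i) Di).
have u0 : 0 < `|u i|.
  by apply: lt_le_trans uk; rewrite divr_gt0// mulr_gt0// half_gt0.
have du : d <= `|u i| by exact: hd.
apply: (core_slice (tau := tau) (y := g (shift m t)) (u := u i) L0 fL eps0 dV) => //.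
- by rewrite (le_trans _ du)// ge_min lexx.
- rewrite mulrC -ler_pdivlMr// (@le_trans _ _ (eps * d / (8 * L)))//.
    by rewrite ge_min lexx orbT.
  by rewrite ler_pM2r ?invr_gt0// ler_pM2l.
- move=> x x01; have := near0 (move m t x); rewrite g1E shift_move_eq coord_move eqxx.
  rewrite clamp_val_id// (Won i)//; last exact: piece_move (pieces i) _ _ Di.
  exact: ltW.
- move=> x x01; have := nearD m (move m t x) (ltnSn m); rewrite Dg1 eqxx DWm scaler0 addr0.
  rewrite /Dshift ltnn eqxx add0r scale1r (Won i)//; last exact: piece_move (pieces i) _ _ Di.
  exact: ltW.
Qed.

End steep_points.

(** * Nullity of the steep points with small directional slopes *)

Section steep_null.
Context {R : realType} {X : completeNormedModType R}.
Variables (mu : probability (cube_measurable R) R).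
Hypothesis mu_product : is_product_lebesgue mu.
Notation T := (cube_measurable R).
Implicit Types (g h : surface X).

Lemma shift_nbhs g (U : set (surface X)) : nbhs g U -> exists M, forall m, (M <= m)%N ->
  exists2 h, U h & forall t, h t = g (shift m t).
Proof.
move=> /nbhs_surface_ball[n [e e0 eU]]; have e20 : 0 < e / 2 by lra.
have [M hM] := shift_uniform_partial g n e20; exists M => m Mm.
have [h [hE Dh]] := C1_surface (C1_shift m (surface_C1 g)); exists h; last by move=> t; rewrite hE.
apply: eU; apply: (@surface_ball_intro _ _ _ _ (e / 2)); first by lra.
  by move=> t; rewrite hE; have [] := hM m t Mm.
by move=> j t jn; rewrite Dh; have [_] := hM m t Mm; apply.
Qed.

(** If [pull g B] had measure [beta > 0], the perturbation would give a set of measure about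
    [c * beta / 2] on which [h] leaves [E]. There either [g] is in [E], and the point belongs to a
    symmetric difference that is small as [h] is near [g]; or [g] is not in [F] while [g \o shift m]
    is in [O]. The latter is rare too: [shift m] preserves [mu], which makes the part in [O] but not
    in [F] small, and [g \o shift m] is near [g], which makes the part in [F] small. *)
Lemma steep_null f (L eps : R) (V : nat -> X) P :
  1 <= L -> is_lipschitz L f -> 0 < eps ->
  (forall v (e : R), 0 < e -> exists n, `|v - V n| < e) ->
  borel P -> (forall x, ~ P x -> regular2 f x) ->
  (exists2 S : set (surface X), residual S & forall g, S g -> mu (pull g P) = 0%E) ->
  exists2 S : set (surface X), residual S & forall g, S g ->
    mu (pull g (small_slopes f V (eps / 64) `&` large_slope f eps)) = 0%E.
Proof.
move=> L1 fL eps0 dV bP regP [SP rSP nullP].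
have L0 : 0 < L by lra.
have cf := is_lipschitz_continuous (ltW L0) fL.
set E := small_slopes f V (eps / 64).
have bE : borel E by exact: borel_small_slopes.
have bB : borel (E `&` large_slope f eps) by apply: borelI => //; exact: borel_large_slope.
have [SE rSE contE] := rel_cont_borel mu bE.
pose S0 := SE `&` SP; have rS0 : residual S0 by exact: residualI.
exists [set g | S0 g /\ locally_dense S0 g]; first exact: residual_locally_dense.
move=> g [[SEg SPg] [U3 [oU3 U3g] U3S]].
set B := E `&` large_slope f eps.
rewrite probE; last exact: measurable_pull.
congr EFin; apply/eqP; rewrite eq_le prob_ge0 andbT leNgt; apply/negP => beta0.
set beta := prob mu (pull g B) in beta0.
pose c := Num.min 1 (eps / (16 * L)).
have c0 : 0 < c by rewrite lt_min ltr01 divr_gt0// mulr_gt0.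
have c1 : c <= 1 by rewrite ge_min lexx.
have cL : c <= eps / (16 * L) by rewrite ge_min lexx orbT.
(* The final comparison is [c * (beta - 2 * a) <= 6 * a]; as [c <= 1], any denominator above 8
   contradicts it. *)
pose a := c * beta / 100; have a0 : 0 < a by rewrite divr_gt0// mulr_gt0.
have [F [W [cF oW FB BW hF]]] := borel_regular mu g bB a0.
have bF := borel_closed cF.
have probF : beta - a <= prob mu (pull g F).
  have bD := borelD (borel_open oW) bF.
  have : beta <= prob mu (pull g F) + prob mu (pull g (W `\` F)).
    apply: prob_le_U; try exact: measurable_pull.
    move=> t Bt; have [Ft|nFt] := pselect (F (g t)); [by left|right; split=> //].
    exact: BW.
  move: hF; clear; lra.
have mfar k : measurable (pull g (far F k.+1%:R^-1) : set T).
  by apply: measurable_pull; apply: borel_closed; exact: closed_far.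
have [k hk] := prob_increasing mu mfar (fun k t => @far_mono _ _ F k (g t)) a0.
pose O := ~` far F k.+1%:R^-1; have oO : open O by apply: closed_openC; exact: closed_far.
have FO : F `<=` O.
  move=> x Fx /(_ x Fx); rewrite subrr normr0 leNgt invr_gt0; by rewrite ltr0n.
have [U1 nU1 hU1] := contE g SEg a a0.
have [U2 nU2 hU2] := closed_upper mu g cF a0.
have [M hM] := shift_nbhs nU2.
pose U := U3 `&` U1^°.
have oU : open U by apply: openI => //; exact: open_interior.
have Ug : U g by split=> //; exact: nbhs_singleton (nbhs_interior nU1).
have US : U `<=` closure S0 by move=> x [/U3S].
have steepF : F `<=` large_slope f eps by move=> x /FB[].
have [m [h [Z [[Mm mZ] [[_ U1h] [SEh _]] ZO probZ hZ]]]] :=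
  steep_perturbation mu_product M L1 fL eps0 a0 dV bP regP (nullP g SPg) bF steepF oO FO oU Ug US.
have [G U2G GE] := hM m Mm.
have bOF : borel (O `\` F) by apply: borelD => //; exact: borel_open.
have mE := measurable_pull h (borelC bE).
have A1 : prob mu (shift m @^-1` pull g (O `\` F)) <= a.
  rewrite pull_shift_prob//; apply: le_trans hk; apply: prob_le.
  - exact: measurable_pull.
  - apply: measurableD => //; exact: bigcupT_measurable.
  - move=> t [Ot nF]; split=> //.
    have : (~` F) (g t) by [].
    by rewrite -(far_closedE cF) => -[k' _ fk']; exists k'.
have A2 : prob mu (pull G F `\` pull g F) <= a by exact: hU2.
have A3 : prob mu (sym_diff g h E) <= a by apply: hU1 => //; exact: interior_subset.
have m1 := measurable_pull_shift g m bOF.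
have m2 : measurable (pull G F `\` pull g F) by apply: measurableD; exact: measurable_pull.
have m3 := measurable_sym_diff g h bE.
have total : prob mu (Z `&` pull h (~` E)) <= 3 * a.
  apply: (@le_trans _ _ (prob mu (shift m @^-1` pull g (O `\` F)) +
      prob mu ((pull G F `\` pull g F) `|` sym_diff g h E))); last first.
    have := probU mu m2 m3; move: A1 A2 A3; clear; lra.
  apply: prob_le_U => //; [exact: measurableU|exact: measurableI|].
  move=> t [Zt nEt]; have [Eg|nEg] := pselect (E (g t)).
    by right; right; left; split.
  have nFg : ~ F (g t) by move=> /FB[].
  have [FG|nFG] := pselect (F (g (shift m t))).
    by right; left; split=> //; rewrite /pull/= GE.
  by left; split=> //; exact: ZO.
have pZ0 := prob_ge0 mu Z.
have cZ : c * prob mu Z <= eps / (16 * L) * prob mu Z by rewrite ler_wpM2r.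
have cbeta : c * (beta - 2 * a) <= 2 * (c * prob mu Z).
  rewrite (mulrCA 2 c) (ler_pM2l c0); move: probZ probF; clear; lra.
have ca : c * a <= a by rewrite ler_piMl// ltW.
have bE' : c * beta = 100 * a by rewrite /a; field.
move: a0 ca bE' cbeta cZ hZ total; rewrite -/E.
move: (_ / _ * prob mu Z) (prob mu (Z `&` _)) (c * prob mu Z); clear.
move=> p q z; rewrite mulrBr (mulrCA c 2) => *; lra.
Qed.

End steep_null.

(** * Frechet differentiability *)

Section frechet.
Context {R : realType} {X : normedModType R}.
Implicit Types (f : X -> R) (A : set X).

Lemma frechetP f x : differentiable f x <-> exists2 psi : {linear X -> R}, continuous psi &
  forall e : R, 0 < e -> exists2 r : R, 0 < r &
    forall u, `|u| < r -> `|f (x + u) - f x - psi u| <= e * `|u|.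
Proof.
split=> [df|[psi cpsi hpsi]].
  exists ('d f x); first exact: diff_continuous.
  move=> e e0; have [_ /eqaddoP/(_ e e0)] := (diff_locallyP x f).1 df.
  move=> /nbhs_ballP[r /= r0 hr]; exists r => // u ur.
  have := hr u; rewrite -ball_normE/= sub0r normrN => /(_ ur).
  by rewrite (addrC x u) -addrA -opprD.
have E : f \o (fun y => y + x) = cst (f x) + psi +o_ 0 id.
  apply/eqaddoP => e e0; have [r r0 hr] := hpsi e e0.
  apply/nbhs_ballP; exists r => //= u; rewrite -ball_normE/= sub0r normrN => /hr.
  by rewrite (addrC x u) -addrA -opprD.
have dE := diff_unique cpsi E.
by apply/diff_locallyP; rewrite dE.
Qed.

Lemma differentiable_local (G : set X) f f' x : open G -> G x ->
  (forall y, G y -> f y = f' y) -> differentiable f x -> differentiable f' x.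
Proof.
move=> oG Gx ff' /frechetP[psi cpsi hpsi]; apply/frechetP; exists psi => // e e0.
have [r r0 hr] := hpsi e e0.
have /nbhs_ballP[d /= d0 hd] := open_nbhs_nbhs (conj oG Gx).
exists (Num.min r d); first by rewrite lt_min r0.
move=> u; rewrite lt_min => /andP[ur ud]; rewrite -!ff'//; first exact: hr.
by apply: hd; rewrite -ball_normE/= opprD addrA subrr sub0r normrN.
Qed.

(** McShane's extension by the infimum of [f y + L * |x - y|]. The last clause keeps the infimum
    accessible: for [f = 0] it yields lower bounds on the distance to [A]. *)
Lemma lipschitz_extension A f (L : R) : 0 <= L -> A !=set0 ->
  (forall x y, A x -> A y -> `|f x - f y| <= L * `|x - y|) ->
  exists F, [/\ is_lipschitz L F, forall x, A x -> F x = f x &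
    forall x b, (forall y, A y -> b <= f y + L * `|x - y|) -> b <= F x].
Proof.
move=> L0 [a Aa] fL; pose E x := [set f y + L * `|x - y| | y in A].
have E0 x : E x !=set0 by exists (f a + L * `|x - a|), a.
have Elb x : has_lbound (E x).
  exists (f a - L * `|x - a|) => _ [y Ay <-].
  have := fL _ _ Aa Ay; have := ler_distD x a y; rewrite (distrC a x) => tri.
  have := ler_wpM2l L0 tri; rewrite mulrDr ler_norml => t1 /andP[_ t2].
  move: t1 t2; move: (_ * _) (_ * _) (_ * _) => p q r; lra.
pose F x := inf (E x).
have Fle x y : A y -> F x <= f y + L * `|x - y|.
  by move=> Ay; apply: ge_inf => //; exists y.
have leF x b : (forall y, A y -> b <= f y + L * `|x - y|) -> b <= F x.
  by move=> hb; apply: lb_le_inf => // _ [y Ay <-]; exact: hb.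
exists F; split=> //.
  have half x y : F x - L * `|x - y| <= F y.
    apply: leF => z Az; have := Fle x z Az.
    have := ler_wpM2l L0 (ler_distD y x z); rewrite mulrDr.
    move: (_ * _) (_ * _) (_ * _) => p q r; lra.
  move=> x y; have := half x y; have := half y x; rewrite (distrC y x) ler_norml.
  move: (_ * _) => p h1 h2; apply/andP; split; lra.
move=> x Ax; apply/eqP; rewrite eq_le; apply/andP; split.
  by have := Fle x x Ax; rewrite subrr normr0 mulr0 addr0.
apply: leF => y Ay; have := fL _ _ Ax Ay; rewrite ler_norml => /andP[_].
by move: (_ * _) => p; lra.
Qed.

(* A differentiable function has zero derivative at a minimum, whereas the distance to a porous
   set grows at least linearly along a sequence converging to any of its points. *)
Lemma porous_not_differentiable A : porous A -> A !=set0 ->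
  exists2 F, is_lipschitz 1 F & forall x, A x -> ~ differentiable F x.
Proof.
move=> [c /andP[c0 c1] pA] A0.
have zL x y : A x -> A y -> `|0 - 0 : R| <= 1 * `|x - y|.
  by move=> _ _; rewrite subrr normr0 mulr_ge0.
have [F [FL FA leF]] := @lipschitz_extension A (fun=> 0) 1 ler01 A0 zL.
exists F => // x Ax /frechetP[psi _ hpsi].
have F0 y : 0 <= F y by apply: leF => z _; rewrite add0r mul1r.
have psi0 u : psi u = 0.
  have low v : 0 <= psi v.
    rewrite -oppr_le0; apply/ler_addgt0Pr => e e0; rewrite add0r.
    have v1 : 0 < `|v| + 1 by apply: ltr_wpDl.
    have [r r0 hr] := hpsi _ (divr_gt0 e0 v1).
    pose s := r / 2 / (`|v| + 1); have s0 : 0 < s by rewrite !divr_gt0.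
    have sv : `|s *: v| < r.
      rewrite normrZ (gtr0_norm s0).
      have : s * (`|v| + 1) = r / 2 by rewrite divfK// gt_eqF.
      rewrite mulrDr mulr1; move: s0 r0; clear; move: (_ * `|v|) => z; lra.
    have := hr _ sv; rewrite (FA _ Ax) subr0 linear_mul normrZ (gtr0_norm s0) ler_norml.
    move=> /andP[_ h]; have h0 := F0 (x + s *: v).
    have h1 : s * - psi v <= s * e.
      have h2 : e / (`|v| + 1) * (s * `|v|) <= s * e.
        rewrite mulrCA ler_pM2l// mulrAC ler_pdivrMr// ler_pM2l// lerDl//.
      move: h h0 h2; rewrite mulrN; move: (e / _ * _) (F _) (s * psi v) => p q w; lra.
    by rewrite ler_pM2l in h1.
  apply/eqP; rewrite eq_le low andbT -oppr_ge0 -linearN; exact: low.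
have [r r0 hr] := hpsi (c / 2) (divr_gt0 c0 (ltr0Sn R 1)).
have [y yx yA] := pA x Ax.
have [n _ /(_ n (leqnn n)) yr] := (cvgrPdist_lt _ _).1 yx r r0.
have far_y : c * `|y n - x| <= F (y n).
  apply: leF => z Az; rewrite add0r mul1r leNgt; apply/negP => near_z.
  have : (closed_ball_ Num.norm (y n) (c * `|y n - x|) `&` A) z by split=> //; exact: ltW.
  by rewrite yA.
(* If [y n] were [x], the ball of radius 0 around it would contain the point [x] of [A]. *)
have yx0 : 0 < `|y n - x|.
  rewrite normr_gt0; apply/eqP => yE.
  have : (closed_ball_ Num.norm (y n) (c * `|y n - x|) `&` A) x.
    by split=> //=; rewrite /closed_ball_/= yE normr0 mulr0.
  by rewrite yA.
have yr' : `|y n - x| < r by rewrite distrC.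
have := hr _ yr'; rewrite subrKC psi0 subr0 (FA _ Ax) subr0 ger0_norm// => /(le_trans far_y).
rewrite (ler_pM2r yx0); lra.
Qed.

End frechet.

(** * Stability of Gamma-null sets *)

Section gamma_null_sets.
Context {R : realType} {X : normedModType R}.
Variables (mu : probability (cube_measurable R) R).

Lemma gamma_null_sub (A B : set X) : A `<=` B -> gamma_null mu B -> gamma_null mu A.
Proof. by move=> AB [N bN BN]; exists N => //; exact: subset_trans BN. Qed.

Lemma gamma_null_bigcup (A : nat -> set X) : (forall n, gamma_null mu (A n)) ->
  gamma_null mu (\bigcup_n A n).
Proof.
move=> nA; have /choice[N hN] n : exists N, borel_gamma_null mu N /\ A n `<=` N.
  by have [N bN AN] := nA n; exists N.
have bN n : borel (N n) by have [[]] := hN n.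
have /choice[S hS] n : exists S : set (surface X), residual S /\
    forall g, S g -> mu [set t | N n (g t)] = 0%E.
  by have [[_ [S rS SN]] _] := hN n; exists S.
exists (\bigcup_n N n); last by move=> x [n _ Ax]; exists n => //; apply: (hN n).2.
split; first exact: borel_bigcup.
exists (\bigcap_n S n); first by apply: residual_bigcap => n; have [] := hS n.
move=> g Sg; have mN n : measurable (pull g (N n)) := measurable_pull g (bN n).
have : mu.-negligible (\bigcup_n pull g (N n)).
  apply: negligible_bigcup => n; apply/negligibleP => //.
  by have [_ /(_ g)] := hS n; apply; exact: Sg.
by move/negligibleP; apply; exact: bigcupT_measurable.
Qed.

Lemma gamma_null0 : gamma_null mu (set0 : set X).
Proof.
exists set0 => //; split; first exact: (borel_open open0).
exists setT; first exact: residualT.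
by move=> g _; exact: measure0.
Qed.

Lemma gamma_null_borel (N : set X) (S : set (surface X)) : borel N -> residual S ->
  (forall g, S g -> mu (pull g N) = 0%E) -> gamma_null mu N.
Proof. by move=> bN rS hS; exists N => //; split=> //; exists S. Qed.

End gamma_null_sets.

(** * Differentiability of Lipschitz functions on the whole space *)

Section lipschitz_frechet.
Context {R : realType} {X : completeNormedModType R}.
Variables (mu : probability (cube_measurable R) R).
Hypothesis mu_product : is_product_lebesgue mu.

Lemma regular_at_small_slopes (f : X -> R) x (psi phi : {linear X -> R}) V (eta : R) :
  regular_at f x psi -> (forall v, `|psi v - phi v| <= eta * `|v|) ->
  small_slopes (fun y => f y - phi y) V eta x.
Proof.
move=> reg near n _ k _; pose kap := k.+1%:R^-1 : R.
have kap0 : 0 < kap by rewrite invr_gt0 ltr0n.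
have [r r0 hr] := reg (V n) kap kap0; have [j] := ltr_add_invr r0; rewrite add0r => jr.
exists j => // s /= sj; rewrite -/kap.
have [->|s0] := eqVneq s 0; first by rewrite scale0r addr0 subrr normr0 mulr0.
have s_gt0 : 0 < `|s| by rewrite normr_gt0.
have := hr `|s| 0 s s_gt0 (lt_trans sj jr); rewrite normr0 addr0 => /(_ (normr_ge0 s) (lexx _)).
move=> h1; have h2 := near (V n); have h3 := ler_wpM2l (normr_ge0 s) h2.
rewrite -normrM mulrBr in h3.
have -> : f (x + s *: V n) - phi (x + s *: V n) - (f x - phi x) =
    (f (x + s *: V n) - f x - s * psi (V n)) + (s * psi (V n) - s * phi (V n)).
  by rewrite linearD linear_mul; move: (f _) (f _) (s * _) (s * _) (phi x) => a b c d e; lra.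
apply: le_trans (ler_normD _ _) _; move: h1 h3.
move: (`|f _ - _ - _|) (`|s * _ - _|) => a b; lra.
Qed.

(** The hypothesis on porous sets is applied to the single set [irregular f V]. As [regular2]
    survives the subtraction of a functional, the Borel set [P] built from it serves for all the
    functions [f - phi i]. Off the remaining null sets, [f - phi i] has no large slopes when [phi i]
    is close to [psi], so [psi] is the derivative. *)
Lemma lipschitz_gamma_ae (f : X -> R) (L : R) : separable_dual X -> 1 <= L -> is_lipschitz L f ->
  (forall A : set X, sigma_porous A -> gamma_null mu A) ->
  gamma_null mu [set x | ~ differentiable f x].
Proof.
move=> X_dual L1 fL null_porous; have L0 : 0 <= L by lra.
have [V dV] := separable_of_dual X_dual; have [phi [cphi dphi]] := dual_dense_seq X_dual.
have cf := is_lipschitz_continuous L0 fL.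
have nullO n k : gamma_null mu (oscillating f (V n) k).
  have [S rS hS] := generic_not_oscillating mu_product (V n) L0 fL.
  by apply: (gamma_null_borel _ rS) => [|g Sg]; [exact: borel_oscillating|exact: hS].
have [N [bN [SN rSN hSN]] irrN] := null_porous _ (irregular_sigma_porous V L0 fL).
have [P [bP [SP rSP hSP]] irrP] : gamma_null mu
    (N `|` \bigcup_n \bigcup_k oscillating f (V n) k).
  pose A (b : nat) := if b is 0%N then N else \bigcup_n \bigcup_k oscillating f (V n) k.
  apply: (@gamma_null_sub _ _ _ _ (\bigcup_b A b)).
    by move=> x [Nx|Ox]; [exists 0%N|exists 1%N].
  apply: gamma_null_bigcup => -[|b]; first exact: (gamma_null_borel bN rSN).
  by apply: gamma_null_bigcup => n; apply: gamma_null_bigcup.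
have regP x : ~ P x -> exists psi : {linear X -> R}, regular_at f x psi /\
    forall v, `|psi v| <= L * `|v|.
  move=> nPx; have nirr : ~ irregular f V x by move=> /irrN Nx; apply: nPx; apply: irrP; left.
  have /choice[D hD] n : exists d, directional f x (V n) d.
    apply: (not_oscillating_directional L0 fL) => k osc; apply: nPx; apply: irrP; right.
    by exists n => //; exists k.
  apply: (regular_derivative L0 fL dV (D := D)) => n; exact: regular_uniform L0 fL nirr (hD n).
pose eps k : R := k.+1%:R^-1; have eps0 k : 0 < eps k by rewrite invr_gt0 ltr0n.
pose g i x := f x - phi i x.
have nullS i k : gamma_null mu (small_slopes (g i) V (eps k / 64) `&` large_slope (g i) (eps k)).
  have [M M0 hM] := linear_bound (cphi i).
  have gL : is_lipschitz (L + M) (g i).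
    move=> x y; rewrite /g; have := fL x y; have := hM (x - y); rewrite linearB.
    move: (f x) (f y) (phi i x) (phi i y) (`|x - y|) => a b c d z h1 h2.
    rewrite (_ : a - c - (b - d) = (a - b) - (c - d)); last by lra.
    by apply: le_trans (ler_normB _ _) _; rewrite mulrDl lerD.
  have LM : 1 <= L + M by lra.
  have regg x : ~ P x -> regular2 (g i) x.
    move=> /regP[psi [reg _]]; apply: regular2_sub_linear; exact: regular_at_regular2 L0 fL reg.
  have [|S rS hS] := steep_null mu_product LM gL (eps0 k) dV bP regg.
    by exists SP.
  apply: (gamma_null_borel _ rS hS).
  have cg := is_lipschitz_continuous (le_trans ler01 LM) gL.
  by apply: borelI; [exact: borel_small_slopes|exact: borel_large_slope].
have nullB : gamma_null mu (P `|` \bigcup_i \bigcup_k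
    (small_slopes (g i) V (eps k / 64) `&` large_slope (g i) (eps k))).
  pose A (b : nat) := if b is 0%N then P else \bigcup_i \bigcup_k
    (small_slopes (g i) V (eps k / 64) `&` large_slope (g i) (eps k)).
  apply: (@gamma_null_sub _ _ _ _ (\bigcup_b A b)).
    by move=> x [Px|Bx]; [exists 0%N|exists 1%N].
  apply: gamma_null_bigcup => -[|b]; first exact: (gamma_null_borel bP rSP).
  by apply: gamma_null_bigcup => i; apply: gamma_null_bigcup.
apply: gamma_null_sub nullB => x; apply: contraPP => nx dx; apply: dx.
have nPx : ~ P x by move=> Px; apply: nx; left.
have [psi [reg psiL]] := regP x nPx.
have cpsi : continuous psi.
  apply/linear_bounded_continuous/linear_boundedP; near=> M => u.
  by rewrite (le_trans (psiL u))// ler_wpM2r.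
(* As [eps k < e / 2], the bound [eps k] for the increments of [f - phi i] and the bound
   [eps k / 64] for [psi - phi i] add up to at most [e]. *)
apply/frechetP; exists psi => // e e0; have [k] := ltr_add_invr (divr_gt0 e0 (ltr0Sn R 1)).
rewrite add0r -/(eps k) => ke; have e64 : 0 < eps k / 64 by rewrite divr_gt0.
have [i hi] := dphi psi cpsi _ e64.
have small := regular_at_small_slopes V reg hi.
have [|r r0 hr] := @not_large_slope _ _ (g i) (eps k) x.
  by move=> large; apply: nx; right; exists i => //; exists k.
exists r => // u ur; have := hr u ur; have := hi u; rewrite /g linearD.
have -> : f (x + u) - (phi i x + phi i u) - (f x - phi i x) = f (x + u) - f x - phi i u by lra.
have -> : f (x + u) - f x - psi u = (f (x + u) - f x - phi i u) - (psi u - phi i u) by lra.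
move=> h1 h2; apply: le_trans (ler_normB _ _) _.
have h3 : eps k * `|u| <= e / 2 * `|u| by rewrite ler_wpM2r// ltW.
move: h1 h2 h3 (mulr_ge0 (ltW e0) (normr_ge0 u)).
move: (eps k) (`|f _ - _ - _|) (`|psi _ - _|) (`|u|) => q a b z; lra.
Unshelve. all: by end_near. Qed.

End lipschitz_frechet.

Theorem corollary3p12 (R : realType) (X : completeNormedModType R)
    (mu : probability (cube_measurable R) R)
    (mu_product : is_product_lebesgue mu)
    (X_dual : separable_dual X) :
  (forall (G : set X) (f : X -> R), open G -> [lipschitz f x | x in G] ->
     gamma_ae_frechet mu G f)
  <->
  (forall A : set X, sigma_porous A -> gamma_null mu A).
Proof.
split=> [ae A [P porP ->]|null_porous G f oG].
  apply: gamma_null_bigcup => n; have [P0|Pn0] := pselect (P n !=set0); last first.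
    rewrite (_ : P n = set0); first exact: gamma_null0.
    by apply/seteqP; split=> // x Px; apply: Pn0; exists x.
  (* Countable unions of Gamma-null sets being Gamma-null, each porous piece uses its own distance
     function. *)
  have [F F1 ndF] := porous_not_differentiable (porP n) P0.
  apply: gamma_null_sub (ae setT F openT _); first by move=> x Px; split=> //; exact: ndF.
  rewrite /lipschitz_on; near=> M; move=> [x y] _; apply: le_trans (F1 x y) _.
  by rewrite /self_sub/= ler_wpM2r.
move=> /pinfty_ex_gt0[M M0 fM]; have [G0|nG] := pselect (G !=set0); last first.
  rewrite /gamma_ae_frechet; apply: (gamma_null_sub (B := set0)); last exact: gamma_null0.
  by move=> x [Gx _]; apply: nG; exists x.
have fL x y : G x -> G y -> `|f x - f y| <= (1 + M) * `|x - y|.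
  move=> Gx Gy; apply: le_trans (fM (x, y) (conj Gx Gy)) _.
  by rewrite /self_sub/= ler_wpM2r// lerDr.
have M1 : 1 <= 1 + M by rewrite lerDl ltW.
(* Passing to an extension of [f] from [G] to [X] is harmless, since differentiability at a point of
   the open set [G] is local. *)
have [F [FL FE _]] := lipschitz_extension (le_trans ler01 M1) G0 fL.
apply: gamma_null_sub (lipschitz_gamma_ae mu_product X_dual M1 FL null_porous).
move=> x [Gx ndf] dF; apply: ndf; exact: differentiable_local oG Gx FE dF.
Unshelve. all: by end_near. Qed.
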